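(* Every closed Lagrangian submanifold $M^3$ in the homogeneous nearly Kähler sphere $\mathbb S^6(1)$ satisfies $$0\ge\int_M\Big(\tfrac{13}{180}|\nabla s|^2+\tfrac1{180}\,s|T|^2+F(s,q,r)\Big)\,\mathrm dM .$$ Moreover, if $M$ is connected and $F(s,q,r)\ge0$ on $M$, then $T=0$ on $M$. Here $s=|h|^2$, $q$, $r$ are the traces of the first three powers of $S$, $T$ is the modified covariant derivative of $h$, and $F(s,q,r)$ is the function $$F(s,q,r)=-\tfrac{11}{36}s^3+\tfrac{55}{36}sq-3r+\tfrac5{24}s^2+\tfrac{25}{24}q+\tfrac{25r}{16s}\quad (s>0),\qquad F=0\ \text{ where } s=0 .$$
   Context: Everything is smooth; closed means compact without boundary. Identify $\mathbb R^7$ with the imaginary Cayley numbers with cross product $X\times Y=\tfrac12(XY-YX)$. The homogeneous nearly Kähler structure on $\mathbb S^6(1)\subset\mathbb R^7$ is the round metric $\langle\cdot,\cdot\rangle$ with $J_xX=x\times X$. Let $\overline\nabla$ be its Levi-Civita connection and $G(X,Y)=(\overline\nabla_XJ)Y$. A Lagrangian submanifold is an immersed 3-manifold $M^3$ with the induced metric such that $J(TM)=T^\perp M$. Let $\nabla,\nabla^\perp$ be the Levi-Civita and normal connections, $h(X,Y)=\overline\nabla_XY-\nabla_XY$ the second fundamental form, and $A_\xi$ the shape operator, $\langle A_\xi X,Y\rangle=\langle h(X,Y),\xi\rangle$. It is known that $M$ is orientable and minimal and that $G(X,Y)$ is normal for tangent $X,Y$. In a local orthonormal frame $\{e_1,e_2,e_3\}$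 of $M$ put $h_{ijk}=\langle h(e_i,e_j),Je_k\rangle$ (known to be totally symmetric and trace-free) and $S_{ij}=\sum_{a,b}h_{abi}h_{abj}$, $s=|h|^2=\operatorname{tr}S$, $q=\operatorname{tr}(S^2)$, $r=\operatorname{tr}(S^3)$. Set $(\nabla h)(X,Y,Z)=\nabla^\perp_Xh(Y,Z)-h(\nabla_XY,Z)-h(Y,\nabla_XZ)$ and $$T(X,Y,Z)=(\nabla h)(X,Y,Z)-\tfrac14\{G(X,A_{JZ}Y)+G(Y,A_{JX}Z)+G(Z,A_{JY}X)\},$$ $T_{lijk}=\langle T(e_l,e_i,e_j),Je_k\rangle$, $|T|^2=\sum_{l,i,j,k}T_{lijk}^2$. $\mathrm dM$ is the Riemannian volume element. *)

(* Defs.v *)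
From HB Require Import structures.
From mathcomp Require Import all_boot all_order all_algebra.
From mathcomp Require Import all_classical all_reals all_analysis.

Set Implicit Arguments.
Unset Strict Implicit.
Unset Printing Implicit Defensive.

Import Order.TTheory GRing.Theory Num.Theory.
Import numFieldNormedType.Exports.

Local Open Scope classical_set_scope.
Local Open Scope ring_scope.

(* Cayley-Dickson doubling: (a, b)(c, d) = (a c - d^* b, d a + b c^* ) and
   (a, b)^* = (a^*, - b). *)
Definition cd_conj (A : zmodType) (cj : A -> A) (x : A * A) : A * A :=
  (cj x.1, - x.2).

Definition cd_mul (A : zmodType) (mul : A -> A -> A) (cj : A -> A)
    (x y : A * A) : A * A :=
  (mul x.1 y.1 - mul (cj y.2) x.2, mul y.2 x.1 + mul x.2 (cj y.1)).

Definition complexes (R : realType) : zmodType := (R * R)%type.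
Definition quaternions (R : realType) : zmodType :=
  (complexes R * complexes R)%type.
Definition cayley (R : realType) : zmodType :=
  (quaternions R * quaternions R)%type.

Definition cconj (R : realType) : complexes R -> complexes R :=
  @cd_conj R id.
Definition cmul (R : realType) : complexes R -> complexes R -> complexes R :=
  @cd_mul R *%R id.
Definition hconj (R : realType) : quaternions R -> quaternions R :=
  @cd_conj (complexes R) (@cconj R).
Definition hmul (R : realType) :
    quaternions R -> quaternions R -> quaternions R :=
  @cd_mul (complexes R) (@cmul R) (@cconj R).
Definition omul (R : realType) : cayley R -> cayley R -> cayley R :=
  @cd_mul (quaternions R) (@hmul R) (@hconj R).

Definition imag_cayley (R : realType) (x : 'rV[R]_7) : cayley R :=
  let c k := x 0 (inord k) in
  (((0, c 0%N), (c 1%N, c 2%N)), ((c 3%N, c 4%N), (c 5%N, c 6%N))).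

Definition imag_part (R : realType) (a : cayley R) : 'rV[R]_7 :=
  \row_i [:: a.1.1.2; a.1.2.1; a.1.2.2; a.2.1.1; a.2.1.2; a.2.2.1; a.2.2.2]`_i.

(* The commutator of two imaginary Cayley numbers is imaginary, so that
   [imag_part] only forgets a zero real part. *)
Definition cross (R : realType) (x y : 'rV[R]_7) : 'rV[R]_7 :=
  let X := imag_cayley x in let Y := imag_cayley y in
  2^-1 *: imag_part (omul X Y - omul Y X).

Definition dot (R : realType) (n : nat) (x y : 'rV[R]_n) : R :=
  \sum_i x 0 i * y 0 i.

Fixpoint Ck_on (R : realType) (V W : normedModType R) (k : nat) (U : set V)
    (f : V -> W) : Prop :=
  if k is k'.+1 then
    (forall x, U x -> differentiable f x) /\
    (forall v, Ck_on k' U (fun x => 'D_v f x))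
  else forall x, U x -> {for x, continuous f}.

(* To be used with [U] open. *)
Definition smooth_on (R : realType) (V W : normedModType R) (U : set V)
    (f : V -> W) : Prop :=
  forall k, Ck_on k U f.

(* A smooth atlas, given by its parametrizations [param c : dom c -> cod c] and
   the inverse maps [coord c]; the values of [param c] outside [dom c] and of
   [coord c] outside [cod c] are irrelevant. *)
Record atlas3 (R : realType) (M : topologicalType) := Atlas3 {
  chart : Type;
  dom : chart -> set 'rV[R]_3;
  cod : chart -> set M;
  param : chart -> 'rV[R]_3 -> M;
  coord : chart -> M -> 'rV[R]_3;
  chart_at : M -> chart;
  dom_open : forall c, open (dom c);
  cod_open : forall c, open (cod c);
  param_cod : forall c u, dom c u -> cod c (param c u);
  coord_dom : forall c p, cod c p -> dom c (coord c p);
  paramK : forall c u, dom c u -> coord c (param c u) = u;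
  coordK : forall c p, cod c p -> param c (coord c p) = p;
  param_continuous : forall c u, dom c u -> {for u, continuous (param c)};
  coord_continuous : forall c p, cod c p -> {for p, continuous (coord c)};
  chart_atP : forall p, cod (chart_at p) p;
  transition_smooth : forall c c',
    smooth_on (dom c `&` param c @^-1` cod c') (coord c' \o param c)
}.

(* Everything below is computed in a chart, for a local parametrization
   [F : 'rV_3 -> S^6].  A vector field of the submanifold is given by its
   coordinates [X : 'rV_3 -> 'rV_3], and a vector field of S^6 along [F] by a
   function [W : 'rV_3 -> 'rV_7] such that [W u] is orthogonal to [F u]. *)

Definition coordv (R : realType) (i : 'I_3) : 'rV[R]_3 := delta_mx 0 i.

Definition coord_field (R : realType) (i : 'I_3) : 'rV[R]_3 -> 'rV[R]_3 :=
  fun=> coordv R i.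

Definition push (R : realType) (F : 'rV[R]_3 -> 'rV[R]_7)
    (X : 'rV[R]_3 -> 'rV[R]_3) : 'rV[R]_3 -> 'rV[R]_7 :=
  fun u => 'D_(X u) F u.

Definition metric (R : realType) (F : 'rV[R]_3 -> 'rV[R]_7) (u : 'rV[R]_3) :
    'M[R]_3 :=
  \matrix_(i, j) dot ('D_(coordv R i) F u) ('D_(coordv R j) F u).

(* Index raising: the coordinates g^{kl} a_l of the tangent vector dual to the
   covector [a]. *)
Definition sharp (R : realType) (F : 'rV[R]_3 -> 'rV[R]_7) (u : 'rV[R]_3)
    (a : 'rV[R]_3) : 'rV[R]_3 :=
  a *m invmx (metric F u).

Definition christoffel (R : realType) (F : 'rV[R]_3 -> 'rV[R]_7)
    (i j : 'I_3) (u : 'rV[R]_3) : 'rV[R]_3 :=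
  let dg (k a b : 'I_3) : R :=
    'D_(coordv R k) (fun v => metric F v a b : R^o) u in
  sharp F u (\row_l (2^-1 * (dg i j l + dg j i l - dg l i j))).

(* Levi-Civita connection of the induced metric, by its Christoffel symbols. *)
Definition nabla (R : realType) (F : 'rV[R]_3 -> 'rV[R]_7)
    (X Y : 'rV[R]_3 -> 'rV[R]_3) : 'rV[R]_3 -> 'rV[R]_3 :=
  fun u => 'D_(X u) Y u +
    \sum_i \sum_j (X u 0 i * Y u 0 j) *: christoffel F i j u.

(* Levi-Civita connection of the round sphere, on vector fields along [F]: the
   component tangent to S^6 of the flat derivative of R^7. *)
Definition nablabar (R : realType) (F : 'rV[R]_3 -> 'rV[R]_7)
    (X : 'rV[R]_3 -> 'rV[R]_3) (W : 'rV[R]_3 -> 'rV[R]_7) :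
    'rV[R]_3 -> 'rV[R]_7 :=
  fun u => 'D_(X u) W u - dot ('D_(X u) W u) (F u) *: F u.

Definition Jop (R : realType) (F W : 'rV[R]_3 -> 'rV[R]_7) :
    'rV[R]_3 -> 'rV[R]_7 :=
  fun u => cross (F u) (W u).

Definition Gtensor (R : realType) (F : 'rV[R]_3 -> 'rV[R]_7)
    (X Y : 'rV[R]_3 -> 'rV[R]_3) : 'rV[R]_3 -> 'rV[R]_7 :=
  fun u => nablabar F X (Jop F (push F Y)) u
         - Jop F (nablabar F X (push F Y)) u.

Definition sff (R : realType) (F : 'rV[R]_3 -> 'rV[R]_7)
    (X Y : 'rV[R]_3 -> 'rV[R]_3) : 'rV[R]_3 -> 'rV[R]_7 :=
  fun u => nablabar F X (push F Y) u - push F (nabla F X Y) u.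

(* Normal connection: [tan] holds the coordinates of the tangential component
   of [nablabar F X xi]. *)
Definition nablaperp (R : realType) (F : 'rV[R]_3 -> 'rV[R]_7)
    (X : 'rV[R]_3 -> 'rV[R]_3) (xi : 'rV[R]_3 -> 'rV[R]_7) :
    'rV[R]_3 -> 'rV[R]_7 :=
  let W := nablabar F X xi in
  let tan u := sharp F u (\row_l dot (W u) ('D_(coordv R l) F u)) in
  fun u => W u - push F tan u.

(* The vector field A_xi X with <A_xi X, Y> = <h(X, Y), xi> for all Y. *)
Definition shape_op (R : realType) (F : 'rV[R]_3 -> 'rV[R]_7)
    (xi : 'rV[R]_3 -> 'rV[R]_7) (X : 'rV[R]_3 -> 'rV[R]_3) :
    'rV[R]_3 -> 'rV[R]_3 :=
  fun u => sharp F u (\row_l dot (sff F X (coord_field l) u) (xi u)).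

Definition nabla_sff (R : realType) (F : 'rV[R]_3 -> 'rV[R]_7)
    (X Y Z : 'rV[R]_3 -> 'rV[R]_3) : 'rV[R]_3 -> 'rV[R]_7 :=
  fun u => nablaperp F X (sff F Y Z) u
         - sff F (nabla F X Y) Z u - sff F Y (nabla F X Z) u.

Definition Ttensor (R : realType) (F : 'rV[R]_3 -> 'rV[R]_7)
    (X Y Z : 'rV[R]_3 -> 'rV[R]_3) : 'rV[R]_3 -> 'rV[R]_7 :=
  fun u => nabla_sff F X Y Z u - 4^-1 *:
    (Gtensor F X (shape_op F (Jop F (push F Z)) Y) u
   + Gtensor F Y (shape_op F (Jop F (push F X)) Z) u
   + Gtensor F Z (shape_op F (Jop F (push F Y)) X) u).

Definition orthonormal_frame (R : realType) (F : 'rV[R]_3 -> 'rV[R]_7)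
    (U : set 'rV[R]_3) (e : 'I_3 -> 'rV[R]_3 -> 'rV[R]_3) : Prop :=
  (forall i, smooth_on U (e i)) /\
  (forall i j u, U u -> dot (push F (e i) u) (push F (e j) u) = (i == j)%:R).

Definition hcomp (R : realType) (F : 'rV[R]_3 -> 'rV[R]_7)
    (e : 'I_3 -> 'rV[R]_3 -> 'rV[R]_3) (i j k : 'I_3) (u : 'rV[R]_3) : R :=
  dot (sff F (e i) (e j) u) (Jop F (push F (e k)) u).

Definition Smat (R : realType) (F : 'rV[R]_3 -> 'rV[R]_7)
    (e : 'I_3 -> 'rV[R]_3 -> 'rV[R]_3) (u : 'rV[R]_3) : 'M[R]_3 :=
  \matrix_(i, j) \sum_a \sum_b hcomp F e a b i u * hcomp F e a b j u.

Definition Tcomp (R : realType) (F : 'rV[R]_3 -> 'rV[R]_7)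
    (e : 'I_3 -> 'rV[R]_3 -> 'rV[R]_3) (l i j k : 'I_3) (u : 'rV[R]_3) : R :=
  dot (Ttensor F (e l) (e i) (e j) u) (Jop F (push F (e k)) u).

Definition immersion_in_S6 (R : realType) (M : topologicalType)
    (A : atlas3 R M) (f : M -> 'rV[R]_7) : Prop :=
  [/\ forall p, dot (f p) (f p) = 1,
      forall c, smooth_on (dom c) (f \o param (a := A) c) &
      forall c u v, dom (a := A) c u -> 'D_v (f \o param c) u = 0 -> v = 0].

(* J(TM) is the orthogonal complement of TM in TS^6. *)
Definition lagrangian (R : realType) (M : topologicalType)
    (A : atlas3 R M) (f : M -> 'rV[R]_7) : Prop :=
  forall c u, dom (a := A) c u ->
    [set cross (f (param c u)) ('D_v (f \o param c) u) | v in setT] =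
    [set w | dot w (f (param c u)) = 0 /\
             forall v, dot w ('D_v (f \o param c) u) = 0].

(* The frames are indexed by the charts, [e c] being a frame on [dom c]. *)
Definition orthonormal_frames (R : realType) (M : topologicalType)
    (A : atlas3 R M) (f : M -> 'rV[R]_7)
    (e : chart A -> 'I_3 -> 'rV[R]_3 -> 'rV[R]_3) : Prop :=
  forall c, orthonormal_frame (f \o param c) (dom c) (e c).

Definition Sat (R : realType) (M : topologicalType) (A : atlas3 R M)
    (f : M -> 'rV[R]_7) (e : chart A -> 'I_3 -> 'rV[R]_3 -> 'rV[R]_3)
    (p : M) : 'M[R]_3 :=
  let c := chart_at A p in Smat (f \o param c) (e c) (coord c p).

Definition s_fun (R : realType) (M : topologicalType) (A : atlas3 R M)
    (f : M -> 'rV[R]_7) (e : chart A -> 'I_3 -> 'rV[R]_3 -> 'rV[R]_3)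
    (p : M) : R :=
  \tr (Sat f e p).

Definition q_fun (R : realType) (M : topologicalType) (A : atlas3 R M)
    (f : M -> 'rV[R]_7) (e : chart A -> 'I_3 -> 'rV[R]_3 -> 'rV[R]_3)
    (p : M) : R :=
  \tr (Sat f e p ^+ 2).

Definition r_fun (R : realType) (M : topologicalType) (A : atlas3 R M)
    (f : M -> 'rV[R]_7) (e : chart A -> 'I_3 -> 'rV[R]_3 -> 'rV[R]_3)
    (p : M) : R :=
  \tr (Sat f e p ^+ 3).

Definition T_normsq (R : realType) (M : topologicalType) (A : atlas3 R M)
    (f : M -> 'rV[R]_7) (e : chart A -> 'I_3 -> 'rV[R]_3 -> 'rV[R]_3)
    (p : M) : R :=
  let c := chart_at A p in
  \sum_l \sum_i \sum_j \sum_k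
    Tcomp (f \o param c) (e c) l i j k (coord c p) ^+ 2.

Definition T_vanishes (R : realType) (M : topologicalType) (A : atlas3 R M)
    (f : M -> 'rV[R]_7) : Prop :=
  forall (c : chart A) (X Y Z : 'rV[R]_3 -> 'rV[R]_3),
    smooth_on (dom c) X -> smooth_on (dom c) Y -> smooth_on (dom c) Z ->
    forall u, dom c u -> Ttensor (f \o param c) X Y Z u = 0.

Definition grad_normsq (R : realType) (M : topologicalType) (A : atlas3 R M)
    (f : M -> 'rV[R]_7) (phi : M -> R) (p : M) : R :=
  let c := chart_at A p in
  let F := f \o param c in
  let u := coord c p in
  let grad :=
    sharp F u (\row_l 'D_(coordv R l) (phi \o param c : _ -> R^o) u) in
  dot ('D_grad F u) ('D_grad F u).

Definition row3 (R : realType) (x : R * R * R) : 'rV[R]_3 :=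
  \row_i [:: x.1.1; x.1.2; x.2]`_i.

Definition lebesgue3 (R : realType) :=
  ((@lebesgue_measure R \x @lebesgue_measure R) \x @lebesgue_measure R)%E.

(* The Borel measure which is sqrt(det g) dx in each chart.  The charts cover
   the manifold, so that this determines it uniquely. *)
Definition riemannian_volume (R : realType) (M : ptopologicalType)
    (A : atlas3 R M) (f : M -> 'rV[R]_7)
    (mu : {measure set (g_sigma_algebraType (@open M)) -> \bar R}) : Prop :=
  forall (c : chart A) (B : set (g_sigma_algebraType (@open M))),
    measurable B -> B `<=` cod c ->
    mu B = (\int[@lebesgue3 R]_(x in
              [set x | dom c (row3 x) /\ B (param c (row3 x))])
              (Num.sqrt (\det (metric (f \o param c) (row3 x))))%:E)%E.

Definition Ffun (R : realType) (s q r : R) : R :=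
  if 0 < s then
    - (11 / 36) * s ^+ 3 + 55 / 36 * (s * q) - 3 * r
    + 5 / 24 * s ^+ 2 + 25 / 24 * q + (25 * r) / (16 * s)
  else 0.

(* Main.v *)
(* The metric connection with the skew torsion coming from G makes the covariant
   derivative T of h totally symmetric.  Through the Codazzi, Gauss and Ricci identities,
   the divergence of
     7 s grad s + 18 grad q - 36 S grad s + 72 h_abi S_cd T_bcda
   equals an invariant of h and of T; after subtraction of the integrand it is a quadratic
   form in T, with coefficients quadratic in h, which is a sum of squares of the components
   of h (x) T under SO(3).  Hence the integrand is at most 1/72 of a divergence, and the
   divergence theorem (a C^1 partition of unity and Fubini in the charts) gives the
   inequality.  If F >= 0, the divergence is nonnegative with zero integral, so it vanishes
   and s |T|^2 = 0: near a point where T <> 0, h vanishes and so does T. *)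
Require Import Defs.
From HB Require Import structures.
From mathcomp Require Import all_boot all_order all_algebra.
From mathcomp Require Import all_classical all_reals all_analysis.
From mathcomp Require Import measurable_realfun.
From mathcomp Require Import ring lra.
Set Implicit Arguments.
Unset Strict Implicit.
Unset Printing Implicit Defensive.
Import Order.TTheory GRing.Theory Num.Theory.
Import numFieldNormedType.Exports.
Local Open Scope classical_set_scope.
Local Open Scope ring_scope.

(** The local identities are proved over an arbitrary commutative ring with derivations, in which
    only 12 has to be invertible. Smooth functions on a chart domain, cut off to 0 outside, form
    such a ring; symmetric trace-free tensors become 7 or 9 free ring elements, and tensor
    identities become polynomial identities. Inequalities are obtained after evaluation at a point,
    which is a ring morphism. The torsion that makes T symmetric has a price: commuting covariant
    derivatives of h produces a term linear in T besides the quadratic form. It is absorbed by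
    completing a square with a share of s|T|^2, and this is the origin of the singular term
    25r/(16s) of F. The torsion constant is tau = c/4, where c is the sign in E_0 x E_1 = c J E_2;
    it enters the curvature only through tau^2 = 1/16, which lowers the curvature 1 of the sphere to
    15/16. The frames of different charts are unrelated and may differ in orientation, so c and tau
    belong to the chart; the field to be integrated has to be written without them. *)

Notation i0 := (@Ordinal 3 0 isT).
Notation i1 := (@Ordinal 3 1 isT).
Notation i2 := (@Ordinal 3 2 isT).

(* An explicit three-term sum: unlike [\sum_(i < 3)] it reduces to its terms. *)
Definition sum3 (V : nmodType) (F : 'I_3 -> V) : V := F i0 + F i1 + F i2.
Notation "\sig_ i F" := (sum3 (fun i => F))
  (at level 41, i name, F at level 41, right associativity,
   format "\sig_ i  F") : ring_scope.

Lemma sum3E (V : nmodType) (F : 'I_3 -> V) : \sum_i F i = \sig_i F i.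
Proof.
rewrite !big_ord_recl big_ord0 addr0 addrA.
by congr (F _ + F _ + F _); apply: val_inj.
Qed.

Lemma ord3P (P : 'I_3 -> Prop) : P i0 -> P i1 -> P i2 -> forall i, P i.
Proof.
by move=> P0 P1 P2 [[|[|[|//]]] Hi]; rewrite (bool_irrelevance Hi isT).
Qed.

(** * Harmonic tensors of degree 3 and 4 in dimension 3 *)

Section Tensors.
Variable A : comNzRingType.

Definition kron (i j : 'I_3) : A :=
  match i : nat, j : nat with
  | 0%N, 0%N | 1%N, 1%N | 2%N, 2%N => 1 | _, _ => 0
  end.

Definition eps3 (i j k : 'I_3) : A :=
  match i : nat, j : nat, k : nat with
  | 0%N, 1%N, 2%N | 1%N, 2%N, 0%N | 2%N, 0%N, 1%N => 1
  | 0%N, 2%N, 1%N | 2%N, 1%N, 0%N | 1%N, 0%N, 2%N => - 1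
  | _, _, _ => 0
  end.

Definition harmonic3 (h : 'I_3 -> 'I_3 -> 'I_3 -> A) : Prop :=
  [/\ forall i j k, h i j k = h j i k, forall i j k, h i j k = h i k j &
      forall i, \sig_j h j j i = 0].

Definition harmonic4 (t : 'I_3 -> 'I_3 -> 'I_3 -> 'I_3 -> A) : Prop :=
  [/\ forall i j k l, t i j k l = t j i k l,
      forall i j k l, t i j k l = t i k j l,
      forall i j k l, t i j k l = t i j l k &
      forall i j, \sig_k t k k i j = 0].

Definition cnt (k i : 'I_3) : nat :=
  match k : nat, i : nat with 1%N, 1%N | 2%N, 2%N => 1%N | _, _ => 0%N end.

(* The harmonic cubic form with coefficients a_p at the components with p
   indices 1 and no index 2, and a_(4+p) at those with exactly one index 2. *)
Definition mk3 (a : nat -> A) (i j k : 'I_3) : A :=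
  let p := (cnt i1 i + cnt i1 j + cnt i1 k)%N in
  match (cnt i2 i + cnt i2 j + cnt i2 k)%N with
  | 0%N => a p
  | 1%N => a (4 + p)%N
  | 2%N => - a p - a p.+2
  | _ => - a 4%N - a 6%N
  end.

(** The encoding of [mk3] with 9 coefficients: a pair of indices 2 is traded, by the vanishing
    trace, for minus the pairs 0 0 and 1 1, and four indices 2 are traded twice. *)
Definition mk4 (t : nat -> A) (i j k l : 'I_3) : A :=
  let p := (cnt i1 i + cnt i1 j + cnt i1 k + cnt i1 l)%N in
  match (cnt i2 i + cnt i2 j + cnt i2 k + cnt i2 l)%N with
  | 0%N => t p
  | 1%N => t (5 + p)%N
  | 2%N => - t p - t p.+2
  | 3%N => - t (5 + p)%N - t (7 + p)%N
  | _ => t 0%N + t 2%N + t 2%N + t 4%N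
  end.

(** Symmetry and the vanishing trace leave 7 components free (9 in degree 4). An identity between
    contractions of such tensors thereby becomes a polynomial identity in free variables, which
    [ring] decides. *)
Lemma harmonic3_mk h : harmonic3 h -> exists a, h = mk3 a.
Proof.
case=> s12 s23 tr.
exists (fun n => nth 0 [:: h i0 i0 i0; h i0 i0 i1; h i0 i1 i1; h i1 i1 i1;
  h i0 i0 i2; h i0 i1 i2; h i1 i1 i2] n).
have t2 i : h i2 i2 i = - h i0 i0 i - h i1 i1 i.
  by rewrite -opprD; exact/esym/addr0_eq/tr.
have e0 : h i0 i2 i2 = - h i0 i0 i0 - h i0 i1 i1 by rewrite s12 s23 t2 (s23 i1) s12.
have e1 : h i1 i2 i2 = - h i0 i0 i1 - h i1 i1 i1 by rewrite s12 s23 t2.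
have e2 := t2 i2.
apply/funext => i; apply/funext => j; apply/funext => k.
move: i j k; do 3 (refine (ord3P _ _ _)); rewrite /mk3 /=;
 rewrite ?(s12 i1 i0) ?(s12 i2 i0) ?(s12 i2 i1) ?(s23 _ i1 i0) ?(s23 _ i2 i0)
  ?(s23 _ i2 i1) ?(s12 i1 i0) ?(s12 i2 i0) ?(s12 i2 i1) //.
Qed.

Lemma harmonic4_mk h : harmonic4 h -> exists a, h = mk4 a.
Proof.
case=> s12 s23 s34 tr.
exists (fun n => nth 0 [:: h i0 i0 i0 i0; h i0 i0 i0 i1; h i0 i0 i1 i1;
  h i0 i1 i1 i1; h i1 i1 i1 i1; h i0 i0 i0 i2; h i0 i0 i1 i2; h i0 i1 i1 i2;
  h i1 i1 i1 i2] n).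
(* Moves the trace, given on the first pair of indices, to the last pair. *)
have rot i j k l : h k l i j = h i j k l by rewrite s23 s12 s34 s23.
have t2 i j : h i j i2 i2 = - h i j i0 i0 - h i j i1 i1.
  by rewrite -!(rot i j) -opprD; exact/esym/addr0_eq/tr.
have [] : [/\ h i0 i0 i2 i2 = - h i0 i0 i0 i0 - h i0 i0 i1 i1,
  h i0 i1 i2 i2 = - h i0 i0 i0 i1 - h i0 i1 i1 i1 &
  h i1 i1 i2 i2 = - h i0 i0 i1 i1 - h i1 i1 i1 i1].
  by split; rewrite t2 ?(rot i0 i0 i1 i1) ?(s34 i0 i1 i1) ?(rot i0 i0) //
    -?(rot i0 i0) s34 s23.
move=> f00 f01 f11.
have f02 : h i0 i2 i2 i2 = - h i0 i0 i0 i2 - h i0 i1 i1 i2.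
  by rewrite t2 (rot i0 i0) (rot i1 i1) (s23 i1 i1 i0) (s12 i1 i0).
have f12 : h i1 i2 i2 i2 = - h i0 i0 i1 i2 - h i1 i1 i1 i2.
  by rewrite t2 (rot i0 i0) (rot i1 i1).
have f22 : h i2 i2 i2 i2 = h i0 i0 i0 i0 + h i0 i0 i1 i1 + h i0 i0 i1 i1
  + h i1 i1 i1 i1.
  by rewrite t2 !(rot _ _ i2 i2) f00 f11 !opprD !opprK !addrA.
apply/funext => i; apply/funext => j; apply/funext => k; apply/funext => l.
move: i j k l; do 4 (refine (ord3P _ _ _)); rewrite /mk4 /=;
 rewrite ?(s12 i1 i0) ?(s12 i2 i0) ?(s12 i2 i1) ?(s23 _ i1 i0) ?(s23 _ i2 i0)
  ?(s23 _ i2 i1) ?(s34 _ _ i1 i0) ?(s34 _ _ i2 i0) ?(s34 _ _ i2 i1)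
  ?(s12 i1 i0) ?(s12 i2 i0) ?(s12 i2 i1) ?(s23 _ i1 i0) ?(s23 _ i2 i0)
  ?(s23 _ i2 i1) ?(s12 i1 i0) ?(s12 i2 i0) ?(s12 i2 i1) //.
Qed.

End Tensors.

Lemma eq_sum3 (V : nmodType) (F G : 'I_3 -> V) :
  (forall i, F i = G i) -> sum3 F = sum3 G.
Proof. by move=> FG; rewrite /sum3 !FG. Qed.

Lemma sum3D (V : nmodType) (F G : 'I_3 -> V) :
  sum3 (fun i => F i + G i) = sum3 F + sum3 G.
Proof. by rewrite -!sum3E big_split. Qed.

Lemma sum3Ml (A : pzRingType) (c : A) (F : 'I_3 -> A) :
  sum3 (fun i => c * F i) = c * sum3 F.
Proof. by rewrite /sum3 !mulrDr. Qed.

Lemma sum3_kronZ (A : comNzRingType) (V : lmodType A) (v : 'I_3 -> V) l :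
  \sig_i kron A l i *: v i = v l.
Proof.
by move: l; refine (ord3P _ _ _); rewrite /sum3 /kron /= !scale0r !scale1r ?addr0 ?add0r.
Qed.

(** * Contractions of h and T, their SO(3) components, and the divergence as an algebraic
    expression *)

Section Contractions.
Variable A : comNzRingType.
Implicit Types (h : 'I_3 -> 'I_3 -> 'I_3 -> A)
  (t : 'I_3 -> 'I_3 -> 'I_3 -> 'I_3 -> A).

Definition shape h (a b : 'I_3) : A := \sig_c \sig_d h a c d * h b c d.
Definition str1 h : A := \sig_a shape h a a.
Definition str2 h : A := \sig_a \sig_b shape h a b * shape h b a.
Definition str3 h : A :=
  \sig_a \sig_b \sig_c shape h a b * shape h b c * shape h c a.

(** For t = T with the derivative index last, [hdt] is half the gradient of s, and the contraction
    of S with [htt] is a quarter of the gradient of q. *)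
Definition hdt h t (i : 'I_3) : A := \sig_a \sig_b \sig_c h a b c * t a b c i.
Definition htt h t (a b i : 'I_3) : A := \sig_c \sig_d h a c d * t b c d i.
Definition normsq4 t : A := \sig_a \sig_b \sig_c \sig_d t a b c d ^+ 2.

Definition ht5 h t (a b c d e : 'I_3) : A := \sig_m h a b m * t m c d e.
Definition ht4 h t (a b c d : 'I_3) : A :=
  \sig_m \sig_n \sig_p eps3 A a m n * h m b p * t n p c d.

End Contractions.

(* The components of h (x) t of spins 5 and 3, 4 and 2, 3, and 1, through which
   the quadratic form in t of [form_ge0] is a sum of squares. *)
Definition sym5 (A : comNzRingType) h t (a b c d e : 'I_3) : A :=
  let y := ht5 h t in let v := hdt h t in let k := @kron A in
  let w a b c d e := v a * (k b c * k d e + k b d * k c e + k b e * k c d) in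
  35 * (y a b c d e + y a c b d e + y a d b c e + y a e b c d + y b c a d e
      + y b d a c e + y b e a c d + y c d a b e + y c e a b d + y d e a b c)
  - 4 * (w a b c d e + w b a c d e + w c a b d e + w d a b c e + w e a b c d).

Definition sym4 (A : comNzRingType) h t (a b c d : 'I_3) : A :=
  let z := ht4 h t in
  z a b c d + z b a c d + z a c b d + z c a b d + z a d b c + z d a b c
  + z b c a d + z c b a d + z b d a c + z d b a c + z c d a b + z d c a b.

Definition sym3 (A : comNzRingType) h t (a b c : 'I_3) : A :=
  let m := htt h t in let v := hdt h t in let k := @kron A in
  5 * (m a b c + m b c a + m c a b)
  - 2 * (v a * k b c + v b * k a c + v c * k a b).

(** The weights are multinomial coefficients: on a totally symmetric tensor the value is the full
    squared norm, each component being counted once for every ordering of its indices. The same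
    holds for [wdot4] and [wsq3]. *)
Definition wsq5 (A : comNzRingType) (y : 'I_3 -> 'I_3 -> 'I_3 -> 'I_3 -> 'I_3 -> A) : A :=
  let x a b c d e := y a b c d e ^+ 2 in
  x i0 i0 i0 i0 i0 + x i1 i1 i1 i1 i1 + x i2 i2 i2 i2 i2
  + 5 * (x i0 i0 i0 i0 i1 + x i0 i0 i0 i0 i2 + x i1 i1 i1 i1 i0
       + x i1 i1 i1 i1 i2 + x i2 i2 i2 i2 i0 + x i2 i2 i2 i2 i1)
  + 10 * (x i0 i0 i0 i1 i1 + x i0 i0 i0 i2 i2 + x i1 i1 i1 i0 i0
        + x i1 i1 i1 i2 i2 + x i2 i2 i2 i0 i0 + x i2 i2 i2 i1 i1)
  + 20 * (x i0 i0 i0 i1 i2 + x i1 i1 i1 i0 i2 + x i2 i2 i2 i0 i1)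
  + 30 * (x i0 i0 i1 i1 i2 + x i0 i0 i2 i2 i1 + x i1 i1 i2 i2 i0).

Definition wdot4 (A : comNzRingType) (y z : 'I_3 -> 'I_3 -> 'I_3 -> 'I_3 -> A) : A :=
  let x a b c d := y a b c d * z a b c d in
  x i0 i0 i0 i0 + x i1 i1 i1 i1 + x i2 i2 i2 i2
  + 4 * (x i0 i0 i0 i1 + x i0 i0 i0 i2 + x i0 i1 i1 i1
       + x i1 i1 i1 i2 + x i0 i2 i2 i2 + x i1 i2 i2 i2)
  + 6 * (x i0 i0 i1 i1 + x i0 i0 i2 i2 + x i1 i1 i2 i2)
  + 12 * (x i0 i0 i1 i2 + x i0 i1 i1 i2 + x i0 i1 i2 i2).

Definition wsq3 (A : comNzRingType) (y : 'I_3 -> 'I_3 -> 'I_3 -> A) : A :=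
  let x a b c := y a b c ^+ 2 in
  x i0 i0 i0 + x i1 i1 i1 + x i2 i2 i2
  + 3 * (x i0 i0 i1 + x i0 i0 i2 + x i1 i1 i0
       + x i1 i1 i2 + x i2 i2 i0 + x i2 i2 i1)
  + 6 * x i0 i1 i2.

Definition dshape (A : comNzRingType) h t (m a b : 'I_3) : A :=
  \sig_c \sig_d (t a c d m * h b c d + h a c d * t b c d m).

(** Curvature of the metric connection with torsion [tau eps3], as the Gauss equation gives it (see
    [curvature]); the torsion changes only the constant 1 of the sphere. *)
Definition curv (A : comNzRingType) (tau : A) h (m l i a : 'I_3) : A :=
  (1 - tau ^+ 2) * (kron A m i * kron A l a - kron A l i * kron A m a)
  + \sig_x (h m i x * h l a x - h l i x * h m a x).

Definition curv_act (A : comNzRingType) (tau : A) h (m l a b c : 'I_3) : A :=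
  \sig_p (curv tau h m l a p * h p b c + curv tau h m l b p * h a p c
          + curv tau h m l c p * h a b p).

Definition torsion4 (A : comNzRingType) h (a b l p : 'I_3) : A :=
  \sig_c \sig_i h a b c * shape h i l * eps3 A i c p.

(** Twelve of the 24 permutations are enough, since [torsion4] is symmetric in its first two indices
    when h is symmetric. This is the tensor with which T pairs in the linear term of the
    divergence. *)
Definition sym_torsion4 (A : comNzRingType) h (a b c d : 'I_3) : A :=
  let n := torsion4 h in
  n a b c d + n a b d c + n a c b d + n a c d b + n a d b c + n a d c b
  + n b c a d + n b c d a + n b d a c + n b d c a + n c d a b + n c d b a.

(* 36 times the divergence of
   7/36 s v_i + S_ab h_acd T_bcdi - S_ij v_j + h_iab S_cd T_abcd, where T is the
   covariant derivative of h, H that of T, and v_i = h_abc T_abci. *)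
Definition div_form (A : comNzRingType) h t
    (H : 'I_3 -> 'I_3 -> 'I_3 -> 'I_3 -> 'I_3 -> A) : A :=
  let S := shape h in let v := hdt h t in let dS := dshape h t in
  let lap a b c := \sig_i H i a b c i in
  7 * (2 * (\sig_i v i ^+ 2) + str1 h * (normsq4 t
         + \sig_a \sig_b \sig_c h a b c * lap a b c))
  + 36 * ((\sig_i \sig_a \sig_b dS i a b * htt h t a b i)
     + (\sig_a \sig_b S a b * \sig_c \sig_d h a c d * lap b c d)
     - (\sig_i \sig_j dS i i j * v j)
     + (\sig_i \sig_a \sig_b h i a b * \sig_c \sig_d dS i c d * t a b c d)
     + (\sig_i \sig_j S i j * \sig_a \sig_b \sig_c
          h a b c * (H c a b j i - H i a b j c))).

Ltac expand3 :=
  cbv beta iota zeta delta [sum3 mk3 mk4 cnt kron eps3 shape str1 str2 str3 hdt htt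
    normsq4 ht5 ht4 dshape curv curv_act torsion4 sym_torsion4 sym5 sym4 sym3 wsq5 wdot4 wsq3 nat_of_ord addn Nat.add].

(** * Polynomial identities for h and T, and the pointwise inequality *)

Section Form.
Variable R : realFieldType.

(** Every square on the right is the norm of an SO(3)-equivariant contraction of h with T and has a
    positive coefficient; 35 and 5 undo the integral normalization of [sym5] and [sym3]. On the
    left, -9/10 = 7/18 - 1 - 13/45: here 7/18 comes from the factor 7 of [div_form], -1 from
    [div_form_quadratic], and 13/45 = 4 * 13/180 is the gradient term of the theorem. *)
Lemma form_sos (a u : nat -> R) : let h := mk3 a in let t := mk4 u in
  let m := htt h t in let v := hdt h t in
  5 / 36 * (str1 h * normsq4 t) - 9 / 10 * (\sig_i v i ^+ 2)
  + \sig_a \sig_b \sig_i m a b i * (m a b i + 3 * m b a i) =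
  23 / 1440 / 35 ^+ 2 * wsq5 (sym5 h t) + 1 / 1296 * wdot4 (sym4 h t) (sym4 h t)
  + 317 / 648 / 5 ^+ 2 * wsq3 (sym3 h t) + 25 / 1008 * (\sig_i v i ^+ 2).
Proof.
expand3; field; by rewrite ?pnatr_eq0.
Qed.
End Form.

Section Identities.
Variables (A : comNzRingType) (a : nat -> A).
Let h := mk3 a.
Let s := str1 h.
Let q := str2 h.
Let r := str3 h.

(** Up to degree 6 the SO(3)-invariants of a harmonic cubic form in dimension 3 are generated by s,
    q and r. This is why the quartic and sextic contractions here and below reduce to combinations
    of s^2, q and of s^3, s q, r, and why F has its form. *)
Lemma dot_lap (tau : A) : 4 * (\sig_a \sig_b \sig_c h a b c *
  (\sig_l curv_act tau h l a b c l)) =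
  4 * s ^+ 2 - 20 * q + 16 * (1 - tau ^+ 2) * s.
Proof. rewrite /s /q /h; expand3. ring. Qed.

Lemma shape_dot_lap (tau : A) :
  \sig_a \sig_b shape h a b * (\sig_c \sig_d h a c d *
    (\sig_l curv_act tau h l b c d l)) =
  s ^+ 3 - 4 * s * q + r + 4 * (1 - tau ^+ 2) * q.
Proof. rewrite /s /q /r /h; expand3. ring. Qed.

Lemma shape_dot_curv (tau : A) :
  2 * (\sig_i \sig_j shape h i j * (\sig_a \sig_b \sig_c
     h a b c * curv_act tau h c i a b j)) =
  - 3 * s ^+ 3 + 13 * s * q - 8 * r - 2 * (1 - tau ^+ 2) * (s ^+ 2 + q).
Proof. rewrite /s /q /r /h; expand3. ring. Qed.

Lemma wdot4_sym_torsion4 :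
  wdot4 (sym_torsion4 h) (sym_torsion4 h) = 12 * (- 4 * s ^+ 3 + 17 * s * q - 15 * r).
Proof. rewrite /s /q /r /h; expand3. ring. Qed.

Variable u : nat -> A.
Let t := mk4 u.

(** T is totally symmetric, so that it pairs equally with each of the 12 summands; the sign comes
    from exchanging the first two indices of [eps3]. *)
Lemma dot_sym_torsion4 :
  wdot4 t (sym_torsion4 h) =
  - 12 * (\sig_i \sig_j shape h i j * (\sig_a \sig_b \sig_c h a b c *
    (\sig_p eps3 A c i p * t a b j p))).
Proof. rewrite /h /t; expand3. ring. Qed.

Lemma div_form_quadratic : let v := hdt h t in let dS := dshape h t in
  let m := htt h t in
  (\sig_i \sig_a \sig_b dS i a b * htt h t a b i)
     - (\sig_i \sig_j dS i i j * v j)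
     + (\sig_i \sig_a \sig_b h i a b * (\sig_c \sig_d dS i c d * t a b c d)) =
  (\sig_a \sig_b \sig_i m a b i * (m a b i + 3 * m b a i)) - (\sig_i v i ^+ 2).
Proof. rewrite /h /t; expand3. ring. Qed.

Lemma normsq4_wdot4 : normsq4 t = wdot4 t t.
Proof. rewrite /t; expand3. ring. Qed.

Lemma lap_torsion b c d : \sig_l \sig_p eps3 A l b p * t c d l p = 0.
Proof.
by rewrite /t; move: b c d; do 3 (refine (ord3P _ _ _)); expand3; ring.
Qed.

End Identities.

Ltac nonneg := repeat first
  [exact: ler0n | exact: sqr_ge0 | apply: addr_ge0 | apply: mulr_ge0].

Section Pointwise.
Variable R : realFieldType.

Lemma sum3_ge0 (F : 'I_3 -> R) : (forall i, 0 <= F i) -> 0 <= sum3 F.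
Proof. by move=> F0; rewrite /sum3 !addr_ge0. Qed.

Lemma wdot4_ge0 (y : 'I_3 -> 'I_3 -> 'I_3 -> 'I_3 -> R) : 0 <= wdot4 y y.
Proof.
have p x : 0 <= x * x :> R by rewrite -expr2 sqr_ge0.
by rewrite /wdot4; repeat first
  [exact: ler0n | exact: p | apply: addr_ge0 | apply: mulr_ge0].
Qed.

Lemma form_ge0 (a u : nat -> R) : let h := mk3 a in let t := mk4 u in
  let m := htt h t in
  0 <= 5 / 36 * (str1 h * normsq4 t) - 9 / 10 * (\sig_i hdt h t i ^+ 2)
  + \sig_a \sig_b \sig_i m a b i * (m a b i + 3 * m b a i).
Proof.
have E := form_sos a u; cbv zeta in E; cbv zeta; rewrite E.
have c0 (n : nat) : 0 <= n%:R^-1 :> R by rewrite invr_ge0 ler0n.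
rewrite !addr_ge0 ?mulr_ge0 ?invr_ge0 ?ler0n ?wdot4_ge0 ?exprn_ge0 ?ler0n //.
- by rewrite /wsq5; nonneg.
- by rewrite /wsq3; nonneg.
- by apply: sum3_ge0 => i; exact: sqr_ge0.
Qed.

Variables (tau : R) (h : 'I_3 -> 'I_3 -> 'I_3 -> R)
  (t : 'I_3 -> 'I_3 -> 'I_3 -> 'I_3 -> R)
  (H : 'I_3 -> 'I_3 -> 'I_3 -> 'I_3 -> 'I_3 -> R).

Hypothesis tauE : 16 * tau ^+ 2 = 1.
Hypothesis h_harmonic : harmonic3 h.
Hypothesis t_harmonic : harmonic4 t.
Hypothesis H_harmonic : forall m, harmonic4 (H m).
Hypothesis ricci : forall m l a b c, H m a b c l - H l a b c m =
  curv_act tau h m l a b c + 2 * tau * (\sig_p eps3 R m l p * t a b c p).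

(** By total symmetry the last index may be exchanged with [a]; commuting the two derivatives then
    leaves a trace of [H a], which vanishes, while the torsion term pairs the skew [eps3] with the
    symmetric T. The divergence of T is thus pure curvature. *)
Lemma lapE a b c : \sig_l H l a b c l = \sig_l curv_act tau h l a b c l.
Proof.
have [u tE] := harmonic4_mk t_harmonic.
have [s12 s23 s34 tr] := H_harmonic a.
have {}tr : \sig_l H a b c l l = 0.
  by rewrite -(tr b c); apply: eq_sum3 => l; rewrite s23 s12 s34 s23.
transitivity (\sig_l ((curv_act tau h l a b c l
    + 2 * tau * (\sig_p eps3 R l a p * t b c l p)) + H a b c l l)).
  apply: eq_sum3 => l; have [r12 r23 r34 _] := H_harmonic l.
  by rewrite -ricci (r34 b c l a) (r23 b c a) (r12 b a) subrK.
by rewrite sum3D tr addr0 sum3D sum3Ml tE lap_torsion mulr0 addr0.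
Qed.

(** Of the coefficient 7/36 of s|T|^2 in the divergence, 5/36 feeds [form_ge0], 1/20 pays for the
    square that absorbs the term linear in T, and 1/180 remains in the statement. Since grad s is
    twice [hdt], 13/45 stands for 13/180. *)
Lemma div_form_lower_bound : let s := str1 h in let q := str2 h in
  let r := str3 h in 0 < s ->
  36 * (13 / 45 * (\sig_i hdt h t i ^+ 2) + 1 / 180 * (s * normsq4 t)
    + (- (11 / 36) * s ^+ 3 + 55 / 36 * (s * q) - 3 * r
    + 5 / 24 * s ^+ 2 + 25 / 24 * q + 25 * r / (16 * s))) <=
  div_form h t H.
Proof.
move=> s q r s0.
have [a hE] := harmonic3_mk h_harmonic.
have [u tE] := harmonic4_mk t_harmonic.
pose TT := \sig_i \sig_j shape h i j * (\sig_a \sig_b \sig_c h a b c *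
    (\sig_p eps3 R c i p * t a b j p)).
pose SC := \sig_i \sig_j shape h i j * (\sig_a \sig_b \sig_c
     h a b c * curv_act tau h c i a b j).
(* The Ricci identity splits the commutator of second derivatives into curvature, evaluated by
   [shape_dot_curv], and the only term of the divergence that is linear in T. *)
have thirdE : \sig_i \sig_j shape h i j * (\sig_a \sig_b \sig_c
    h a b c * (H c a b j i - H i a b j c)) = SC + 2 * tau * TT.
  rewrite /SC /TT -sum3Ml -sum3D; apply: eq_sum3 => i.
  rewrite -sum3Ml -sum3D; apply: eq_sum3 => j.
  rewrite mulrCA -mulrDr; congr (_ * _).
  do 3 (rewrite -sum3Ml -sum3D; apply: eq_sum3 => ?).
  by rewrite ricci mulrDr [in RHS]mulrCA.
have e1 := dot_lap a tau; have e2 := shape_dot_lap a tau.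
have e3 := shape_dot_curv a tau; have e4 := wdot4_sym_torsion4 a.
have e5 := dot_sym_torsion4 a u; have e6 := div_form_quadratic a u.
have e7 := form_ge0 a u; have e8 := normsq4_wdot4 u.
move: e1 e2 e3 e4 e5 e6 e7 e8; rewrite /= -hE -tE -/s -/q -/r -/TT -/SC.
move=> e1 e2 e3 e4 e5 e6 e7 e8.
have t16 : tau ^+ 2 = 1 / 16 by have := tauE; lra.
have t15 : 1 - tau ^+ 2 = 15 / 16 by rewrite t16; lra.
rewrite /div_form; cbv zeta beta; rewrite thirdE -/s.
pose lap a b c := \sig_i H i a b c i.
have lapE' b c d : lap b c d = \sig_l curv_act tau h l b c d l by exact: lapE.
have hL : \sig_a \sig_b \sig_c h a b c * lap a b c = s ^+ 2 - 5 * q + 15 / 4 * s.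
  suff: 4 * (\sig_a \sig_b \sig_c h a b c * lap a b c) =
    4 * s ^+ 2 - 20 * q + 16 * (1 - tau ^+ 2) * s by rewrite t15; lra.
  rewrite -e1; congr (_ * _); do 3 (apply: eq_sum3 => ?); by rewrite lapE'.
have ShL : \sig_a \sig_b shape h a b * (\sig_c \sig_d h a c d * lap b c d) =
    s ^+ 3 - 4 * s * q + r + 15 / 4 * q.
  rewrite (_ : 15 / 4 = 4 * (1 - tau ^+ 2)); last by rewrite t15; lra.
  rewrite -e2; do 2 (apply: eq_sum3 => ?); congr (_ * _).
  by do 2 (apply: eq_sum3 => ?); rewrite lapE'.
rewrite /lap in hL ShL; rewrite hL ShL.
move: e6; set X1 := (X in X - _ + _ = _); set X2 := (X in _ - X + _ = _).
set X3 := (X in _ - _ + X = _) => e6.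
(* With N = [sym_torsion4 h], this is the value for which the cross term of s|t - kappa N|^2 / 20
   equals [2 * tau * TT]. By [wdot4_sym_torsion4] the square of kappa N contributes -25r/(16s), the
   counterpart of the singular term of F. *)
pose kappa := 5 / 3 * tau / s.
have := wdot4_ge0 (fun a b c d => t a b c d - kappa * sym_torsion4 h a b c d).
rewrite (_ : wdot4 _ _ = wdot4 t t - 2 * kappa * wdot4 t (sym_torsion4 h)
  + kappa ^+ 2 * wdot4 (sym_torsion4 h) (sym_torsion4 h)); last first.
  by rewrite /wdot4; ring.
rewrite -e8 e4 e5 => W0.
rewrite -subr_ge0.
have E3 : SC = (- 3 * s ^+ 3 + 13 * s * q - 8 * r - 15 / 8 * (s ^+ 2 + q)) / 2.
  by rewrite t15 in e3; lra.
move: e7; rewrite E3; set v2 := \sig_i hdt h t i ^+ 2.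
rewrite -/v2 in e6.
set M2 := \sig_a _ => e7; rewrite -/M2 in e6.
have X1E : X1 = M2 - v2 + X2 - X3 by rewrite -e6; ring.
have k2 : kappa ^+ 2 = 25 / (144 * s ^+ 2).
  rewrite /kappa !exprMn t16.
  by field; rewrite gt_eqF.
rewrite k2 /kappa in W0.
have := mulr_ge0 (ltW s0) W0.
set Wv := (X in 0 <= X) => W1; apply: le_trans (_ : 0 <= 36 * (5 / 36 * (s * normsq4 t)
  - 9 / 10 * v2 + M2) + 36 / 20 * Wv) _; first by apply: addr_ge0; apply: mulr_ge0 => //; rewrite divr_ge0 ?ler0n.
rewrite le_eqVlt; apply/orP; left; apply/eqP.
rewrite -/X1 -/X2 -/X3 X1E /Wv; field.
by rewrite gt_eqF.
Qed.

End Pointwise.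

(** * Action of skew matrices on tensors *)

Section TensorCalculus.
Variable A : comNzRingType.
Implicit Types (g : 'I_3 -> 'I_3 -> A).

Definition skew3 g : Prop :=
  (forall i, g i i = 0) /\ (forall i j, g i j = - g j i).

Definition act1 g (u : 'I_3 -> A) (a : 'I_3) : A := \sig_x g a x * u x.
Definition act2 g (u : 'I_3 -> 'I_3 -> A) (a b : 'I_3) : A :=
  \sig_x (g a x * u x b + g b x * u a x).
Definition act3 g (u : 'I_3 -> 'I_3 -> 'I_3 -> A) (a b c : 'I_3) : A :=
  \sig_x (g a x * u x b c + g b x * u a x c + g c x * u a b x).
Definition act4 g (u : 'I_3 -> 'I_3 -> 'I_3 -> 'I_3 -> A) (a b c d : 'I_3) : A :=
  \sig_x (g a x * u x b c d + g b x * u a x c d + g c x * u a b x d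
          + g d x * u a b c x).

Lemma exchange_sum3 (F : 'I_3 -> 'I_3 -> A) :
  \sig_i \sig_j F i j = \sig_j \sig_i F i j.
Proof. by rewrite /sum3; ring. Qed.

(** Three free entries in place of the skewness hypotheses, so that [ring] can settle statements
    about a connection form. *)
Lemma skew3E g : skew3 g -> exists x y z, g = fun i j : 'I_3 =>
  match i : nat, j : nat with
  | 0%N, 1%N => x | 1%N, 0%N => - x | 0%N, 2%N => y | 2%N, 0%N => - y
  | 1%N, 2%N => z | 2%N, 1%N => - z | _, _ => 0
  end.
Proof.
case=> g0 gN; exists (g i0 i1), (g i0 i2), (g i1 i2).
apply/funext => i; apply/funext => j.
by move: i j; do 2 (refine (ord3P _ _ _)); rewrite ?g0 // gN.
Qed.

Lemma act2_adjoint g u w : skew3 g ->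
  \sig_a \sig_b (act2 g u a b * w a b + u a b * act2 g w a b) = 0.
Proof. by move=> /skew3E[x [y [z ->]]]; rewrite /act2 /sum3 /=; ring. Qed.

Lemma act3_adjoint g u w : skew3 g -> \sig_a \sig_b \sig_c
  (act3 g u a b c * w a b c + u a b c * act3 g w a b c) = 0.
Proof. by move=> /skew3E[x [y [z ->]]]; rewrite /act3 /sum3 /=; ring. Qed.

Lemma act3_comm g g' u a b c :
  act3 g (act3 g' u) a b c - act3 g' (act3 g u) a b c =
  act3 (fun i j => \sig_x (g i x * g' x j - g' i x * g x j)) u a b c.
Proof. by rewrite /act3 /sum3; ring. Qed.

Lemma act3_trace g u i : skew3 g ->
  \sig_j act3 g u j j i = act1 g (fun x => \sig_j u j j x) i.
Proof. by move=> /skew3E[x [y [z ->]]]; rewrite /act3 /act1 /sum3 /=; ring. Qed.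

Lemma act4_trace g u i j : skew3 g ->
  \sig_k act4 g u k k i j = act2 g (fun x y => \sig_k u k k x y) i j.
Proof. by move=> /skew3E[x [y [z ->]]]; rewrite /act4 /act2 /sum3 /=; ring. Qed.

Lemma act3_sym12 g u : (forall a b c, u a b c = u b a c) ->
  forall a b c, act3 g u a b c = act3 g u b a c.
Proof.
by move=> s a b c; apply: eq_sum3 => x; rewrite (s x b) (s a x) (s a b); ring.
Qed.

Lemma act3_sym23 g u : (forall a b c, u a b c = u a c b) ->
  forall a b c, act3 g u a b c = act3 g u a c b.
Proof.
by move=> s a b c; apply: eq_sum3 => x; rewrite (s x b) (s a x) (s a b x); ring.
Qed.

Lemma act4_sym12 g u : (forall a b c d, u a b c d = u b a c d) ->
  forall a b c d, act4 g u a b c d = act4 g u b a c d.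
Proof.
move=> s a b c d; apply: eq_sum3 => x.
by rewrite (s x b) (s a x) (s a b x) (s a b c x); ring.
Qed.

Lemma act4_sym23 g u : (forall a b c d, u a b c d = u a c b d) ->
  forall a b c d, act4 g u a b c d = act4 g u a c b d.
Proof.
move=> s a b c d; apply: eq_sum3 => x.
by rewrite (s x b) (s a x) (s a b x) (s a b c x); ring.
Qed.

Lemma act4_sym34 g u : (forall a b c d, u a b c d = u a b d c) ->
  forall a b c d, act4 g u a b c d = act4 g u a b d c.
Proof.
move=> s a b c d; apply: eq_sum3 => x.
by rewrite (s x b) (s a x) (s a b x) (s a b c x); ring.
Qed.

Lemma act4_act3 g u a b c d : act4 g u a b c d =
  act3 g (fun a b c => u a b c d) a b c + \sig_x g d x * u a b c x.
Proof. by rewrite /act4 /act3 -sum3D. Qed.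

Lemma act3B g u v a b c : act3 g (fun a b c => u a b c - v a b c) a b c =
  act3 g u a b c - act3 g v a b c.
Proof. by rewrite /act3 /sum3; ring. Qed.

Lemma act20 g a b : act2 g (fun _ _ => 0) a b = 0.
Proof. by rewrite /act2 /sum3; ring. Qed.

Lemma act10 g a : act1 g (fun _ => 0) a = 0.
Proof. by rewrite /act1 /sum3; ring. Qed.

Lemma sum3_rotate4 (F : 'I_3 -> 'I_3 -> 'I_3 -> 'I_3 -> A) :
  \sig_i \sig_a \sig_b \sig_c F a b c i = \sig_a \sig_b \sig_c \sig_i F a b c i.
Proof.
rewrite exchange_sum3; apply: eq_sum3 => a.
rewrite exchange_sum3; apply: eq_sum3 => b.
exact: exchange_sum3.
Qed.

Lemma sum3Mr2 c (F : 'I_3 -> 'I_3 -> A) :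
  c * (\sig_a \sig_b F a b) = \sig_a \sig_b c * F a b.
Proof. by rewrite -sum3Ml; apply: eq_sum3 => a; rewrite sum3Ml. Qed.

Lemma sum3Mr3 c (F : 'I_3 -> 'I_3 -> 'I_3 -> A) :
  c * (\sig_a \sig_b \sig_d F a b d) = \sig_a \sig_b \sig_d c * F a b d.
Proof. by rewrite -sum3Ml; apply: eq_sum3 => a; rewrite sum3Mr2. Qed.

Lemma contract_exchange (u : 'I_3 -> 'I_3 -> 'I_3 -> A) (S : 'I_3 -> 'I_3 -> A)
    (K : 'I_3 -> 'I_3 -> 'I_3 -> 'I_3 -> 'I_3 -> A) :
  \sig_i \sig_a \sig_b u i a b * (\sig_c \sig_d S c d * K i a b c d) =
  \sig_c \sig_d S c d * (\sig_i \sig_a \sig_b u i a b * K i a b c d).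
Proof.
transitivity (\sig_i \sig_c \sig_a \sig_d \sig_b u i a b * (S c d * K i a b c d)).
  apply: eq_sum3 => i; rewrite [RHS]exchange_sum3; apply: eq_sum3 => a.
  transitivity (\sig_b \sig_c \sig_d u i a b * (S c d * K i a b c d)).
    by apply: eq_sum3 => b; rewrite sum3Mr2.
  rewrite exchange_sum3; apply: eq_sum3 => c; exact: exchange_sum3.
rewrite exchange_sum3; apply: eq_sum3 => c.
transitivity (\sig_i \sig_d \sig_a \sig_b u i a b * (S c d * K i a b c d)).
  by apply: eq_sum3 => i; rewrite exchange_sum3.
rewrite exchange_sum3; apply: eq_sum3 => d; rewrite sum3Mr3.
by do 3 (apply: eq_sum3 => ?); rewrite mulrCA.
Qed.

End TensorCalculus.

(** * Derivations along a moving frame *)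

Section CommutingDerivations.
Variables (A : comNzRingType) (p : 'I_3 -> A -> A).
Hypothesis p_add : forall i x y, p i (x + y) = p i x + p i y.
Hypothesis p_mul : forall i x y, p i (x * y) = p i x * y + x * p i y.
Hypothesis p_comm : forall i j x, p i (p j x) = p j (p i x).
Variable e : 'I_3 -> 'I_3 -> A.

Definition fder (l : 'I_3) (x : A) : A := \sig_i e l i * p i x.

Lemma fder_add l x y : fder l (x + y) = fder l x + fder l y.
Proof. by rewrite /fder /sum3 !p_add; ring. Qed.

Lemma fder_mul l x y : fder l (x * y) = fder l x * y + x * fder l y.
Proof. by rewrite /fder /sum3 !p_mul; ring. Qed.

(** The second-order terms cancel because the [p i] commute; the first-order remainder is
    re-expanded in the frame through g, which expresses the [p i] in the frame derivations. *)
Lemma fder_bracket (g : 'I_3 -> 'I_3 -> A) m l x :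
  (forall y i, p i y = \sig_a g i a * fder a y) ->
  fder m (fder l x) - fder l (fder m x) =
  \sig_a (\sig_i (fder m (e l i) - fder l (e m i)) * g i a) * fder a x.
Proof.
move=> pE.
transitivity (\sig_i (fder m (e l i) - fder l (e m i)) * p i x).
  rewrite [fder l x]/fder [fder m x]/fder /sum3 !fder_add !fder_mul /fder /sum3.
  by rewrite (p_comm i1 i0) (p_comm i2 i0) (p_comm i2 i1); ring.
transitivity (\sig_i (fder m (e l i) - fder l (e m i)) * (\sig_a g i a * fder a x)).
  by apply: eq_sum3 => i; rewrite -pE.
by rewrite /sum3; ring.
Qed.

End CommutingDerivations.

(** * Covariant derivatives with torsion, curvature, and the divergence of the field *)

Section Derivations.
Variables (A : comNzRingType) (D : 'I_3 -> A -> A).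
Hypothesis D_add : forall l x y, D l (x + y) = D l x + D l y.
Hypothesis D_mul : forall l x y, D l (x * y) = D l x * y + x * D l y.

Lemma der0 l : D l 0 = 0.
Proof. by apply: (addrI (D l 0)); rewrite -D_add !addr0. Qed.

Lemma der1 l : D l 1 = 0.
Proof. by apply: (addrI (D l 1)); rewrite addr0 -[in RHS](mulr1 1) D_mul mulr1 mul1r. Qed.

Lemma derN l x : D l (- x) = - D l x.
Proof. by apply/eqP; rewrite -addr_eq0 -D_add addNr der0. Qed.

Lemma der_sum3 l (F : 'I_3 -> A) : D l (sum3 F) = \sig_i D l (F i).
Proof. by rewrite /sum3 !D_add. Qed.

Lemma der_eps3 l i j k : D l (eps3 A i j k) = 0.
Proof.
by move: i j k; do 3 (refine (ord3P _ _ _)); rewrite /eps3 /= ?derN ?der1 ?der0 ?oppr0.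
Qed.

Variables (G : 'I_3 -> 'I_3 -> 'I_3 -> A) (h : 'I_3 -> 'I_3 -> 'I_3 -> A) (tau : A).
Hypothesis D_tau : forall l, D l tau = 0.
Hypothesis G_skew : forall l, skew3 (G l).
Hypothesis D_bracket : forall m l x,
  D m (D l x) - D l (D m x) = \sig_a (G m l a - G l m a) * D a x.
Hypothesis h_harmonic : harmonic3 h.
Hypothesis codazzi : forall m l i k, D m (h l i k) - D l (h m i k) =
  \sig_a ((G m l a - G l m a) * h a i k - G l i a * h m k a + G m i a * h l k a
   + h l i a * (G m k a + 4 * tau * eps3 A m k a)
   - h m i a * (G l k a + 4 * tau * eps3 A l k a)).
Hypothesis gauss : forall m l i k, D m (G l i k) - D l (G m i k) =
  kron A l i * kron A m k - kron A m i * kron A l k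
  + \sig_a ((G m l a - G l m a) * G a i k + G l i a * G m k a - G m i a * G l k a
     + h l i a * h m k a - h m i a * h l k a).

(* The metric connection with totally skew torsion for which the covariant
   derivative of h is totally symmetric. *)
Definition tconn (l i a : 'I_3) : A := G l i a + tau * eps3 A l i a.
Definition covh (a b c l : 'I_3) : A := D l (h a b c) - act3 (tconn l) h a b c.
Definition cov2h (m a b c l : 'I_3) : A :=
  D m (covh a b c l) - act4 (tconn m) covh a b c l.

Lemma tconn_skew l : skew3 (tconn l).
Proof.
have [G0 GN] := G_skew l; split => [i|i j]; rewrite /tconn.
  rewrite G0 add0r; move: l i {G0 GN}; do 2 (refine (ord3P _ _ _));
  by rewrite /eps3 /= mulr0.
rewrite GN opprD; congr (_ + _); rewrite -mulrN; congr (_ * _).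
by move: l i j {G0 GN}; do 3 (refine (ord3P _ _ _)); rewrite /eps3 /= ?opprK ?oppr0.
Qed.

(** [codazzi] compares D_l h_cab with D_c h_lab; its last index is normal and carries the connection
    [G + 4 * tau * eps3], the others carry [G]. With the torsion [tau] spread over all three indices
    of h, the Levi-Civita parts cancel and so do, for harmonic h, the [eps3] parts. *)
Lemma covh_sym34 a b c l : covh a b c l = covh a b l c.
Proof.
apply/eqP; rewrite -subr_eq0; apply/eqP.
have [s12 s23 _] := h_harmonic.
have E : D l (h a b c) - D c (h a b l) = D l (h c a b) - D c (h l a b).
  by rewrite s23 s12 (s23 a b) (s12 a l).
rewrite /covh [LHS](_ : _ = (D l (h a b c) - D c (h a b l))
  - (act3 (tconn l) h a b c - act3 (tconn c) h a b l)); last by ring.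
rewrite E codazzi /act3 /tconn.
have [u hE] := harmonic3_mk h_harmonic.
have [x0 [y0 [z0 E0]]] := skew3E (G_skew i0).
have [x1 [y1 [z1 E1]]] := skew3E (G_skew i1).
have [x2 [y2 [z2 E2]]] := skew3E (G_skew i2).
move: a b c l {E}; do 4 (refine (ord3P _ _ _)); rewrite /sum3 ?E0 ?E1 ?E2 hE;
  cbv beta iota zeta delta [mk3 cnt eps3 nat_of_ord addn Nat.add]; ring.
Qed.

(** The connection is metric, so covariant differentiation commutes with traces and permutations of
    the indices of h; only the exchange with the derivative index needs Codazzi. *)
Lemma covh_harmonic : harmonic4 covh.
Proof.
have [s12 s23 tr] := h_harmonic.
split => [i j k l|i j k l|i j k l|i j].
- by rewrite /covh s12 (act3_sym12 _ s12).
- by rewrite /covh s23 (act3_sym23 _ s23).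
- exact: covh_sym34.
- have := act3_trace h i (tconn_skew j).
  rewrite (_ : (fun x => \sig_k h k k x) = fun _ => 0); last by apply/funext => x; exact: tr.
  rewrite act10 /covh => tr0.
  have := der_sum3 j (fun k => h k k i); rewrite tr der0 => tr1.
  transitivity ((\sig_k D j (h k k i)) - \sig_k act3 (tconn j) h k k i).
    by rewrite /sum3; ring.
  by rewrite -tr1 tr0 subr0.
Qed.

Lemma cov2h_harmonic m : harmonic4 (cov2h m).
Proof.
have [s12 s23 s34 tr] := covh_harmonic.
split => [i j k l|i j k l|i j k l|i j].
- by rewrite /cov2h s12 (act4_sym12 _ s12).
- by rewrite /cov2h s23 (act4_sym23 _ s23).
- by rewrite /cov2h s34 (act4_sym34 _ s34).
- have := act4_trace covh i j (tconn_skew m).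
  rewrite (_ : (fun x y => \sig_k covh k k x y) = fun _ _ => 0); last first.
    by apply/funext => x; apply/funext => y; exact: tr.
  rewrite act20 /cov2h => tr0.
  have := der_sum3 m (fun k => covh k k i j); rewrite tr der0 => tr1.
  transitivity ((\sig_k D m (covh k k i j)) - \sig_k act4 (tconn m) covh k k i j).
    by rewrite /sum3; ring.
  by rewrite -tr1 tr0 subr0.
Qed.

(** The torsion is parallel, [tau] being constant and [eps3] invariant under skew matrices, so the
    terms linear in [tau] drop out and only [tau ^+ 2] is left beside the Gauss equation. *)
Lemma curvature m l i k :
  \sig_a (G m l a - G l m a) * tconn a i k - D m (tconn l i k) + D l (tconn m i k)
  + \sig_x (tconn m i x * tconn l x k - tconn l i x * tconn m x k) =
  curv tau h m l i k.
Proof.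
have Dg p q a b : D p (tconn q a b) = D p (G q a b).
  by rewrite D_add D_mul D_tau der_eps3 mul0r mulr0 !addr0.
rewrite !Dg -[_ - D m _ + _]addrA.
have -> : - D m (G l i k) + D l (G m i k) = - (D m (G l i k) - D l (G m i k)).
  by ring.
rewrite gauss /curv /tconn.
have [x0 [y0 [z0 E0]]] := skew3E (G_skew i0).
have [x1 [y1 [z1 E1]]] := skew3E (G_skew i1).
have [x2 [y2 [z2 E2]]] := skew3E (G_skew i2).
move: m l i k; do 4 (refine (ord3P _ _ _)).
all: rewrite /sum3 ?E0 ?E1 ?E2 /kron /eps3 /=.
all: ring.
Qed.

Lemma der_act3 m g u a b c : D m (act3 g u a b c) =
  act3 (fun i j => D m (g i j)) u a b c + act3 g (fun a b c => D m (u a b c)) a b c.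
Proof. by rewrite /act3 der_sum3 /sum3 !D_add !D_mul; ring. Qed.

(** For a connection with torsion the commutator of second derivatives contains a first-order term
    as well, here in T. Its sign is opposite to the one in the pointwise inequality, which is
    therefore applied to [- tau]; the curvature depends only on the square. *)
Lemma ricci_identity m l a b c : cov2h m a b c l - cov2h l a b c m =
  curv_act tau h m l a b c + 2 * - tau * (\sig_p eps3 A m l p * covh a b c p).
Proof.
have cE i k : \sig_x (tconn m i x * tconn l x k - tconn l i x * tconn m x k) =
  curv tau h m l i k - \sig_a (G m l a - G l m a) * tconn a i k
  + D m (tconn l i k) - D l (tconn m i k).
  by rewrite -(curvature m l i k); ring.
have := act3_comm (tconn m) (tconn l) h a b c.
rewrite (_ : (fun i j => _) = fun i k => curv tau h m l i k
  - \sig_a (G m l a - G l m a) * tconn a i k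
  + D m (tconn l i k) - D l (tconn m i k)); last first.
  by apply/funext => i; apply/funext => k; exact: cE.
move=> commE; rewrite /cov2h !act4_act3.
have covE p : (fun a b c => covh a b c p) =
  fun a b c => D p (h a b c) - act3 (tconn p) h a b c by [].
have DE p q : D p (covh a b c q) =
  D p (D q (h a b c)) - D p (act3 (tconn q) h a b c) by rewrite D_add derN.
rewrite !covE !act3B !DE !der_act3.
have := D_bracket m l (h a b c).
have DhE p : D p (h a b c) = covh a b c p + act3 (tconn p) h a b c.
  by rewrite /covh subrK.
rewrite (eq_sum3 (G := fun x => (G m l x - G l m x) *
  (covh a b c x + act3 (tconn x) h a b c))); last by move=> x; rewrite DhE.
move=> bE.
have {}bE : D m (D l (h a b c)) = D l (D m (h a b c))
  + \sig_x (G m l x - G l m x) * (covh a b c x + act3 (tconn x) h a b c).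
  by rewrite -bE; ring.
rewrite bE; move: commE; set X := act3 (tconn m) (act3 (tconn l) h) a b c.
set Y := act3 (tconn l) (act3 (tconn m) h) a b c => commE.
have {}commE := canRL (subrK Y) commE.
rewrite commE.
have epsN p : eps3 A l m p = - eps3 A m l p.
  by move: l m p {X Y bE commE DhE DE cE covE}; do 3 (refine (ord3P _ _ _));
    rewrite /eps3 /= ?opprK ?oppr0.
have gE p : tconn m l p - tconn l m p = G m l p - G l m p + 2 * tau * eps3 A m l p.
  by rewrite /tconn epsN; ring.
rewrite /curv_act.
have {}gE : 2 * tau * (\sig_p eps3 A m l p * covh a b c p) =
  (\sig_x tconn m l x * covh a b c x) - (\sig_x tconn l m x * covh a b c x)
  - (\sig_x (G m l x - G l m x) * covh a b c x).
  by rewrite /sum3 /tconn !epsN; ring.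
rewrite mulrN mulNr gE {gE} /act3 /sum3; ring.
Qed.

(** The connection form is skew, so its contributions cancel in a full contraction and only the
    covariant derivatives u' and w' survive. The same holds for two and three indices below. *)
Lemma leibniz1 m u u' w w' :
  (forall a, D m (u a) = u' a + act1 (tconn m) u a) ->
  (forall a, D m (w a) = w' a + act1 (tconn m) w a) ->
  D m (\sig_a u a * w a) = \sig_a (u' a * w a + u a * w' a).
Proof.
move=> uE wE; rewrite der_sum3; transitivity (\sig_a ((u' a * w a + u a * w' a)
  + (act1 (tconn m) u a * w a + u a * act1 (tconn m) w a))).
  by apply: eq_sum3 => a; rewrite D_mul uE wE; ring.
rewrite sum3D; have [x [y [z gE]]] := skew3E (tconn_skew m).
by rewrite gE /act1 /sum3 /=; ring.
Qed.

Lemma leibniz2 m u u' w w' :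
  (forall a b, D m (u a b) = u' a b + act2 (tconn m) u a b) ->
  (forall a b, D m (w a b) = w' a b + act2 (tconn m) w a b) ->
  D m (\sig_a \sig_b u a b * w a b) =
  \sig_a \sig_b (u' a b * w a b + u a b * w' a b).
Proof.
move=> uE wE; rewrite der_sum3.
rewrite -[RHS]addr0 -(act2_adjoint u w (tconn_skew m)) -sum3D.
apply: eq_sum3 => a; rewrite der_sum3 -sum3D; apply: eq_sum3 => b.
by rewrite D_mul uE wE; ring.
Qed.

Lemma leibniz3 m u u' w w' :
  (forall a b c, D m (u a b c) = u' a b c + act3 (tconn m) u a b c) ->
  (forall a b c, D m (w a b c) = w' a b c + act3 (tconn m) w a b c) ->
  D m (\sig_a \sig_b \sig_c u a b c * w a b c) =
  \sig_a \sig_b \sig_c (u' a b c * w a b c + u a b c * w' a b c).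
Proof.
move=> uE wE; rewrite der_sum3.
rewrite -[RHS]addr0 -(act3_adjoint u w (tconn_skew m)) -sum3D.
apply: eq_sum3 => a; rewrite der_sum3 -sum3D; apply: eq_sum3 => b.
rewrite der_sum3 -sum3D; apply: eq_sum3 => c.
by rewrite D_mul uE wE; ring.
Qed.

Lemma der_h m a b c : D m (h a b c) = covh a b c m + act3 (tconn m) h a b c.
Proof. by rewrite /covh subrK. Qed.

Lemma der_covh m a b c l :
  D m (covh a b c l) = cov2h m a b c l + act4 (tconn m) covh a b c l.
Proof. by rewrite /cov2h subrK. Qed.

Let S := shape h.
Let s := str1 h.
Let v := hdt h covh.
Let dS := dshape h covh.
Let M := htt h covh.

Lemma der_str1 m : D m s = 2 * v m.
Proof.
rewrite [LHS](leibniz3 (u' := fun a b c => covh a b c m)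
  (w' := fun a b c => covh a b c m) (der_h m) (der_h m)).
by rewrite /v /hdt /sum3; ring.
Qed.

Lemma der_hdt m i : D m (v i) =
  (\sig_a \sig_b \sig_c (covh a b c m * covh a b c i + h a b c * cov2h m a b c i))
  + act1 (tconn m) v i.
Proof.
rewrite [LHS](leibniz3 (u' := fun a b c => covh a b c m)
  (w' := fun a b c => cov2h m a b c i + \sig_x tconn m i x * covh a b c x)
  (der_h m)); last first.
  by move=> a b c; rewrite der_covh act4_act3 [act3 _ _ _ _ _ + _]addrC addrA.
by rewrite /act1 /v /hdt /sum3; ring.
Qed.

Lemma der_shape m a b : D m (S a b) = dS m a b + act2 (tconn m) S a b.
Proof.
rewrite [LHS](leibniz2 (u' := fun c d => covh a c d m + \sig_x tconn m a x * h x c d)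
  (w' := fun c d => covh b c d m + \sig_x tconn m b x * h x c d)).
- by rewrite /act2 /S /dS /shape /dshape /sum3; ring.
- by move=> c d; rewrite der_h /act3 /act2 /sum3; ring.
- by move=> c d; rewrite der_h /act3 /act2 /sum3; ring.
Qed.

Lemma der_str2 m : D m (str2 h) = 4 * (\sig_a \sig_b S a b * M a b m).
Proof.
rewrite [LHS](leibniz2 (u' := dS m) (w' := fun a b => dS m b a)).
- have SC a b : S a b = S b a by rewrite /S /shape; do 2 (apply: eq_sum3 => ?); rewrite mulrC.
  have dSE a b : dS m a b = M b a m + M a b m.
    by rewrite /dS /M /dshape /htt /sum3; ring.
  rewrite /sum3 -/S !dSE (SC i1 i0) (SC i2 i0) (SC i2 i1).
  by move: (S) (M) => S' M'; ring.
- exact: der_shape.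
- by move=> a b; rewrite der_shape /act2 /sum3 -/S; ring.
Qed.

Lemma der_htt m a b i : D m (M a b i) =
  (\sig_c \sig_d (covh a c d m * covh b c d i + h a c d * cov2h m b c d i))
  + act3 (tconn m) M a b i.
Proof.
rewrite [LHS](leibniz2 (u' := fun c d => covh a c d m + \sig_x tconn m a x * h x c d)
  (w' := fun c d => cov2h m b c d i + \sig_x (tconn m b x * covh x c d i
     + tconn m i x * covh b c d x))).
- by rewrite /act3 /M /htt /sum3; ring.
- by move=> c d; rewrite der_h /act3 /act2 /sum3; ring.
- by move=> c d; rewrite der_covh /act4 /act2 /sum3; ring.
Qed.

Let X3 i := \sig_a \sig_b S a b * M a b i.
Let X2 i := \sig_j S i j * v j.
Let U a b := \sig_c \sig_d S c d * covh a b c d.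
Let X4 i := \sig_a \sig_b h i a b * U a b.

Lemma der_X3 m i : D m (X3 i) = (\sig_a \sig_b (dS m a b * M a b i + S a b *
  (\sig_c \sig_d (covh a c d m * covh b c d i + h a c d * cov2h m b c d i))))
  + act1 (tconn m) X3 i.
Proof.
pose F a b := \sig_c \sig_d (covh a c d m * covh b c d i + h a c d * cov2h m b c d i).
have FE a b : D m (M a b i) = F a b + act3 (tconn m) M a b i by exact: der_htt.
transitivity ((\sig_a \sig_b (dS m a b * M a b i + S a b * F a b))
  + act1 (tconn m) X3 i); last by [].
move: F FE => F FE; rewrite [LHS](leibniz2 (u' := dS m)
  (w' := fun a b => F a b + \sig_x tconn m i x * M a b x) (der_shape m)).
- by rewrite /act1 /X3 /sum3; move: (S) (M) (dS) => S' M' dS'; ring.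
- by move=> a b; rewrite FE /act3 /act2 /sum3; move: (M) => M'; ring.
Qed.

Lemma der_X2 m i : D m (X2 i) = (\sig_j (dS m i j * v j + S i j *
  (\sig_a \sig_b \sig_c (covh a b c m * covh a b c j + h a b c * cov2h m a b c j))))
  + act1 (tconn m) X2 i.
Proof.
pose F j := \sig_a \sig_b \sig_c (covh a b c m * covh a b c j + h a b c * cov2h m a b c j).
have FE j : D m (v j) = F j + act1 (tconn m) v j by exact: der_hdt.
transitivity ((\sig_j (dS m i j * v j + S i j * F j)) + act1 (tconn m) X2 i);
  last by [].
move: F FE => F FE; rewrite [LHS](leibniz1
  (u' := fun j => dS m i j + \sig_x tconn m i x * S x j) _ FE).
- by rewrite /act1 /X2 /sum3; move: (S) (v) (dS) => S' v' dS'; ring.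
- by move=> j; rewrite der_shape /act2 /act1 /sum3; move: (S) => S'; ring.
Qed.

Lemma der_U m a b : D m (U a b) = (\sig_c \sig_d (dS m c d * covh a b c d
  + S c d * cov2h m a b c d)) + act2 (tconn m) U a b.
Proof.
rewrite [LHS](leibniz2 (u' := dS m) (w' := fun c d => cov2h m a b c d +
  \sig_x (tconn m a x * covh x b c d + tconn m b x * covh a x c d)) (der_shape m)).
- by rewrite /act2 /U /sum3; ring.
- by move=> c d; rewrite der_covh /act4 /act2 /sum3; ring.
Qed.

Lemma der_X4 m i : D m (X4 i) = (\sig_a \sig_b (covh i a b m * U a b + h i a b *
   (\sig_c \sig_d (dS m c d * covh a b c d + S c d * cov2h m a b c d))))
  + act1 (tconn m) X4 i.
Proof.
pose F a b := \sig_c \sig_d (dS m c d * covh a b c d + S c d * cov2h m a b c d).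
have FE a b : D m (U a b) = F a b + act2 (tconn m) U a b by exact: der_U.
transitivity ((\sig_a \sig_b (covh i a b m * U a b + h i a b * F a b))
  + act1 (tconn m) X4 i); last by [].
move: F FE => F FE; rewrite [LHS](leibniz2
  (u' := fun a b => covh i a b m + \sig_x tconn m i x * h x a b) _ FE).
- by rewrite /act1 /X4 /sum3; move: (U) => U'; ring.
- by move=> c d; rewrite der_h /act3 /act2 /sum3; ring.
Qed.

Lemma der_natr m n : D m n%:R = 0.
Proof. by elim: n => [|n IH]; rewrite ?der0 // -addn1 natrD D_add IH der1 addr0. Qed.

(** Half of the field to be integrated: [v] is half of grad s, [X3] a quarter of grad q and [X2]
    half of S grad s. *)
Definition simons_field i := 7 * (s * v i) + 36 * (X3 i - X2 i + X4 i).

Lemma divergence_simons_field :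
  \sig_i (D i (simons_field i) - act1 (tconn i) simons_field i) =
  div_form h covh cov2h.
Proof.
have [t12 t23 t34 ttr] := covh_harmonic.
pose lap a b c := \sig_i cov2h i a b c i.
pose DV i j := \sig_a \sig_b \sig_c (covh a b c i * covh a b c j + h a b c * cov2h i a b c j).
pose DM i a b := \sig_c \sig_d (covh a c d i * covh b c d i + h a c d * cov2h i b c d i).
pose DU i a b := \sig_c \sig_d (dS i c d * covh a b c d + S c d * cov2h i a b c d).
(* The divergences of [X3] and [X2] both contain [P], by the total symmetry of T, so it cancels in
   their difference. *)
pose P := \sig_a \sig_b S a b * (\sig_c \sig_d \sig_i covh a c d i * covh b c d i).
transitivity (7 * (2 * (\sig_i v i ^+ 2) + s * (\sig_i DV i i)) + 36 * (
  (\sig_i \sig_a \sig_b (dS i a b * M a b i + S a b * DM i a b))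
  - (\sig_i \sig_j (dS i i j * v j + S i j * DV i j))
  + (\sig_i \sig_a \sig_b (covh i a b i * U a b + h i a b * DU i a b)))).
  transitivity (\sig_i (7 * (2 * v i ^+ 2 + s * DV i i) + 36 * (
    (\sig_a \sig_b (dS i a b * M a b i + S a b * DM i a b))
    - (\sig_j (dS i i j * v j + S i j * DV i j))
    + (\sig_a \sig_b (covh i a b i * U a b + h i a b * DU i a b))))).
    have Dcomb l x y z w u : D l (7 * (x * y) + 36 * (z - w + u)) =
      7 * (D l x * y + x * D l y) + 36 * (D l z - D l w + D l u).
      by rewrite D_add !D_mul !der_natr !D_add derN; ring.
    apply: eq_sum3 => i; rewrite /simons_field Dcomb.
    rewrite der_X3 der_X2 der_X4 der_str1 der_hdt -/(DV i i).
    set Y3 := \sig_a \sig_b _; set Y2 := \sig_j (dS _ _ _ * _ + _).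
    set Y4 := \sig_a \sig_b _.
    by rewrite /act1 /sum3; ring.
  by rewrite /sum3; ring.
have -> : \sig_i DV i i = normsq4 covh + \sig_a \sig_b \sig_c h a b c * lap a b c.
  rewrite /DV sum3_rotate4 /normsq4 -sum3D; apply: eq_sum3 => a.
  rewrite -sum3D; apply: eq_sum3 => b; rewrite -sum3D; apply: eq_sum3 => c.
  by rewrite sum3D sum3Ml; congr (_ + _); apply: eq_sum3 => i; rewrite expr2.
have -> : \sig_i \sig_a \sig_b (dS i a b * M a b i + S a b * DM i a b) =
  (\sig_i \sig_a \sig_b dS i a b * M a b i) + (P +
  (\sig_a \sig_b S a b * (\sig_c \sig_d h a c d * lap b c d))).
  transitivity ((\sig_i \sig_a \sig_b dS i a b * M a b i) +
    (\sig_i \sig_a \sig_b S a b * DM i a b)); first by rewrite /sum3; ring.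
  congr (_ + _); rewrite /P -sum3D exchange_sum3; apply: eq_sum3 => a.
  rewrite exchange_sum3 -sum3D; apply: eq_sum3 => b; rewrite sum3Ml -mulrDr.
  congr (_ * _); rewrite -sum3D exchange_sum3; apply: eq_sum3 => c.
  by rewrite exchange_sum3 -sum3D; apply: eq_sum3 => d; rewrite sum3D sum3Ml.
have -> : \sig_i \sig_j (dS i i j * v j + S i j * DV i j) =
  (\sig_i \sig_j dS i i j * v j) + (P + (\sig_i \sig_j S i j *
    (\sig_a \sig_b \sig_c h a b c * cov2h i a b c j))).
  rewrite -!sum3D; apply: eq_sum3 => i; rewrite -!sum3D; apply: eq_sum3 => j.
  congr (_ + _); rewrite -mulrDr; congr (_ * _).
  rewrite /DV -!sum3D; apply: eq_sum3 => a; rewrite -!sum3D; apply: eq_sum3 => b.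
  rewrite -!sum3D; apply: eq_sum3 => c; congr (_ * _ + _).
    by rewrite t34 t23 t12.
  by rewrite t34 t23 t12.
have -> : \sig_i \sig_a \sig_b (covh i a b i * U a b + h i a b * DU i a b) =
  (\sig_i \sig_a \sig_b h i a b * (\sig_c \sig_d dS i c d * covh a b c d))
  + (\sig_i \sig_j S i j * (\sig_a \sig_b \sig_c h a b c * cov2h c a b j i)).
  (* Differentiating the factor h of [X4] yields the divergence of h, a trace of T. *)
  have T0 : \sig_i \sig_a \sig_b covh i a b i * U a b = 0.
    have tE i a b : covh i a b i = covh i i a b by rewrite t34 t23.
    transitivity (\sig_a \sig_b (\sig_i covh i i a b) * U a b).
      by rewrite /sum3 !tE; ring.
    transitivity (\sig_a \sig_b 0 * U a b); last by rewrite /sum3; ring.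
    by do 2 (apply: eq_sum3 => ?); rewrite ttr.
  transitivity ((\sig_i \sig_a \sig_b covh i a b i * U a b) + ((\sig_i \sig_a \sig_b
     h i a b * (\sig_c \sig_d dS i c d * covh a b c d))
   + \sig_i \sig_a \sig_b h i a b * (\sig_c \sig_d S c d * cov2h i a b c d))).
    rewrite -!sum3D; apply: eq_sum3 => i; rewrite -!sum3D; apply: eq_sum3 => a.
    rewrite -!sum3D; apply: eq_sum3 => b; rewrite -mulrDr -!sum3D; congr (_ + _ * _).
    by apply: eq_sum3 => c; rewrite -!sum3D.
  rewrite T0 add0r; congr (_ + _); rewrite contract_exchange.
  apply: eq_sum3 => i; apply: eq_sum3 => j; congr (_ * _).
  have [h12 h23 _] := h_harmonic.
  rewrite exchange_sum3; apply: eq_sum3 => a.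
  rewrite exchange_sum3; apply: eq_sum3 => b; apply: eq_sum3 => c.
  by have [_ _ c34 _] := cov2h_harmonic c; rewrite h12 h23 c34.
rewrite /div_form; cbv zeta beta; rewrite -/S -/s -/v -/dS -/M.
(* The second derivatives of h left over from [X4] and [X2] differ in the order of differentiation;
   their difference is the commutator that appears in [div_form]. *)
have -> : \sig_i \sig_j S i j * (\sig_a \sig_b \sig_c
    h a b c * (cov2h c a b j i - cov2h i a b j c)) =
  (\sig_i \sig_j S i j * (\sig_a \sig_b \sig_c h a b c * cov2h c a b j i))
  - (\sig_i \sig_j S i j * (\sig_a \sig_b \sig_c h a b c * cov2h i a b c j)).
  apply/eqP; rewrite eq_sym subr_eq eq_sym; apply/eqP.
  rewrite -!sum3D; apply: eq_sum3 => i; rewrite -!sum3D; apply: eq_sum3 => j.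
  rewrite -mulrDr -!sum3D; congr (_ * _).
  apply: eq_sum3 => a; rewrite -!sum3D; apply: eq_sum3 => b.
  rewrite -!sum3D; apply: eq_sum3 => c.
  by have [_ _ c34 _] := cov2h_harmonic i; rewrite (c34 a b j c); ring.
rewrite /lap; set Z1 := \sig_i \sig_j S i j * _; set Z2 := \sig_i \sig_j S i j * _.
set Z3 := \sig_i \sig_j dS i i j * v j; set Z4 := \sig_i \sig_a \sig_b dS _ _ _ * _.
set Z5 := \sig_a \sig_b S a b * _; set Z6 := \sig_i \sig_a \sig_b h _ _ _ * _.
set Z7 := normsq4 _ + _; set Z8 := sum3 (fun i => v i ^+ 2).
ring.
Qed.

End Derivations.

(** * Lagrangian frames in S^6 from the axioms of the cross product *)

Section MovingFrame.
Variables (A : comNzRingType) (D : 'I_3 -> A -> A).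
Hypothesis D_add : forall l x y, D l (x + y) = D l x + D l y.
Hypothesis D_mul : forall l x y, D l (x * y) = D l x * y + x * D l y.

Variables (V : lmodType A) (dt : V -> V -> A) (cr : V -> V -> V)
  (DV : 'I_3 -> V -> V).
Hypothesis dtC : forall x y, dt x y = dt y x.
Hypothesis dtDl : forall x y z, dt (x + y) z = dt x z + dt y z.
Hypothesis dtZl : forall a x y, dt (a *: x) y = a * dt x y.
Hypothesis crDl : forall x y z, cr (x + y) z = cr x z + cr y z.
Hypothesis crZl : forall a x y, cr (a *: x) y = a *: cr x y.
Hypothesis crC : forall x y, cr x y = - cr y x.
Hypothesis crxx : forall x, cr x x = 0.
Hypothesis dt_cr : forall x y z, dt (cr x y) z = dt x (cr y z).
Hypothesis cr_cr2 : forall x y, cr x (cr x y) = - dt x x *: y + dt x y *: x.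
Hypothesis cr_cr : forall x y z, cr x (cr z y) + cr z (cr x y) =
  (- 2 * dt x z) *: y + dt x y *: z + dt z y *: x.
Hypothesis DV_add : forall l x y, DV l (x + y) = DV l x + DV l y.
Hypothesis DV_scale : forall l a x, DV l (a *: x) = D l a *: x + a *: DV l x.
Hypothesis D_dt : forall l x y, D l (dt x y) = dt (DV l x) y + dt x (DV l y).
Hypothesis DV_cr : forall l x y, DV l (cr x y) = cr (DV l x) y + cr x (DV l y).

Variable beta : 'I_3 -> 'I_3 -> 'I_3 -> A.
Hypothesis D_beta : forall m l x,
  D m (D l x) - D l (D m x) = \sig_a beta m l a * D a x.
Hypothesis DV_beta : forall m l x,
  DV m (DV l x) - DV l (DV m x) = \sig_a beta m l a *: DV a x.

Variables (F : V) (E : 'I_3 -> V).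
Let N i := cr F (E i).
Hypothesis dtFF : dt F F = 1.
Hypothesis DF : forall l, DV l F = E l.
Hypothesis dtEE : forall i j, dt (E i) (E j) = kron A i j.
Hypothesis dtEN : forall i j, dt (E i) (N j) = 0.
Hypothesis frame_complete : forall x, x = dt x F *: F
  + ((\sig_i dt x (E i) *: E i) + \sig_i dt x (N i) *: N i).
(** An inverse of 12 allows factors 2 and 3 to be cancelled and supplies 1/4 as [3 * twelfth]. *)
Variable twelfth : A.
Hypothesis twelfthE : 12 * twelfth = 1.

Let dtDr x y z : dt x (y + z) = dt x y + dt x z.
Proof. by rewrite dtC dtDl !(dtC x). Qed.
Let dtZr a x y : dt x (a *: y) = a * dt x y.
Proof. by rewrite dtC dtZl dtC. Qed.
Let dt0l x : dt 0 x = 0. Proof. by rewrite -(scale0r 0) dtZl mul0r. Qed.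
Let dt0r x : dt x 0 = 0. Proof. by rewrite dtC dt0l. Qed.
Let dtNl x y : dt (- x) y = - dt x y. Proof. by rewrite -scaleN1r dtZl mulN1r. Qed.
Let dtNr x y : dt x (- y) = - dt x y. Proof. by rewrite dtC dtNl dtC. Qed.
Let dt_sumr x (y : 'I_3 -> V) : dt x (sum3 y) = \sig_i dt x (y i).
Proof. by rewrite /sum3 !dtDr. Qed.
Let dt_suml x (y : 'I_3 -> V) : dt (sum3 y) x = \sig_i dt (y i) x.
Proof. by rewrite /sum3 !dtDl. Qed.
Let crDr x y z : cr x (y + z) = cr x y + cr x z.
Proof. by rewrite crC crDl opprD -!(crC x). Qed.
Let crZr a x y : cr x (a *: y) = a *: cr x y.
Proof. by rewrite crC crZl -scalerN -crC. Qed.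
Let cr_suml x (y : 'I_3 -> V) : cr (sum3 y) x = \sig_i cr (y i) x.
Proof. by rewrite /sum3 !crDl. Qed.
Let cr_sumr x (y : 'I_3 -> V) : cr x (sum3 y) = \sig_i cr x (y i).
Proof. by rewrite /sum3 !crDr. Qed.
Let crNr x y : cr x (- y) = - cr x y.
Proof. by rewrite -scaleN1r crZr scaleN1r. Qed.

Let torsion2 (x : A) : x + x = 0 -> x = 0.
Proof.
move=> x0; rewrite -[x]mul1r -twelfthE.
by transitivity (6 * twelfth * (x + x)); [ring|rewrite x0 mulr0].
Qed.

Let torsion3 (x : A) : x + x + x = 0 -> x = 0.
Proof.
move=> x0; rewrite -[x]mul1r -twelfthE.
by transitivity (4 * twelfth * (x + x + x)); [ring|rewrite x0 mulr0].
Qed.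

Let D_kron l i j : D l (kron A i j) = 0.
Proof.
by move: i j; do 2 (refine (ord3P _ _ _)); rewrite /kron /= ?(der1 D_mul) ?(der0 D_add).
Qed.

Lemma frame_dtEF i : dt (E i) F = 0.
Proof.
have := D_dt i F F; rewrite dtFF (der1 D_mul) DF (dtC F) => /esym.
exact: torsion2.
Qed.

Lemma frame_dtNF i : dt (N i) F = 0.
Proof. by rewrite dt_cr dtC dt_cr crxx dt0r. Qed.

Let crFN i : cr F (N i) = - E i.
Proof. by rewrite /N cr_cr2 dtFF (dtC F) frame_dtEF scale0r addr0 scaleN1r. Qed.

Lemma frame_dtNN i j : dt (N i) (N j) = kron A i j.
Proof.
by rewrite /N dt_cr [cr (E i) _]crC dtNr -dt_cr -/(N j); rewrite crFN dtNl opprK dtC dtEE.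
Qed.

Definition frame_conn (l i a : 'I_3) : A := dt (DV l (E i)) (E a).
Definition frame_sff (l i a : 'I_3) : A := dt (DV l (E i)) (N a).
Let G := frame_conn.
Let h := frame_sff.
Let GE l i a : dt (DV l (E i)) (E a) = G l i a. Proof. by []. Qed.
Let hE l i a : dt (DV l (E i)) (N a) = h l i a. Proof. by []. Qed.

Let dtDF l i : dt (DV l (E i)) F = - kron A l i.
Proof.
have := D_dt l (E i) F; rewrite frame_dtEF (der0 D_add) DF dtEE => /esym/eqP.
rewrite addr_eq0 => /eqP ->; congr (- _).
by move: l i; do 2 (refine (ord3P _ _ _)).
Qed.

Lemma der_frame l i : DV l (E i) = - kron A l i *: F
  + ((\sig_a G l i a *: E a) + \sig_a h l i a *: N a).
Proof. by rewrite [LHS]frame_complete dtDF. Qed.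

Lemma frame_conn_skew l : skew3 (G l).
Proof.
have GN i j : G l i j = - G l j i.
  have := D_dt l (E i) (E j); rewrite dtEE D_kron => /esym/eqP.
  by rewrite addr_eq0 (dtC (E i)) => /eqP.
split=> [i|//]; apply: torsion2; rewrite {1}GN; exact: addNr.
Qed.

Let bracketF m l : DV m (E l) - DV l (E m) = \sig_a beta m l a *: E a.
Proof. by have := DV_beta m l F; rewrite !DF => ->; apply: eq_sum3 => a; rewrite DF. Qed.

Let sum3_kron (x : 'I_3 -> A) a : \sig_i x i * kron A i a = x a.
Proof. by move: a; refine (ord3P _ _ _); rewrite /sum3 /kron /=; ring. Qed.

Lemma frame_torsion_free m l a : beta m l a = G m l a - G l m a.
Proof.
have := congr1 (dt^~ (E a)) (bracketF m l).
rewrite dtDl dtNl !GE dt_suml => ->.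
rewrite -(sum3_kron (beta m l)); apply: eq_sum3 => b.
by rewrite dtZl dtEE.
Qed.

Let h12 i j k : h i j k = h j i k.
Proof.
apply/eqP; rewrite -subr_eq0; apply/eqP.
have := congr1 (dt^~ (N k)) (bracketF i j).
rewrite dtDl dtNl dt_suml => ->.
rewrite (eq_sum3 (G := fun=> 0)); first by rewrite /sum3 !addr0.
by move=> a; rewrite dtZl dtEN mulr0.
Qed.

Let phi i j k := dt (cr (E i) (E j)) (E k).
Let phiE i j k : dt (cr (E i) (E j)) (E k) = phi i j k. Proof. by []. Qed.

(** Differentiating the orthogonality of E_j and N_k shows that the failure of h to be symmetric in
    its last two indices is the 3-form [phi]. *)
Let h_phi i j k : h i k j - h i j k = phi j i k.
Proof.
have := D_dt i (E j) (N k); rewrite dtEN (der0 D_add) hE.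
rewrite /N DV_cr DF dtDr -!dt_cr -/(phi j i k) (crC (E j)) -/(N j) dtNl.
rewrite (dtC (N j)) hE => e.
by transitivity (phi j i k - 0); [rewrite e; ring|rewrite subr0].
Qed.

Let phi_cyc i j k : phi i j k = phi j k i.
Proof. by rewrite /phi dt_cr dtC. Qed.

(** h is symmetric in its first two indices and off by [phi] in the last two. Going around through
    the transpositions makes the cyclic sum of [phi] vanish, and this sum is 3 [phi]. It expresses
    that E_i x E_j, hence G, is normal. *)
Let phi0 i j k : phi i j k = 0.
Proof.
apply: torsion3; transitivity (phi i j k + phi j k i + phi k i j).
  by rewrite -(phi_cyc i j k) -(phi_cyc k i j).
rewrite -(h_phi j i k) -(h_phi k j i) -(h_phi i k j).
rewrite (h12 k j i) (h12 j i k) (h12 k i j); ring.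
Qed.

Let h23 i j k : h i j k = h i k j.
Proof. by apply/eqP; rewrite eq_sym -subr_eq0 h_phi phi0. Qed.

Definition frame_sign : A := dt (cr (E i0) (E i1)) (N i2).
Let c := frame_sign.

Let psi i j k := dt (cr (E i) (E j)) (N k).

Let psi12 i j k : psi i j k = - psi j i k.
Proof. by rewrite /psi crC dtNl. Qed.

Let psi23 i j k : psi i j k = - psi i k j.
Proof.
apply/eqP; rewrite -addr_eq0 /psi !dt_cr -dtDr /N (crC F) (crC F) !crNr -opprD.
by rewrite cr_cr dtNr !dtDr !dtZr !frame_dtEF; apply/eqP; ring.
Qed.

Let psiE i j k : psi i j k = c * eps3 A i j k.
Proof.
have p12 a b : psi a a b = 0 by apply: torsion2; rewrite {1}psi12 addNr.
have p23 a b : psi a b b = 0 by apply: torsion2; rewrite {1}psi23 addNr.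
have p13 a b : psi a b a = 0 by rewrite psi12 p23 oppr0.
have c0 : psi i0 i1 i2 = c by [].
move: i j k; do 3 (refine (ord3P _ _ _)); rewrite /eps3 /= ?p12 ?p23 ?p13;
  rewrite ?mulr0 ?mulrN1 ?mulr1 //.
- by rewrite psi23 psi12 c0 opprK.
- by rewrite psi12 psi23 c0 opprK.
- by rewrite psi12 psi23 psi12 c0 opprK.
Qed.

Lemma cr_frame i j : cr (E i) (E j) = \sig_k (c * eps3 A i j k) *: N k.
Proof.
rewrite [LHS]frame_complete.
rewrite [X in X *: F](_ : _ = 0); last first.
  by rewrite dt_cr crC dtNr -/(N j) dtEN oppr0.
rewrite scale0r add0r [X in X + _](_ : _ = 0) ?add0r.
  by apply: eq_sum3 => k; rewrite -psiE.
by rewrite /sum3 !phiE !phi0 !scale0r !addr0.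
Qed.

Lemma frame_sign_sq : c ^+ 2 = 1.
Proof.
have : dt (cr (E i0) (E i1)) (cr (E i0) (E i1)) = 1.
  rewrite dt_cr (crC (E i0)) crNr cr_cr2 dtNr dtDr !dtZr !dtEE /kron /=; ring.
rewrite cr_frame /sum3 /eps3 /= !mulr0 !scale0r !add0r mulr1 dtZl dtZr frame_dtNN mulr1.
by rewrite expr2.
Qed.

Lemma der_sign l : D l c = 0.
Proof.
have := der1 D_mul l; rewrite -frame_sign_sq expr2 D_mul (mulrC _ c) => /torsion2 e.
by rewrite -[LHS]mul1r -frame_sign_sq expr2 -mulrA e mulr0.
Qed.

Let cr_NE a b : cr (N a) (E b) = - kron A a b *: F
  + \sig_k (c * eps3 A a b k) *: E k.
Proof.
have e : cr (E b) (N a) = kron A b a *: F - cr F (cr (E b) (E a)).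
  apply/eqP; rewrite eq_sym subr_eq cr_cr frame_dtEF mulr0 scale0r add0r (dtC F) frame_dtEF.
  by rewrite scale0r addr0 dtEE.
rewrite crC e opprB addrC cr_frame cr_sumr -scaleNr; congr (_ *: _ + _).
  by move: a b {e}; do 2 (refine (ord3P _ _ _)).
apply: eq_sum3 => k; rewrite crZr crFN scalerN -scaleNr -mulrN; congr (_ * _ *: _).
by move: a b k {e}; do 3 (refine (ord3P _ _ _)); rewrite /eps3 /= ?opprK ?oppr0.
Qed.

(** Since N_a = F x E_a, its derivative is E_l x E_a + F x D_l E_a. The first summand is normal and
    shifts the normal connection from [G] to [G + c * eps3]; this shift is the source of all torsion
    terms. *)
Lemma der_normal l a : DV l (N a) =
  (\sig_k (G l a k + c * eps3 A l a k) *: N k) - \sig_k h l a k *: E k.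
Proof.
rewrite /N DV_cr DF cr_frame der_frame crDr crZr crxx scaler0 add0r crDr !cr_sumr.
rewrite addrA -sum3D; congr (_ + _).
  by apply: eq_sum3 => k; rewrite crZr -scalerDl addrC.
rewrite -scaleN1r; rewrite /sum3 !scalerDr !crZr !crFN.
by rewrite !scalerN !scaleN1r.
Qed.

(** Minimality: differentiate E_0 x E_1 = c N_2 and compare the components along E_2; the trace of h
    appears multiplied by the invertible c. *)
Lemma frame_sff_trace i : \sig_j h j j i = 0.
Proof.
rewrite -[LHS]mul1r -frame_sign_sq expr2 -mulrA.
have [dE0 dE1] := (der_frame i i0, der_frame i i1).
have : dt (DV i (cr (E i0) (E i1))) (E i2) =
    dt (DV i (\sig_k (c * eps3 A i0 i1 k) *: N k)) (E i2) by rewrite cr_frame.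
rewrite (_ : \sig_k (c * eps3 A i0 i1 k) *: N k = c *: N i2); last first.
  by rewrite /sum3 /eps3 /= !mulr0 !scale0r !add0r mulr1.
rewrite DV_scale der_sign scale0r.
rewrite add0r dtZl DV_cr dtDl (crC (E i0)) dtNl.
have T l a b m : dt (cr (DV l (E a)) (E b)) (E m) = \sig_k c * h l a k * eps3 A k b m.
  rewrite der_frame crDl crZl dtDl dtZl -/(N b).
  rewrite (dtC (N b)) dtEN mulr0 add0r crDl !cr_suml dtDl !dt_suml.
  rewrite (_ : \sig_k dt (cr (G l a k *: E k) (E b)) (E m) = 0) ?add0r; last first.
    by rewrite /sum3 !crZl !dtZl !phiE !phi0 !mulr0 !addr0.
  apply: eq_sum3 => k; rewrite crZl dtZl cr_NE dtDl dtZl (dtC F) frame_dtEF mulr0 add0r.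
  rewrite dt_suml; rewrite (_ : c * h l a k * eps3 A k b m = h l a k * (c * eps3 A k b m)); last by ring.
  congr (_ * _); rewrite -[RHS](sum3_kron (fun x => c * eps3 A k b x)).
  by apply: eq_sum3 => x; rewrite dtZl dtEE.
rewrite !T der_normal dtDl dtNl !dt_suml.
rewrite (_ : \sig_k dt ((G i i2 k + c * eps3 A i i2 k) *: N k) (E i2) = 0); last first.
  by rewrite /sum3 !dtZl !(dtC (N _)) !dtEN !mulr0 !addr0.
rewrite (_ : \sig_k dt (h i i2 k *: E k) (E i2) = h i i2 i2); last first.
  rewrite -[RHS](sum3_kron (h i i2)); apply: eq_sum3 => x; by rewrite dtZl dtEE.
rewrite /sum3 /eps3 /= => e.
rewrite (_ : c * (h i0 i0 i + h i1 i1 i + h i2 i2 i) = 0) ?mulr0 //.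
rewrite !(h23 _ _ i) !(h12 _ i _).
transitivity (c * h i i0 i0 + c * h i i1 i1 + c * h i i2 i2); first by ring.
move/eqP: e; rewrite -subr_eq0 => /eqP e; rewrite -e; ring.
Qed.

Lemma frame_sff_harmonic : harmonic3 h.
Proof. split; [exact: h12|exact: h23|exact: frame_sff_trace]. Qed.

Let dt_derE_derN l i m k : dt (DV l (E i)) (DV m (N k)) =
  \sig_a (h l i a * (G m k a + c * eps3 A m k a) - G l i a * h m k a).
Proof.
rewrite der_normal dtDr dtNr !dt_sumr.
rewrite /sum3 !dtZr !GE !hE; ring.
Qed.

(** The flatness of R^7, in the form of [DV_beta] for E_i, read along N_k; read along E_k it gives
    the Gauss equation. *)
Lemma frame_codazzi m l i k : D m (h l i k) - D l (h m i k) =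
  \sig_a ((G m l a - G l m a) * h a i k - G l i a * h m k a + G m i a * h l k a
   + h l i a * (G m k a + c * eps3 A m k a)
   - h m i a * (G l k a + c * eps3 A l k a)).
Proof.
rewrite /h /frame_sff !D_dt !dt_derE_derN.
have := congr1 (dt^~ (N k)) (DV_beta m l (E i)); rewrite dtDl dtNl dt_suml.
move=> /eqP; rewrite subr_eq => /eqP ->.
rewrite /sum3 !dtZl !frame_torsion_free !hE; ring.
Qed.

Lemma frame_gauss m l i k : D m (G l i k) - D l (G m i k) =
  kron A l i * kron A m k - kron A m i * kron A l k
  + \sig_a ((G m l a - G l m a) * G a i k + G l i a * G m k a - G m i a * G l k a
     + h l i a * h m k a - h m i a * h l k a).
Proof.
rewrite /G /frame_conn !D_dt.
have := congr1 (dt^~ (E k)) (DV_beta m l (E i)); rewrite dtDl dtNl dt_suml.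
move=> /eqP; rewrite subr_eq => /eqP ->.
have dEE p q j : dt (DV p (E j)) (DV q (E k)) = kron A p j * kron A q k
  + \sig_a (G p j a * G q k a + h p j a * h q k a).
  rewrite (der_frame q) dtDr dtZr dtDr !dt_sumr dtDF.
  by rewrite /sum3 !dtZr !GE !hE; ring.
rewrite !dEE /sum3 !dtZl !frame_torsion_free !GE; ring.
Qed.

Lemma frame_divergence (w : 'I_3 -> A) :
  \sig_b dt (E b) (DV b (\sig_i w i *: E i)) = \sig_j (D j (w j) - act1 (G j) w j).
Proof.
apply: eq_sum3 => b; transitivity (\sig_i (D b (w i) * kron A i b + w i * G b i b)).
  rewrite /sum3 !DV_add !dtDr; rewrite !DV_scale !dtDr !dtZr !(dtC (E b)) !dtEE.
  by rewrite !GE.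
rewrite sum3D sum3_kron /act1; congr (_ + _).
have [x [y [z ->]]] := skew3E (frame_conn_skew b).
by move: b; refine (ord3P _ _ _); rewrite /sum3 /=; ring.
Qed.

End MovingFrame.

(** * The Cayley cross product on R^7 over a commutative ring *)

Notation j0 := (@Ordinal 7 0 isT).
Notation j1 := (@Ordinal 7 1 isT).
Notation j2 := (@Ordinal 7 2 isT).
Notation j3 := (@Ordinal 7 3 isT).
Notation j4 := (@Ordinal 7 4 isT).
Notation j5 := (@Ordinal 7 5 isT).
Notation j6 := (@Ordinal 7 6 isT).

Lemma ord7P (P : 'I_7 -> Prop) : P j0 -> P j1 -> P j2 -> P j3 -> P j4 -> P j5 ->
  P j6 -> forall i, P i.
Proof.
move=> P0 P1 P2 P3 P4 P5 P6.
by move=> [[|[|[|[|[|[|[|//]]]]]]] Hi]; rewrite (bool_irrelevance Hi isT).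
Qed.

Lemma sum7E (V : nmodType) (f : 'I_7 -> V) :
  \sum_i f i = f j0 + (f j1 + (f j2 + (f j3 + (f j4 + (f j5 + f j6))))).
Proof.
rewrite !big_ord_recl big_ord0 addr0.
by do 6 (congr (_ + _); first by congr f; apply: val_inj); congr f; apply: val_inj.
Qed.

Lemma sum_sum3 (V : nmodType) (I : finType) (f : 'I_3 -> I -> V) :
  \sum_y \sig_p f p y = \sig_p \sum_y f p y.
Proof. by rewrite /sum3 !big_split. Qed.

Section Dim7.
Variable A : comNzRingType.
Implicit Types x y z : 'rV[A]_7.

Definition dot7 x y : A := \sum_i x 0 i * y 0 i.

(* Coordinates of the product of imaginary Cayley numbers, for the basis in
   which the Cayley-Dickson doubling of Defs is written. *)
Definition fano (x y : 'I_7 -> A) (i : 'I_7) : A :=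
  match i : nat with
  | 0%N => x j1 * y j2 - x j2 * y j1 + (x j3 * y j4 - x j4 * y j3)
        + (x j6 * y j5 - x j5 * y j6)
  | 1%N => x j2 * y j0 - x j0 * y j2 + (x j3 * y j5 - x j5 * y j3)
        + (x j4 * y j6 - x j6 * y j4)
  | 2%N => x j0 * y j1 - x j1 * y j0 + (x j3 * y j6 - x j6 * y j3)
        + (x j5 * y j4 - x j4 * y j5)
  | 3%N => x j4 * y j0 - x j0 * y j4 + (x j5 * y j1 - x j1 * y j5)
        + (x j6 * y j2 - x j2 * y j6)
  | 4%N => x j0 * y j3 - x j3 * y j0 + (x j2 * y j5 - x j5 * y j2)
        + (x j6 * y j1 - x j1 * y j6)
  | 5%N => x j0 * y j6 - x j6 * y j0 + (x j1 * y j3 - x j3 * y j1)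
        + (x j4 * y j2 - x j2 * y j4)
  | _ => x j1 * y j4 - x j4 * y j1 + (x j2 * y j3 - x j3 * y j2)
        + (x j5 * y j0 - x j0 * y j5)
  end.

Definition cross7 x y : 'rV[A]_7 := \row_i fano (x 0) (y 0) i.

Lemma cross7_row x (u : 'I_7 -> A) :
  cross7 x (\row_i u i) = \row_i fano (x 0) u i.
Proof.
apply/rowP => i; rewrite !mxE; congr (fano _ _ _).
by apply/funext => k; rewrite mxE.
Qed.

Lemma dot7C x y : dot7 x y = dot7 y x.
Proof. by apply: eq_bigr => i _; rewrite mulrC. Qed.

Lemma dot7Dl x y z : dot7 (x + y) z = dot7 x z + dot7 y z.
Proof. by rewrite -big_split; apply: eq_bigr => i _; rewrite mxE mulrDl. Qed.

Lemma dot7Zl a x y : dot7 (a *: x) y = a * dot7 x y.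
Proof. by rewrite mulr_sumr; apply: eq_bigr => i _; rewrite mxE mulrA. Qed.

Lemma cross7Dl x y z : cross7 (x + y) z = cross7 x z + cross7 y z.
Proof.
apply/rowP; refine (ord7P _ _ _ _ _ _ _); rewrite !mxE /fano /= !mxE; ring.
Qed.

Lemma cross7Zl a x y : cross7 (a *: x) y = a *: cross7 x y.
Proof.
apply/rowP; refine (ord7P _ _ _ _ _ _ _); rewrite !mxE /fano /= ?mxE; ring.
Qed.

Lemma cross7C x y : cross7 x y = - cross7 y x.
Proof. by apply/rowP; refine (ord7P _ _ _ _ _ _ _); rewrite !mxE /fano /=; ring. Qed.

Lemma cross7xx x : cross7 x x = 0.
Proof. by apply/rowP; refine (ord7P _ _ _ _ _ _ _); rewrite !mxE /fano /=; ring. Qed.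

Lemma dot7_cross x y z : dot7 (cross7 x y) z = dot7 x (cross7 y z).
Proof. by rewrite /dot7 !sum7E !mxE /fano /=; ring. Qed.

Lemma cross7_cross2 x y :
  cross7 x (cross7 x y) = - dot7 x x *: y + dot7 x y *: x.
Proof.
rewrite {2}/cross7 cross7_row; apply/rowP; refine (ord7P _ _ _ _ _ _ _);
by rewrite !mxE /fano /dot7 !sum7E /=; ring.
Qed.

Lemma cross7_cross x y z : cross7 x (cross7 z y) + cross7 z (cross7 x y) =
  (- 2 * dot7 x z) *: y + dot7 x y *: z + dot7 z y *: x.
Proof.
rewrite [cross7 z y]/cross7 [cross7 x y]/cross7 !cross7_row.
apply/rowP; refine (ord7P _ _ _ _ _ _ _);
by rewrite !mxE /fano /dot7 !sum7E /=; ring.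
Qed.

Section Derivation7.
Variable D : 'I_3 -> A -> A.
Hypothesis D_add : forall l a b, D l (a + b) = D l a + D l b.
Hypothesis D_mul : forall l a b, D l (a * b) = D l a * b + a * D l b.

Definition der7 (l : 'I_3) x : 'rV[A]_7 := \row_i D l (x 0 i).

Lemma der7D l x y : der7 l (x + y) = der7 l x + der7 l y.
Proof. by apply/rowP => i; rewrite !mxE D_add. Qed.

Lemma der7Z l a x : der7 l (a *: x) = D l a *: x + a *: der7 l x.
Proof. by apply/rowP => i; rewrite !mxE D_mul. Qed.

Lemma der_dot7 l x y : D l (dot7 x y) = dot7 (der7 l x) y + dot7 x (der7 l y).
Proof.
by rewrite /dot7 !sum7E !D_add !D_mul !mxE; ring.
Qed.

Lemma der7_cross l x y :
  der7 l (cross7 x y) = cross7 (der7 l x) y + cross7 x (der7 l y).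
Proof.
by apply/rowP; refine (ord7P _ _ _ _ _ _ _);
  rewrite !mxE /fano /= !D_add !(derN D_add) !D_mul !mxE; ring.
Qed.

Lemma der7_bracket (beta : 'I_3 -> 'I_3 -> 'I_3 -> A) m l x :
  (forall b, D m (D l b) - D l (D m b) = \sig_a beta m l a * D a b) ->
  der7 m (der7 l x) - der7 l (der7 m x) = \sig_a beta m l a *: der7 a x.
Proof. by move=> e; apply/rowP => i; rewrite !mxE e. Qed.

End Derivation7.

(** The seven vectors are the rows of a matrix Q with Q Q^T = 1. Over a commutative ring this
    implies Q^T Q = 1, which is the expansion of x. *)
Lemma orthonormal7_complete (F : 'rV[A]_7) (E N : 'I_3 -> 'rV[A]_7) :
  dot7 F F = 1 -> (forall i, dot7 (E i) F = 0) -> (forall i, dot7 (N i) F = 0) ->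
  (forall i j, dot7 (E i) (E j) = kron A i j) ->
  (forall i j, dot7 (N i) (N j) = kron A i j) ->
  (forall i j, dot7 (E i) (N j) = 0) ->
  forall x, x = dot7 x F *: F
  + ((\sig_i dot7 x (E i) *: E i) + \sig_i dot7 x (N i) *: N i).
Proof.
move=> FF EF NF EE NN EN x.
pose q (k : 'I_7) := nth 0 [:: F; E i0; E i1; E i2; N i0; N i1; N i2] k.
pose Q : 'M[A]_7 := \matrix_k q k.
have qq k l : dot7 (q k) (q l) = (k == l)%:R.
  move: k l; do 2 (refine (ord7P _ _ _ _ _ _ _)); rewrite /q /= ?FF ?EF ?NF ?EE ?NN ?EN
   ?[dot7 F _]dot7C ?[dot7 (N _) (E _)]dot7C ?EF ?NF ?EN //.
have QQ : Q *m Q^T = 1%:M.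
  apply/matrixP => k l; rewrite !mxE -qq; apply: eq_bigr => i _.
  by rewrite !mxE.
have /(congr1 (mulmx x)) := mulmx1C QQ; rewrite mulmx1 mulmxA => {1}<-.
apply/rowP => j; rewrite mxE.
have xq k : (x *m Q^T) 0 k = dot7 x (q k).
  by rewrite mxE; apply: eq_bigr => i _; rewrite !mxE.
by rewrite sum7E !xq !mxE /q /=; ring.
Qed.

End Dim7.

(* The vector field whose divergence is integrated, written through the tangential
   derivations P_x = (grad, e_x) of the ambient coordinates only, so that it does not
   depend on a frame. *)
Section Ambient.
Variables (B : comNzRingType) (P : 'I_7 -> B -> B) (f : 'I_7 -> B).

(** The gradient of a coordinate function is the tangential part of a coordinate vector, so these
    are the entries of the orthogonal projection to the tangent space; [amb_normal z] is J of the
    tangential part of the z-th coordinate vector. *)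
Definition amb_proj (y a : 'I_7) : B := P y (f a).
Definition amb_normal (z a : 'I_7) : B := fano f (amb_proj z) a.
Definition amb_sff (x y z : 'I_7) : B :=
  \sum_a P x (amb_proj y a) * amb_normal z a.
Definition amb_shape (y z : 'I_7) : B :=
  \sum_x \sum_w amb_sff y x w * amb_sff z x w.
Definition amb_s : B := \sum_y amb_shape y y.
Definition amb_q : B := \sum_y \sum_z amb_shape y z * amb_shape z y.
Definition amb_last (x : 'I_7) : B := \sum_a \sum_b amb_sff x a b *
  (\sum_c \sum_d amb_shape c d * P a (amb_sff b c d)).
Definition amb_field (x : 'I_7) : B := 7 * (amb_s * P x amb_s) + 18 * P x amb_q
  - 36 * (\sum_y amb_shape x y * P y amb_s) + 72 * amb_last x.
Definition amb_div : B := \sum_x P x (amb_field x).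

End Ambient.

(** * The ambient field and its divergence in an adapted frame *)

Section FrameInSphere.
Variables (A : comNzRingType) (D : 'I_3 -> A -> A).
Hypothesis D_add : forall l x y, D l (x + y) = D l x + D l y.
Hypothesis D_mul : forall l x y, D l (x * y) = D l x * y + x * D l y.
Variable beta : 'I_3 -> 'I_3 -> 'I_3 -> A.
Hypothesis D_beta : forall m l x,
  D m (D l x) - D l (D m x) = \sig_a beta m l a * D a x.
Variables (F : 'rV[A]_7) (E : 'I_3 -> 'rV[A]_7).
Let N i := cross7 F (E i).
Hypothesis dtFF : dot7 F F = 1.
Hypothesis DF : forall l, der7 D l F = E l.
Hypothesis dtEE : forall i j, dot7 (E i) (E j) = kron A i j.
Hypothesis dtEN : forall i j, dot7 (E i) (N j) = 0.
Variable twelfth : A.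
Hypothesis twelfthE : 12 * twelfth = 1.

Let D7D := der7D D_add.
Let D7Z := der7Z D_mul.
Let Ddt := der_dot7 D_add D_mul.
Let Dcr := der7_cross D_add D_mul.
Let D7b m l x : der7 D m (der7 D l x) - der7 D l (der7 D m x) =
  \sig_a beta m l a *: der7 D a x := der7_bracket x (D_beta m l).

Ltac dim7 := first [ eassumption | exact (@dot7C A) | exact (@dot7Dl A)
  | exact (@dot7Zl A) | exact (@cross7Dl A) | exact (@cross7Zl A)
  | exact (@cross7C A) | exact (@cross7xx A) | exact (@dot7_cross A)
  | exact (@cross7_cross2 A) | exact (@cross7_cross A) | exact D7D | exact D7Z
  | exact Ddt | exact Dcr | exact D7b ].

Let EF i : dot7 (E i) F = 0.
Proof. eapply frame_dtEF; dim7. Qed.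

Let NF i : dot7 (N i) F = 0.
Proof. eapply frame_dtNF; dim7. Qed.

Let NN i j : dot7 (N i) (N j) = kron A i j.
Proof.
eapply frame_dtNN; dim7.
Qed.

Lemma frame7_EF i : dot7 (E i) F = 0.
Proof. exact: EF. Qed.

Lemma frame7_NF i : dot7 (N i) F = 0.
Proof. exact: NF. Qed.

Lemma frame7_NN i j : dot7 (N i) (N j) = kron A i j.
Proof. exact: NN. Qed.

Lemma frame7_complete x : x = dot7 x F *: F
  + ((\sig_i dot7 x (E i) *: E i) + \sig_i dot7 x (N i) *: N i).
Proof. exact: orthonormal7_complete. Qed.

Definition sff7 : 'I_3 -> 'I_3 -> 'I_3 -> A := frame_sff (@dot7 A) (@cross7 A) (der7 D) F E.
Definition conn7 : 'I_3 -> 'I_3 -> 'I_3 -> A := frame_conn (@dot7 A) (der7 D) E.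
Definition sign7 : A := frame_sign (@dot7 A) (@cross7 A) F E.
(** A quarter of the sign: the normal connection differs from the tangential one by [sign7 * eps3],
    which is [4 * tau7 * eps3]. *)
Definition tau7 : A := 3 * twelfth * sign7.
Definition cov7 : 'I_3 -> 'I_3 -> 'I_3 -> 'I_3 -> A := covh D conn7 sff7 tau7.
Definition cov27 : 'I_3 -> 'I_3 -> 'I_3 -> 'I_3 -> 'I_3 -> A :=
  cov2h D conn7 sff7 tau7.

Ltac frame7 := first [dim7 | exact frame7_complete].
Let G := conn7.
Let h := sff7.

Lemma tau7_4 : 4 * tau7 = sign7.
Proof.
transitivity (12 * twelfth * sign7); last by rewrite twelfthE mul1r.
by rewrite /tau7; ring.
Qed.

Lemma sign7_sq : sign7 ^+ 2 = 1.
Proof. eapply frame_sign_sq; frame7. Qed.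

Lemma tau7_sq : 16 * tau7 ^+ 2 = 1.
Proof. by transitivity (sign7 ^+ 2); [rewrite -tau7_4; ring|exact: sign7_sq]. Qed.

Lemma der_sign7 l : D l sign7 = 0.
Proof. eapply der_sign; frame7. Qed.

Lemma der_tau7 l : D l tau7 = 0.
Proof.
have t0 : 12 * D l twelfth = 0.
  have := congr1 (D l) twelfthE; rewrite D_mul (der_natr D_add D_mul) mul0r add0r.
  by rewrite (der1 D_mul).
rewrite /tau7 !D_mul der_sign7 (der_natr D_add D_mul) mulr0 addr0 mul0r add0r.
rewrite (_ : D l twelfth = 0) ?mulr0 ?mul0r //.
transitivity (12 * twelfth * D l twelfth); first by rewrite twelfthE mul1r.
by rewrite mulrAC t0 mul0r.
Qed.

Lemma conn7_skew l : skew3 (G l).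
Proof. eapply frame_conn_skew; frame7. Qed.

Lemma conn7_bracket m l x :
  D m (D l x) - D l (D m x) = \sig_a (G m l a - G l m a) * D a x.
Proof.
rewrite D_beta; apply: eq_sum3 => a; congr (_ * _).
eapply frame_torsion_free; frame7.
Qed.

Lemma sff7_harmonic : harmonic3 h.
Proof. eapply frame_sff_harmonic; frame7. Qed.

Lemma sff7_codazzi m l i k : D m (h l i k) - D l (h m i k) =
  \sig_a ((G m l a - G l m a) * h a i k - G l i a * h m k a + G m i a * h l k a
   + h l i a * (G m k a + 4 * tau7 * eps3 A m k a)
   - h m i a * (G l k a + 4 * tau7 * eps3 A l k a)).
Proof.
rewrite tau7_4.
eapply frame_codazzi; frame7.
Qed.

Lemma sff7_gauss m l i k : D m (G l i k) - D l (G m i k) =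
  kron A l i * kron A m k - kron A m i * kron A l k
  + \sig_a ((G m l a - G l m a) * G a i k + G l i a * G m k a - G m i a * G l k a
     + h l i a * h m k a - h m i a * h l k a).
Proof. eapply frame_gauss; frame7. Qed.

Lemma cov7_harmonic : harmonic4 cov7.
Proof.
by apply: covh_harmonic; [|exact: conn7_skew|exact: sff7_harmonic|exact: sff7_codazzi].
Qed.

Lemma cov27_harmonic m : harmonic4 (cov27 m).
Proof.
by apply: cov2h_harmonic; [|exact: conn7_skew|exact: sff7_harmonic|exact: sff7_codazzi].
Qed.

Lemma cov7_ricci m l a b c : cov27 m a b c l - cov27 l a b c m =
  curv_act tau7 h m l a b c + 2 * - tau7 * (\sig_p eps3 A m l p * cov7 a b c p).
Proof.
apply: ricci_identity; [by []|by []|exact: der_tau7|exact: conn7_skew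
  |exact: conn7_bracket|exact: sff7_gauss].
Qed.

Lemma sign_frame7 i j : cross7 (E i) (E j) = \sig_k (sign7 * eps3 A i j k) *: N k.
Proof. eapply cr_frame; frame7. Qed.

Lemma der_normal7 l a : der7 D l (N a) =
  (\sig_k (G l a k + sign7 * eps3 A l a k) *: N k) - \sig_k h l a k *: E k.
Proof. eapply der_normal; frame7. Qed.

Definition tgrad (x : 'I_7) (u : A) : A := \sig_i E i 0 x * D i u.
Let P := tgrad.
Let f := F 0.

(** Ambient coordinates of the tangent vector with frame components u; [twoidx] and [lift] do the
    same for tensors. Sums over ambient indices turn into sums over frame indices since the E_i are
    orthonormal. *)
Definition comb (u : 'I_3 -> A) (x : 'I_7) : A := \sig_i u i * E i 0 x.

Lemma contract1 u w : \sum_x comb u x * comb w x = \sig_i u i * w i.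
Proof.
transitivity (dot7 (\sig_i u i *: E i) (\sig_i w i *: E i)).
  by apply: eq_bigr => x _; rewrite /sum3 !mxE /comb /sum3.
rewrite /sum3 !dot7Dl !dot7Zl !(dot7C (E _)) !dot7Dl !dot7Zl !dtEE /kron /=; ring.
Qed.

(** The derivatives of the E_i inside [comb] have tangential part [G], so a contraction with a
    tangent vector produces the Levi-Civita derivative. *)
Lemma contract_der j u w :
  \sum_x comb u x * D j (comb w x) = \sig_k u k * (D j (w k) - act1 (G j) w k).
Proof.
have [a [b [c gE]]] := skew3E (conn7_skew j).
have dE i k : dot7 (der7 D j (E i)) (E k) = G j i k by [].
transitivity (dot7 (der7 D j (\sig_i w i *: E i)) (\sig_i u i *: E i)).
  by apply: eq_bigr => x _; rewrite /sum3 !mxE /comb /sum3 mulrC.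
rewrite /sum3 !D7D !D7Z !dot7Dl !dot7Zl ![dot7 _ (_ + _)]dot7C !dot7Dl !dot7Zl.
rewrite ![dot7 (E _) (der7 _ _ _)]dot7C !dtEE !dE gE /act1 /sum3 /kron /=; ring.
Qed.

Let twoidx u x y := comb (fun p => comb (u p) y) x.

Lemma contract2 u w : \sum_x \sum_y twoidx u x y * twoidx w x y =
  \sig_i \sig_j u i j * w i j.
Proof.
rewrite exchange_big /=; under eq_bigr do rewrite contract1.
by rewrite sum_sum3; apply: eq_sum3 => i; exact: contract1.
Qed.

Let lift h x y z := comb (fun p => twoidx (h p) y z) x.

(** The projection is the sum of E_j tensor E_j. Contracted with a normal vector, only the terms in
    which the contracted factor is differentiated survive. *)
Lemma amb_sff_frame x y z : amb_sff P f x y z = lift h x y z.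
Proof.
have projE a b : amb_proj P f a b = comb (fun i => E i 0 b) a.
  by apply: eq_sum3 => i; rewrite mulrC; congr (_ * _); rewrite -DF mxE.
have normE a b : amb_normal P f a b = comb (fun k => N k 0 b) a.
  rewrite /amb_normal (_ : amb_proj P f a = fun b => comb (fun i => E i 0 b) a);
    last by apply/funext.
  rewrite /comb /sum3 !mxE; move: b; refine (ord7P _ _ _ _ _ _ _);
  rewrite /fano /f /=; ring.
have P_D u : P x u = comb (fun i => D i u) x.
  by apply: eq_sum3 => i; rewrite mulrC.
rewrite /amb_sff; under eq_bigr do rewrite P_D normE projE.
transitivity (\sum_b comb (fun i => D i (comb (fun j => E j 0 b) y)
   * comb (fun k => N k 0 b) z) x).
  by apply: eq_bigr => b _; rewrite /comb /sum3; ring.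
rewrite /comb sum_sum3; apply: eq_sum3 => i; rewrite -mulr_suml; congr (_ * _).
transitivity (\sum_b \sig_k ((\sig_j ((der7 D i (E j)) 0 b * N k 0 b * E j 0 y
   + E j 0 b * N k 0 b * D i (E j 0 y))) * E k 0 z)).
  by apply: eq_bigr => b _; rewrite /sum3 !D_add !D_mul !mxE; ring.
rewrite sum_sum3 /twoidx /comb.
transitivity (\sig_k \sig_j h i j k * E j 0 y * E k 0 z).
  apply: eq_sum3 => k; rewrite -mulr_suml sum_sum3 /sum3 !mulrDl.
  have e j : \sum_b (der7 D i (E j) 0 b * N k 0 b * E j 0 y
    + E j 0 b * N k 0 b * D i (E j 0 y)) = h i j k * E j 0 y.
    rewrite big_split /= -!mulr_suml.
    by rewrite -/(dot7 (E j) (N k)) dtEN mul0r addr0.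
  by rewrite !e.
by rewrite /sum3; ring.
Qed.

Lemma amb_shape_frame y z : amb_shape P f y z = twoidx (shape h) y z.
Proof.
rewrite /amb_shape; under eq_bigr do under eq_bigr do rewrite !amb_sff_frame.
transitivity (\sum_x \sum_w \sig_p \sig_r (twoidx (h p) x w * twoidx (h r) x w)
   * (E p 0 y * E r 0 z)).
  by do 2 (apply: eq_bigr => ? _); rewrite /lift /comb /sum3; ring.
under eq_bigr do rewrite sum_sum3; rewrite sum_sum3 /twoidx {1}/comb.
apply: eq_sum3 => p.
under eq_bigr do rewrite sum_sum3; rewrite sum_sum3.
rewrite {1}/comb -[RHS]mulrC -sum3Ml; apply: eq_sum3 => r.
under eq_bigr do rewrite -mulr_suml; rewrite -mulr_suml contract2 /shape; ring.
Qed.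

Lemma amb_s_frame : amb_s P f = str1 h.
Proof.
rewrite /amb_s; under eq_bigr do rewrite amb_shape_frame.
rewrite /twoidx; transitivity (\sum_y \sig_p (comb (shape h p) y * comb (fun i => kron A i p) y)).
  apply: eq_bigr => y _; rewrite {1}/comb; apply: eq_sum3 => p; congr (_ * _).
  by move: p; refine (ord3P _ _ _); rewrite /comb /sum3 /kron /=; ring.
rewrite sum_sum3; apply: eq_sum3 => p; rewrite contract1.
by move: p; refine (ord3P _ _ _); rewrite /sum3 /kron /=; ring.
Qed.

Lemma amb_q_frame : amb_q P f = str2 h.
Proof.
have sC a b : shape h a b = shape h b a.
  by do 2 (apply: eq_sum3 => ?); rewrite mulrC.
rewrite /amb_q; under eq_bigr do under eq_bigr do rewrite !amb_shape_frame.
transitivity (\sum_y \sum_z twoidx (shape h) y z * twoidx (shape h) y z).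
  apply: eq_bigr => y _; apply: eq_bigr => z _; congr (_ * _).
  by rewrite /twoidx /comb /sum3 (sC i1 i0) (sC i2 i0) (sC i2 i1); ring.
by rewrite contract2; do 2 (apply: eq_sum3 => ?); rewrite (sC _ _); congr (_ * _).
Qed.

Lemma contract_der2 j u w : \sum_x \sum_y twoidx u x y * D j (twoidx w x y) =
  \sig_k \sig_l u k l * (D j (w k l) - act2 (G j) w k l).
Proof.
rewrite exchange_big /=; under eq_bigr do rewrite contract_der.
rewrite sum_sum3.
transitivity (\sig_p ((\sig_q u p q * (D j (w p q) - act1 (G j) (w p) q))
  - \sig_x G j p x * (\sig_q u p q * w x q))).
  apply: eq_sum3 => p; under eq_bigr do rewrite mulrBr.
  rewrite sumrB contract_der; congr (_ - _).
  transitivity (\sum_y \sig_x G j p x * (comb (u p) y * comb (w x) y)).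
    by apply: eq_bigr => y _; rewrite /act1 /sum3; ring.
  rewrite sum_sum3; apply: eq_sum3 => x.
  by rewrite -mulr_sumr contract1.
by rewrite /act1 /act2 /sum3; ring.
Qed.

Lemma tgradE x u : P x u = comb (fun i => D i u) x.
Proof. by apply: eq_sum3 => i; rewrite mulrC. Qed.

Lemma amb_last_frame x : amb_last P f x = comb (fun i => \sig_j \sig_k h i j k *
  (\sig_l \sig_m shape h l m * (D j (h k l m) - act3 (G j) h k l m))) x.
Proof.
pose u j k := comb (fun i => h i j k) x.
rewrite /amb_last exchange_big /=.
transitivity (\sum_b \sum_a comb (fun j => comb (u j) b) a *
  comb (fun j => \sum_c \sum_d twoidx (shape h) c d * D j (lift h b c d)) a).
  apply: eq_bigr => b _; apply: eq_bigr => a _; rewrite amb_sff_frame; congr (_ * _).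
    by rewrite /u /lift /twoidx /comb /sum3; ring.
  transitivity (\sum_c \sum_d \sig_j
      (twoidx (shape h) c d * D j (lift h b c d)) * E j 0 a).
    apply: eq_bigr => c _; apply: eq_bigr => d _.
    rewrite amb_shape_frame amb_sff_frame tgradE /comb -sum3Ml.
    by apply: eq_sum3 => j; rewrite mulrA.
  under eq_bigr do rewrite sum_sum3.
  rewrite sum_sum3; apply: eq_sum3 => j.
  by under eq_bigr do rewrite -mulr_suml; rewrite -mulr_suml.
under eq_bigr do rewrite contract1.
rewrite sum_sum3.
transitivity (\sig_j \sig_k u j k *
  (\sig_l \sig_m shape h l m * (D j (h k l m) - act3 (G j) h k l m))); last first.
  have Y_out (Y : 'I_3 -> 'I_3 -> A) : \sig_j \sig_k u j k * Y j k =
      comb (fun i => \sig_j \sig_k h i j k * Y j k) x.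
    by rewrite /u /comb /sum3; ring.
  exact: Y_out.
apply: eq_sum3 => j.
transitivity (\sum_c \sum_d \sum_b twoidx (shape h) c d *
   (comb (u j) b * D j (comb (fun k => twoidx (h k) c d) b))).
  under eq_bigr do rewrite mulr_sumr.
  rewrite exchange_big; apply: eq_bigr => c _.
  under eq_bigr do rewrite mulr_sumr.
  rewrite exchange_big; apply: eq_bigr => d _.
  by apply: eq_bigr => b _; rewrite mulrCA.
transitivity (\sum_c \sum_d \sig_k u j k * (twoidx (shape h) c d * D j (twoidx (h k) c d)
  - \sig_q G j k q * (twoidx (shape h) c d * twoidx (h q) c d))).
  apply: eq_bigr => c _; apply: eq_bigr => d _; rewrite -mulr_sumr contract_der.
  by rewrite /act1 /sum3; ring.
under eq_bigr do rewrite sum_sum3; rewrite sum_sum3; apply: eq_sum3 => k.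
under eq_bigr do rewrite -mulr_sumr; rewrite -mulr_sumr; congr (_ * _).
under eq_bigr do rewrite sumrB; rewrite sumrB contract_der2.
under [X in _ - X]eq_bigr do rewrite sum_sum3; rewrite sum_sum3.
transitivity ((\sig_l \sig_m shape h l m * (D j (h k l m) - act2 (G j) (h k) l m))
  - \sig_q G j k q * (\sig_l \sig_m shape h l m * h q l m)).
  congr (_ - _); apply: eq_sum3 => q; under eq_bigr do rewrite -mulr_sumr.
  by rewrite -mulr_sumr contract2.
by rewrite /act2 /act3; move: (shape h) => S'; rewrite /sum3; ring.
Qed.

(** The ambient expression differentiates h with the Levi-Civita connection, [cov7] with the
    connection with torsion. Their difference vanishes in this contraction, so the last summand of
    the field needs no choice of orientation. *)
Lemma act3_eps_vanish i : \sig_j \sig_k h i j k *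
  (\sig_l \sig_m shape h l m * act3 (eps3 A j) h k l m) = 0.
Proof.
have [u ->] := harmonic3_mk sff7_harmonic.
move: i; refine (ord3P _ _ _);
cbv beta iota zeta delta [sum3 mk3 cnt eps3 shape act3 nat_of_ord addn Nat.add];
ring.
Qed.

(** A totally skew torsion does not change the divergence of vector fields. *)
Lemma tconn7_trace (w : 'I_3 -> A) :
  \sig_j act1 (tconn G tau7 j) w j = \sig_j act1 (G j) w j.
Proof. by rewrite /act1 /tconn /sum3 /eps3 /=; ring. Qed.

Lemma amb_field_frame x :
  amb_field P f x = comb (fun i => 2 * simons_field D G h tau7 i) x.
Proof.
have s_der := der_str1 D_add D_mul h tau7 conn7_skew.
have q_der := der_str2 D_add D_mul h tau7 conn7_skew.
rewrite /amb_field amb_s_frame amb_q_frame !tgradE amb_last_frame.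
rewrite (_ : \sum_y _ = comb (fun i => \sig_j shape h i j * D j (str1 h)) x); last first.
  transitivity (\sum_y comb (fun j => comb (fun i => shape h i j) x) y *
    comb (fun j => D j (str1 h)) y).
    apply: eq_bigr => y _; rewrite amb_shape_frame tgradE; congr (_ * _).
    by rewrite /twoidx /comb /sum3; ring.
  by rewrite contract1 /comb /sum3; ring.
transitivity (comb (fun i => 7 * (str1 h * D i (str1 h)) + 18 * D i (str2 h)
  - 36 * (\sig_j shape h i j * D j (str1 h))
  + 72 * \sig_j \sig_k h i j k * (\sig_l \sig_m shape h l m *
     (D j (h k l m) - act3 (G j) h k l m))) x).
  have comb_lin c a1 a2 a3 a4 : 7 * (c * comb a1 x) + 18 * comb a2 x
      - 36 * comb a3 x + 72 * comb a4 x =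
      comb (fun i => 7 * (c * a1 i) + 18 * a2 i - 36 * a3 i + 72 * a4 i) x.
    by rewrite /comb /sum3; ring.
  exact: comb_lin.
apply: eq_sum3 => i; congr (_ * _).
have -> : \sig_j \sig_k h i j k * (\sig_l \sig_m shape h l m *
    (D j (h k l m) - act3 (G j) h k l m)) =
  \sig_a \sig_b h i a b * (\sig_c \sig_d shape h c d * cov7 a b c d).
  have [c12 c23 c34 _] := cov7_harmonic.
  have covE j k l m : cov7 j k l m =
      (D j (h k l m) - act3 (G j) h k l m) - tau7 * act3 (eps3 A j) h k l m.
    by rewrite c12 c23 c34 /cov7 /covh /act3 /tconn -/G -/h /sum3; ring.
  transitivity ((\sig_j \sig_k h i j k * (\sig_l \sig_m shape h l m *
    (D j (h k l m) - act3 (G j) h k l m))) - tau7 * (\sig_j \sig_k h i j k *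
    (\sig_l \sig_m shape h l m * act3 (eps3 A j) h k l m))).
    by rewrite act3_eps_vanish mulr0 subr0.
  apply/eqP; rewrite subr_eq -sum3Ml -sum3D; apply/eqP; apply: eq_sum3 => j.
  rewrite -sum3Ml -sum3D; apply: eq_sum3 => k; rewrite mulrCA -mulrDr; congr (_ * _).
  rewrite -sum3Ml -sum3D; apply: eq_sum3 => l.
  by rewrite -sum3Ml -sum3D; apply: eq_sum3 => m; rewrite covE; ring.
rewrite s_der q_der /simons_field -/cov7.
rewrite (_ : \sig_j shape h i j * D j (str1 h) =
  2 * (\sig_j shape h i j * hdt h cov7 j)); last first.
  by rewrite -sum3Ml; apply: eq_sum3 => j; rewrite s_der mulrCA.
rewrite -/cov7; ring.
Qed.

Lemma amb_div_frame : amb_div P f = 2 * div_form h cov7 cov27.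
Proof.
transitivity (\sig_b dot7 (E b) (der7 D b
   (\sig_i (2 * simons_field D G h tau7 i) *: E i))).
  rewrite /amb_div; under eq_bigr do rewrite amb_field_frame.
  rewrite sum_sum3; apply: eq_sum3 => b; apply: eq_bigr => x _.
  by rewrite mxE /comb /sum3 !mxE.
transitivity (\sig_j (D j (2 * simons_field D G h tau7 j)
   - act1 (G j) (fun i => 2 * simons_field D G h tau7 i) j)).
  by apply: (frame_divergence D_add D_mul (@dot7C A) (@dot7Dl A) (@dot7Zl A)
    D7D D7Z Ddt dtEE twelfthE).
rewrite -(divergence_simons_field D_add D_mul conn7_skew sff7_harmonic sff7_codazzi).
rewrite -sum3Ml.
set w := simons_field D G h tau7.
transitivity ((\sig_j 2 * D j (w j)) - 2 * (\sig_j act1 (G j) w j)).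
  have D2 l u : D l (2 * u) = 2 * D l u.
    by rewrite D_mul (der_natr D_add D_mul) mul0r add0r.
  by rewrite /act1 /sum3 !D2; ring.
by rewrite -tconn7_trace /sum3; ring.
Qed.

End FrameInSphere.

(** * Coordinate frames and the tensors of the statement in frame components *)

Section CoordinateFrame.
Variables (A : comNzRingType) (p : 'I_3 -> A -> A).
Variables (ec : 'I_3 -> 'I_3 -> A) (F : 'rV[A]_7).
Let D := fder p ec.
Let E l := der7 D l F.
Hypothesis EE : forall i j, dot7 (E i) (E j) = kron A i j.

Lemma dot7_suml (u : 'I_3 -> 'rV[A]_7) x : dot7 (sum3 u) x = \sig_i dot7 (u i) x.
Proof. by rewrite /sum3 !dot7Dl. Qed.

Lemma der7_fder l w : der7 D l w = \sig_i ec l i *: der7 p i w.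
Proof. by apply/rowP => j; rewrite !mxE. Qed.

Definition coframe (i a : 'I_3) : A := dot7 (der7 p i F) (E a).
Let g := coframe.

Lemma coframe_coef a b : \sig_j ec a j * g j b = kron A a b.
Proof.
rewrite -EE {1}/E der7_fder dot7_suml.
by apply: eq_sum3 => i; rewrite dot7Zl.
Qed.

(** Orthonormality gives the product of the two matrices in the other order; a one-sided inverse of
    a square matrix over a commutative ring is two-sided. *)
Lemma coef_coframe i j : \sig_a g i a * ec a j = kron A i j.
Proof.
pose M : 'M[A]_3 := \matrix_(a, b) ec a b.
pose M' : 'M[A]_3 := \matrix_(a, b) g a b.
have kE a b : kron A a b = (a == b)%:R by move: a b; do 2 (refine (ord3P _ _ _)).
have MM : M *m M' = 1%:M.
  apply/matrixP => a b; rewrite !mxE -kE -coframe_coef sum3E.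
  by apply: eq_sum3 => k; rewrite !mxE.
have /matrixP/(_ i j) := mulmx1C MM; rewrite !mxE kE => <-; rewrite sum3E.
by apply: eq_sum3 => k; rewrite !mxE.
Qed.

Lemma sum3_kronl (v : 'I_3 -> A) l : \sig_i kron A l i * v i = v l.
Proof. exact: (sum3_kronZ (V := A^o)). Qed.

Lemma coord_der y i : p i y = \sig_a g i a * D a y.
Proof.
transitivity (\sig_j (\sig_a g i a * ec a j) * p j y).
  rewrite -[LHS](sum3_kronl (p^~ y)).
  by apply: eq_sum3 => j; rewrite coef_coframe.
by rewrite /D /fder /sum3; ring.
Qed.

End CoordinateFrame.

Section FrameTensors.
Variables (A : comNzRingType) (D : 'I_3 -> A -> A).
Hypothesis D_add : forall l x y, D l (x + y) = D l x + D l y.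
Hypothesis D_mul : forall l x y, D l (x * y) = D l x * y + x * D l y.
Variable beta : 'I_3 -> 'I_3 -> 'I_3 -> A.
Hypothesis D_beta : forall m l x,
  D m (D l x) - D l (D m x) = \sig_a beta m l a * D a x.
Variables (F : 'rV[A]_7) (E : 'I_3 -> 'rV[A]_7).
Let N i := cross7 F (E i).
Hypothesis dtFF : dot7 F F = 1.
Hypothesis DF : forall l, der7 D l F = E l.
Hypothesis dtEE : forall i j, dot7 (E i) (E j) = kron A i j.
Hypothesis dtEN : forall i j, dot7 (E i) (N j) = 0.
Variable twelfth : A.
Hypothesis twelfthE : 12 * twelfth = 1.

Let G := conn7 D E.
Let h := sff7 D F E.
Let c := sign7 F E.
Let tau := tau7 F E twelfth.
Let t := cov7 D F E twelfth.

Let D7D := der7D D_add.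
Let D7Z := der7Z D_mul.

Definition lin7 (x : 'I_3 -> A) (v : 'I_3 -> 'rV[A]_7) : 'rV[A]_7 :=
  \sig_i x i *: v i.
Definition dir7 (x : 'I_3 -> A) (w : 'rV[A]_7) : 'rV[A]_7 := lin7 x (fun i => der7 D i w).
Definition frame_nabla (x y : 'I_3 -> A) (k : 'I_3) : A :=
  \sig_i x i * (D i (y k) + \sig_j y j * G i j k).
Definition bil3 (b : 'I_3 -> 'I_3 -> 'I_3 -> A) (x y : 'I_3 -> A) (k : 'I_3) : A :=
  \sig_i \sig_j x i * y j * b i j k.

Lemma dot7_lin x v w : dot7 (lin7 x v) w = \sig_i x i * dot7 (v i) w.
Proof. by rewrite dot7_suml; apply: eq_sum3 => i; rewrite dot7Zl. Qed.

Lemma der7_lin l x v : der7 D l (lin7 x v) =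
  lin7 (fun i => D l (x i)) v + lin7 x (fun i => der7 D l (v i)).
Proof. by rewrite -sum3D /lin7 [in LHS]/sum3 !D7D !D7Z. Qed.

Let EF := frame7_EF D_add D_mul dtFF DF twelfthE.
Let NF := frame7_NF F E.
Let NN := frame7_NN D_add D_mul dtFF DF dtEE twelfthE.

Let EE_lin x k : dot7 (lin7 x E) (E k) = x k.
Proof.
rewrite dot7_lin -[RHS](sum3_kronl x); apply: eq_sum3 => i.
by rewrite dtEE mulrC; congr (_ * _); move: i k; do 2 (refine (ord3P _ _ _)).
Qed.

Lemma frame_NN_lin x k : dot7 (lin7 x N) (N k) = x k.
Proof.
rewrite dot7_lin -[RHS](sum3_kronl x); apply: eq_sum3 => i.
by rewrite NN mulrC; congr (_ * _); move: i k; do 2 (refine (ord3P _ _ _)).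
Qed.

Let lin0 x v w : (forall i, dot7 (v i) w = 0) -> dot7 (lin7 x v) w = 0.
Proof. by move=> vw; rewrite dot7_lin /sum3 !vw !mulr0 !addr0. Qed.

Lemma dir_tangent x y k : dot7 (dir7 x (lin7 y E)) (E k) = frame_nabla x y k.
Proof.
by rewrite dot7_lin; apply: eq_sum3 => i; rewrite der7_lin dot7Dl EE_lin dot7_lin.
Qed.

Lemma dir_normal x y k : dot7 (dir7 x (lin7 y E)) (N k) = bil3 h x y k.
Proof.
rewrite dot7_lin; apply: eq_sum3 => i; rewrite der7_lin dot7Dl lin0 //.
by rewrite add0r dot7_lin -sum3Ml; apply: eq_sum3 => j; rewrite mulrA.
Qed.

Let aux (V : zmodType) (a b d : V) : a + (b + d) - a - b = d.
Proof. by rewrite [a + _]addrC addrK addrC addKr. Qed.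

Let dot_EF w k : dot7 (w - dot7 w F *: F) (E k) = dot7 w (E k).
Proof. by rewrite -scaleNr dot7Dl dot7Zl (dot7C F) EF mulr0 addr0. Qed.

Lemma normal_part w :
  w - dot7 w F *: F - lin7 (fun k => dot7 (w - dot7 w F *: F) (E k)) E =
  lin7 (fun k => dot7 w (N k)) N.
Proof.
rewrite [lin7 _ E](eq_sum3 (G := fun k => dot7 w (E k) *: E k)).
  rewrite {1}[w](frame7_complete D_add D_mul dtFF DF dtEE dtEN twelfthE).
  exact: aux.
by move=> k; rewrite dot_EF.
Qed.

Lemma sff_part x y (w := dir7 x (lin7 y E)) :
  w - dot7 w F *: F - lin7 (frame_nabla x y) E = lin7 (bil3 h x y) N.
Proof.
transitivity (lin7 (fun k => dot7 w (N k)) N).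
  rewrite -normal_part; congr (_ - _); apply: eq_sum3 => k.
  by rewrite dot_EF dir_tangent.
by apply: eq_sum3 => k; rewrite dir_normal.
Qed.

Lemma dir_normal_frame x s k : dot7 (dir7 x (lin7 s N)) (N k) =
  \sig_i x i * (D i (s k) + \sig_a s a * (G i a k + c * eps3 A i a k)).
Proof.
rewrite dot7_lin; apply: eq_sum3 => i; rewrite der7_lin dot7Dl frame_NN_lin dot7_lin.
congr (_ * (_ + _)); apply: eq_sum3 => a; congr (_ * _).
rewrite (der_normal7 D_add D_mul D_beta dtFF DF dtEE dtEN twelfthE) dot7Dl.
rewrite [X in X + _](frame_NN_lin (fun k => G i a k + c * eps3 A i a k)).
rewrite -scaleN1r dot7Zl -/(lin7 (fun k => sff7 D F E i a k) E).
by rewrite lin0 ?mulr0 ?addr0.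
Qed.

Lemma cross7Dr (x y z : 'rV[A]_7) : cross7 x (y + z) = cross7 x y + cross7 x z.
Proof. by rewrite !(cross7C x) cross7Dl opprD. Qed.

Lemma cross7Zr a (x y : 'rV[A]_7) : cross7 x (a *: y) = a *: cross7 x y.
Proof. by rewrite !(cross7C x) cross7Zl scalerN. Qed.

Lemma cross7_linr w x v : cross7 w (lin7 x v) = lin7 x (fun i => cross7 w (v i)).
Proof. by rewrite /lin7 /sum3 !cross7Dr !cross7Zr. Qed.

Lemma cross7_linl w x v : cross7 (lin7 x v) w = lin7 x (fun i => cross7 (v i) w).
Proof. by rewrite /lin7 /sum3 !cross7Dl !cross7Zl. Qed.

Lemma dir7_pos x : dir7 x F = lin7 x E.
Proof. by apply: eq_sum3 => i; rewrite DF. Qed.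

Lemma dir7_cross x v w : dir7 x (cross7 v w) = cross7 (dir7 x v) w + cross7 v (dir7 x w).
Proof.
rewrite /dir7 cross7_linl cross7_linr -sum3D; apply: eq_sum3 => i.
by rewrite (der7_cross D_add D_mul) scalerDr.
Qed.

(** This is G(X, Y) = X x Y: differentiating F x Y leaves X x Y beside J of the derivative of Y, the
    projections along F drop out, and X x Y is already normal. *)
Lemma torsion_part x y (w := cross7 F (lin7 y E)) (v := dir7 x (lin7 y E)) :
  dir7 x w - dot7 (dir7 x w) F *: F - cross7 F (v - dot7 v F *: F) =
  lin7 (bil3 (fun i j k => c * eps3 A i j k) x y) N.
Proof.
rewrite -!scaleNr cross7Dr cross7Zr cross7xx scaler0 addr0 dir7_cross -/v dot7Dl.
rewrite [dot7 (cross7 F v) F]dot7C -dot7_cross cross7xx.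
rewrite (_ : dot7 0 v = 0) ?addr0; last first.
  by rewrite -[0 in LHS](scale0r (0 : 'rV[A]_7)) dot7Zl mul0r.
rewrite dir7_pos.
have -> : cross7 (lin7 x E) (lin7 y E) = lin7 (bil3 (fun i j k => c * eps3 A i j k) x y) N.
  rewrite cross7_linl; transitivity (\sig_i x i *: \sig_j y j *:
      \sig_k (c * eps3 A i j k) *: N k).
    apply: eq_sum3 => i; rewrite cross7_linr; congr (_ *: _).
    apply: eq_sum3 => j; congr (_ *: _).
    exact: (sign_frame7 D_add D_mul D_beta dtFF DF dtEE dtEN twelfthE).
  apply/rowP => p; rewrite /lin7 /bil3 /sum3 !mxE.
  by ring.
rewrite lin0 ?scale0r; last by move=> i; exact: NF.
by rewrite oppr0 scale0r addr0 addrK.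
Qed.

Definition tri3 (b : 'I_3 -> 'I_3 -> 'I_3 -> 'I_3 -> A) (x y z : 'I_3 -> A) (k : 'I_3) : A :=
  \sig_l \sig_i \sig_j x l * (y i * (z j * b l i j k)).

(* The coefficient of JE_k in T(x, y, z) *)
Lemma cov7_torsion x y z k (a := fun x y j => \sig_i \sig_m y i * x m * h i j m)
    (e := bil3 (fun i j k => c * eps3 A i j k)) :
  (\sig_i x i * (D i (bil3 h y z k) +
      \sig_b bil3 h y z b * (G i b k + c * eps3 A i b k)))
  - bil3 h (frame_nabla x y) z k - bil3 h y (frame_nabla x z) k
  - 3 * twelfth * (e x (a z y) k + e y (a x z) k + e z (a y x) k) =
  tri3 (fun l i j k => t i j k l) x y z k.
Proof.
(* Tensoriality: all derivatives of x, y and z cancel here, and what remains is an identity in the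
   components of h for each triple of frame vectors. *)
transitivity (tri3 (fun l i j k => D l (h i j k)
   + \sig_b h i j b * (G l b k + c * eps3 A l b k)
   - (\sig_b (G l i b * h b j k + G l j b * h i b k))
   - 3 * twelfth * c * (\sig_b (h i b j * eps3 A l b k + h j b l * eps3 A i b k
      + h l b i * eps3 A j b k))) x y z k).
  rewrite /tri3 /e /a /bil3 /frame_nabla /sum3 !D_add !D_mul.
  ring.
apply: eq_sum3 => l; apply: eq_sum3 => i; apply: eq_sum3 => j.
do 3 congr (_ * _).
have [p [q [r gE]]] := skew3E (conn7_skew D_add D_mul dtEE twelfthE l).
have [a' hE] := harmonic3_mk (sff7_harmonic D_add D_mul D_beta dtFF DF dtEE dtEN twelfthE).
have cE : c = 4 * tau by rewrite tau7_4.
rewrite -[3 * twelfth * c]/tau cE /t /cov7 /covh -/h -/tau /tconn /act3 -/G.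
move: (D l (h i j k)) => d; rewrite /G gE /h hE.
move: (tau) => ta; move: l i j k {gE}; do 4 (refine (ord3P _ _ _));
rewrite /sum3 /mk3 /cnt /eps3 /=; ring.
Qed.

End FrameTensors.

Section Combinations.
Variable A : comNzRingType.
Implicit Types (x y : 'I_3 -> A) (v : 'I_3 -> 'rV[A]_7).

Lemma lin7D x y v : lin7 x v + lin7 y v = lin7 (fun i => x i + y i) v.
Proof. by rewrite /lin7 -sum3D; apply: eq_sum3 => i; rewrite scalerDl. Qed.

Lemma lin7Z a x v : a *: lin7 x v = lin7 (fun i => a * x i) v.
Proof. by rewrite /lin7 /sum3 !scalerDr !scalerA. Qed.

Lemma lin7B x y v : lin7 x v - lin7 y v = lin7 (fun i => x i - y i) v.
Proof. by rewrite -scaleN1r lin7Z lin7D; apply: eq_sum3 => i; rewrite mulN1r. Qed.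

Lemma bil3_kron (b : 'I_3 -> 'I_3 -> 'I_3 -> A) i j k : bil3 b (kron A i) (kron A j) k = b i j k.
Proof.
by move: i j; do 2 (refine (ord3P _ _ _)); rewrite /bil3 /sum3 /kron /=; ring.
Qed.

Lemma tri3_kron (b : 'I_3 -> 'I_3 -> 'I_3 -> 'I_3 -> A) l i j k :
  tri3 b (kron A l) (kron A i) (kron A j) k = b l i j k.
Proof.
by move: l i j; do 3 (refine (ord3P _ _ _)); rewrite /tri3 /sum3 /kron /=; ring.
Qed.

Lemma dot7_orthonormal x y v : (forall i j, dot7 (v i) (v j) = kron A i j) ->
  dot7 (lin7 x v) (lin7 y v) = \sig_i x i * y i.
Proof.
move=> vv; rewrite /lin7 /sum3 !dot7Dl !dot7Zl !(dot7C (v _)) !dot7Dl !dot7Zl !vv.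
by rewrite /kron /=; ring.
Qed.

End Combinations.

Section CoordinateConnection.
Variables (A : comNzRingType) (p : 'I_3 -> A -> A).
Hypothesis p_add : forall i x y, p i (x + y) = p i x + p i y.
Hypothesis p_mul : forall i x y, p i (x * y) = p i x * y + x * p i y.
Hypothesis p_comm : forall i j x, p i (p j x) = p j (p i x).
Variables (ec : 'I_3 -> 'I_3 -> A) (F : 'rV[A]_7).
Let D := fder p ec.
Let E l := der7 D l F.
Let P := der7 p.
Hypothesis EE : forall i j, dot7 (E i) (E j) = kron A i j.

Lemma koszul i j l : p i (dot7 (P j F) (P l F)) + p j (dot7 (P i F) (P l F))
    - p l (dot7 (P i F) (P j F)) = 2 * dot7 (P i (P j F)) (P l F).
Proof.
have PC a b : P a (P b F) = P b (P a F) by apply/rowP => y; rewrite !mxE.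
rewrite !(der_dot7 p_add p_mul) -/P (PC l i) (PC l j) (PC j i) [dot7 (P j F) _]dot7C.
ring.
Qed.

Definition frame_coords (x : 'I_3 -> A) l := \sig_a x a * ec a l.
(** Christoffel symbols as tangential parts of the second derivatives of the immersion, in frame
    components; by [koszul] they agree with the formula through derivatives of the metric. *)
Definition coord_conn i j k := dot7 (P i (P j F)) (E k).

Lemma coord_connE i j k :
  coord_conn i j k = \sig_l dot7 (P i (P j F)) (P l F) * ec k l.
Proof.
rewrite /coord_conn dot7C {1}/E der7_fder dot7_suml; apply: eq_sum3 => l.
by rewrite dot7Zl mulrC dot7C.
Qed.

Lemma dir7_coframe l w : dir7 D (coframe p ec F l) w = P l w.
Proof.
apply/rowP => j; rewrite /dir7 /lin7 /sum3 !mxE.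
by rewrite (coord_der EE).
Qed.

Lemma frame_coords_coframe l j : frame_coords (coframe p ec F l) j = kron A l j.
Proof. exact: (coef_coframe EE). Qed.

Lemma coframe_contract b x w k :
  \sig_l (\sig_m bil3 b x (coframe p ec F l) m * w m) * ec k l =
  \sig_i \sig_m x i * w m * b i k m.
Proof.
transitivity (\sig_j (\sig_l ec k l * coframe p ec F l j) *
    (\sig_i \sig_m x i * w m * b i j m)).
  by move: (coframe p ec F) => g; rewrite /bil3 /sum3; ring.
rewrite -[RHS](sum3_kronl (fun j => \sig_i \sig_m x i * w m * b i j m)).
by apply: eq_sum3 => j; rewrite (coframe_coef EE).
Qed.

Lemma conn_coord i j l : frame_coords (conn7 D E i j) l =
  D i (ec j l) + \sig_q \sig_m ec i q * ec j m * frame_coords (coord_conn q m) l.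
Proof.
have EEc m : E m = lin7 (ec m) (P^~ F) by exact: der7_fder.
have D_add : forall l x y, D l (x + y) = D l x + D l y := fder_add p_add ec.
have D_mul : forall l x y, D l (x * y) = D l x * y + x * D l y := fder_mul p_mul ec.
have GE k : conn7 D E i j k = (\sig_m D i (ec j m) * coframe p ec F m k)
    + \sig_q \sig_m ec i q * ec j m * coord_conn q m k.
  rewrite /conn7 /frame_conn {1}EEc (der7_lin D_add D_mul) dot7Dl !dot7_lin.
  congr (_ + _).
  transitivity (\sig_m ec j m * (\sig_q ec i q * coord_conn q m k)).
    apply: eq_sum3 => m; congr (_ * _); rewrite der7_fder dot7_suml.
    by apply: eq_sum3 => q; rewrite dot7Zl.
  by rewrite /sum3; ring.
transitivity ((\sig_m D i (ec j m) * frame_coords (coframe p ec F m) l)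
  + \sig_q \sig_m ec i q * ec j m * frame_coords (coord_conn q m) l).
  rewrite /frame_coords; move: GE; move: (conn7 D E) (coframe p ec F) coord_conn.
  by move=> c g ga GE; rewrite /sum3 !GE /sum3; ring.
congr (_ + _); rewrite -[RHS](sum3_kronl (fun m => D i (ec j m))).
apply: eq_sum3 => m; rewrite frame_coords_coframe.
by rewrite mulrC; congr (_ * _); move: m l; do 2 (refine (ord3P _ _ _)).
Qed.

(** Identifies the connection of the moving frame with the one defined by Christoffel symbols. *)
Lemma nabla_coords x y l : frame_coords (frame_nabla D E x y) l =
  (\sig_i x i * D i (frame_coords y l)) + \sig_q \sig_m
    frame_coords x q * frame_coords y m * frame_coords (coord_conn q m) l.
Proof.
have D_add : forall l x y, D l (x + y) = D l x + D l y := fder_add p_add ec.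
have D_mul : forall l x y, D l (x * y) = D l x * y + x * D l y := fder_mul p_mul ec.
transitivity (\sig_i x i * ((\sig_k D i (y k) * ec k l)
   + \sig_j y j * frame_coords (conn7 D E i j) l)).
  by rewrite /frame_coords /frame_nabla /sum3; ring.
transitivity (\sig_i x i * ((\sig_k D i (y k) * ec k l) + \sig_j y j * (D i (ec j l)
   + \sig_q \sig_m ec i q * ec j m * frame_coords (coord_conn q m) l))).
  apply: eq_sum3 => i; congr (_ * (_ + _)); apply: eq_sum3 => j; congr (_ * _).
  exact: conn_coord.
move: (fun q m => frame_coords (coord_conn q m) l) => ga.
have De i : D i (frame_coords y l) = \sig_k (D i (y k) * ec k l + y k * D i (ec k l)).
  by rewrite /frame_coords /sum3 !D_add !D_mul.
rewrite /sum3 !De /frame_coords /sum3; ring.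
Qed.

End CoordinateConnection.

(** * Determinant of the coframe and the divergence in coordinates *)

Definition det3 (A : comNzRingType) (m : 'I_3 -> 'I_3 -> A) : A :=
  m i0 i0 * (m i1 i1 * m i2 i2 - m i1 i2 * m i2 i1)
  - m i0 i1 * (m i1 i0 * m i2 i2 - m i1 i2 * m i2 i0)
  + m i0 i2 * (m i1 i0 * m i2 i1 - m i1 i1 * m i2 i0).

Definition cof3 (A : comNzRingType) (m : 'I_3 -> 'I_3 -> A) (i j : 'I_3) : A :=
  let s (i : 'I_3) : 'I_3 := match i : nat with 0%N => i1 | 1%N => i2 | _ => i0 end in
  m (s i) (s j) * m (s (s i)) (s (s j)) - m (s i) (s (s j)) * m (s (s i)) (s j).

Lemma det3_matrix (A : comNzRingType) (M : 'M[A]_3) : \det M = det3 (fun i j => M i j).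
Proof.
rewrite (expand_det_row _ i0) sum3E /sum3 /cofactor.
rewrite !(expand_det_row _ ord0) !big_ord_recl !big_ord0 /cofactor !det_mx11 !mxE.
pose n a b := M (inord a) (inord b).
have ME i j : M i j = n (nat_of_ord i) (nat_of_ord j) by rewrite /n !inord_val.
rewrite /det3 !ME /= /bump /= !addr0 ?expr0 ?expr1 ?exprS ?expr0 /=; ring.
Qed.

Lemma cof3P (A : comNzRingType) (m : 'I_3 -> 'I_3 -> A) k k' :
  \sig_b m k b * cof3 m k' b = det3 m * kron A k k'.
Proof.
by move: k k'; do 2 (refine (ord3P _ _ _)); rewrite /cof3 /det3 /sum3 /kron /=; ring.
Qed.

Lemma rmorph_det3 (A B : comNzRingType) (phi : {rmorphism A -> B}) m :
  phi (det3 m) = det3 (fun i j => phi (m i j)).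
Proof. by rewrite /det3 !(rmorphD, rmorphN, rmorphM). Qed.

Section CoordinateDivergence.
Variables (A : comNzRingType) (p : 'I_3 -> A -> A).
Hypothesis p_add : forall i x y, p i (x + y) = p i x + p i y.
Hypothesis p_mul : forall i x y, p i (x * y) = p i x * y + x * p i y.
Hypothesis p_comm : forall i j x, p i (p j x) = p j (p i x).
Variables (ec : 'I_3 -> 'I_3 -> A) (F : 'rV[A]_7).
Let D := fder p ec.
Let E l := der7 D l F.
Let P := der7 p.
Hypothesis EE : forall i j, dot7 (E i) (E j) = kron A i j.
Let g := coframe p ec F.
Variable twelfth : A.
Hypothesis twelfthE : 12 * twelfth = 1.

Lemma der7_coframe k : P k F = lin7 (g k) E.
Proof. exact: esym (dir7_coframe EE k F). Qed.

Lemma metric_coframe i j : dot7 (P i F) (P j F) = \sig_a g i a * g j a.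
Proof. by rewrite !der7_coframe dot7_orthonormal. Qed.

Lemma det3_coframe : det3 ec * det3 g = 1.
Proof.
pose M1 : 'M[A]_3 := \matrix_(a, b) ec a b; pose M2 : 'M[A]_3 := \matrix_(a, b) g a b.
have d1 : \det M1 = det3 ec by rewrite det3_matrix /det3 !mxE.
have d2 : \det M2 = det3 g by rewrite det3_matrix /det3 !mxE.
rewrite -d1 -d2 -det_mulmx (_ : M1 *m M2 = 1%:M) ?det1 //.
apply/matrixP => a b; rewrite !mxE sum3E; transitivity (kron A a b).
  by rewrite -(coframe_coef EE); apply: eq_sum3 => j; rewrite !mxE.
by move: a b; do 2 (refine (ord3P _ _ _)).
Qed.

Lemma cof3_coframe k b : det3 g * ec b k = cof3 g k b.
Proof.
transitivity (\sig_l ec b l * (\sig_c g l c * cof3 g k c)).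
  transitivity (\sig_l ec b l * (det3 g * kron A l k)); last first.
    by apply: eq_sum3 => l; rewrite cof3P.
  move: (det3 g) => d.
  by move: k; refine (ord3P _ _ _); rewrite /sum3 /kron /=; ring.
transitivity (\sig_c (\sig_l ec b l * g l c) * cof3 g k c).
  by move: (cof3 g) (g) => C' g'; rewrite /sum3; ring.
rewrite -[RHS](sum3_kronl (cof3 g k)); apply: eq_sum3 => c.
by rewrite (coframe_coef EE).
Qed.

Lemma jacobi j : p j (det3 g) = det3 g * (\sig_b \sig_k ec b k * p j (g k b)).
Proof.
transitivity (\sig_b \sig_k cof3 g k b * p j (g k b)); last first.
  rewrite -sum3Ml; apply: eq_sum3 => b; rewrite -sum3Ml; apply: eq_sum3 => k.
  by rewrite -cof3_coframe mulrA.
rewrite /det3 /cof3 /=; move: (g) => g'.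
have pN x : p j (- x) = - p j x by apply: (derN p_add).
rewrite !(p_add, p_mul, pN) /sum3 /=; ring.
Qed.

Definition coord_vector (w : 'I_3 -> A) j := \sig_i w i * ec i j.

(** The classical formula for the divergence with [det3 g] as density. Its derivative is given by
    [jacobi], and the rotation [c] of the frame enters only through the entries [c j b b], which
    vanish. *)
Lemma divergence_coord w :
  \sig_j p j (det3 g * coord_vector w j) =
  det3 g * \sum_x tgrad D E x (comb E w x).
Proof.
have D_add : forall l x y, D l (x + y) = D l x + D l y := fder_add p_add ec.
have D_mul : forall l x y, D l (x * y) = D l x * y + x * D l y := fder_mul p_mul ec.
have Plin j x v : P j (lin7 x v) = lin7 (fun i => p j (x i)) v + lin7 x (fun i => P j (v i)).
  exact: der7_lin.
pose om := coord_vector w.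
have wE : lin7 w E = lin7 om (P^~ F).
  rewrite (_ : lin7 w E = \sig_i w i *: lin7 (ec i) (P^~ F)); last first.
    by apply: eq_sum3 => i; congr (_ *: _); exact: der7_fder.
  apply/rowP => x; rewrite /om /coord_vector /lin7 /sum3 !mxE.
  by move: (P i0 F 0 x) (P i1 F 0 x) (P i2 F 0 x) => ? ? ?; ring.
have divE : \sum_x tgrad D E x (comb E w x) = \sig_b dot7 (der7 D b (lin7 w E)) (E b).
  rewrite /tgrad sum_sum3; apply: eq_sum3 => b; apply: eq_bigr => x _.
  by rewrite mulrC /lin7 /comb /sum3 !mxE.
pose c j a b := dot7 (P j (E a)) (E b).
have gE k b : dot7 (P k F) (E b) = g k b by [].
(* Second derivatives of F commute, so the derivative of [P j F] in direction k is expressed by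
   derivatives of [g k] in direction j, as they occur in [jacobi]. *)
have PPE j k b : dot7 (P k (P j F)) (E b) = p j (g k b) + \sig_a g k a * c j a b.
  have -> : P k (P j F) = P j (P k F) by apply/rowP => x; rewrite !mxE.
  rewrite der7_coframe Plin dot7Dl !dot7_lin; congr (_ + _).
  rewrite -[RHS](sum3_kronl (fun a => p j (g k a))); apply: eq_sum3 => a.
  by rewrite EE mulrC; congr (_ * _); move: a b; do 2 (refine (ord3P _ _ _)).
have bE b : dot7 (der7 D b (lin7 w E)) (E b) = \sig_k ec b k *
   (\sig_j (p k (om j) * g j b + om j * (p j (g k b) + \sig_a g k a * c j a b))).
  rewrite der7_fder dot7_suml; apply: eq_sum3 => k; rewrite dot7Zl; congr (_ * _).
  rewrite wE -/P Plin dot7Dl !dot7_lin -sum3D; apply: eq_sum3 => j.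
  by rewrite gE PPE.
have c0 j b : c j b b = 0.
  have := der_dot7 p_add p_mul j (E b) (E b); rewrite EE.
  have -> : p j (kron A b b) = 0.
    by move: b; refine (ord3P _ _ _); rewrite /kron /= (der1 p_mul).
  rewrite [X in _ + X]dot7C -/(c j b b) -mulr2n -mulr_natl => /esym c2.
  rewrite -[LHS]mul1r -twelfthE; transitivity (6 * twelfth * (2 * c j b b)).
    by move: (c j b b) => y; ring.
  by rewrite c2 mulr0.
have -> : \sum_x tgrad D E x (comb E w x) = (\sig_j p j (om j))
    + \sig_j om j * (\sig_b \sig_k ec b k * p j (g k b)).
  rewrite divE (eq_sum3 bE).
  transitivity ((\sig_k \sig_j p k (om j) * (\sig_b g j b * ec b k))
    + (\sig_j om j * (\sig_b \sig_k ec b k * p j (g k b)))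
    + \sig_j om j * (\sig_b \sig_a (\sig_k ec b k * g k a) * c j a b)).
    move: (c) (om) (g) => c' om' g'; rewrite /sum3; ring.
  have z j : \sig_b \sig_a (\sig_k ec b k * g k a) * c j a b = 0.
    transitivity (\sig_b c j b b); last by rewrite /sum3 !c0 !addr0.
    apply: eq_sum3 => b; rewrite -[RHS](sum3_kronl (fun a => c j a b)).
    by apply: eq_sum3 => a; rewrite (coframe_coef EE).
  rewrite [X in _ + _ + X](eq_sum3 (G := fun=> 0)); last by move=> j; rewrite z mulr0.
  rewrite [X in _ + _ + X]/sum3 !addr0.
  congr (_ + _); apply: eq_sum3 => k.
  rewrite -[RHS](sum3_kronl (fun j => p k (om j))); apply: eq_sum3 => j.
  rewrite (coef_coframe EE) mulrC; congr (_ * _).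
  by move: j k; do 2 (refine (ord3P _ _ _)).
rewrite mulrDr -!sum3Ml -sum3D; apply: eq_sum3 => j.
by rewrite p_mul jacobi -/om; move: (sum3 _) => X; ring.
Qed.

End CoordinateDivergence.

(** * The cubic trace r in ambient coordinates *)

Section AmbientCube.
Variables (A : comNzRingType) (E : 'I_3 -> 'rV[A]_7).
Hypothesis dtEE : forall i j, dot7 (E i) (E j) = kron A i j.

Lemma contract_twoidx (u w : 'I_3 -> 'I_3 -> A) x z :
  \sum_y comb E (fun p => comb E (u p) y) x * comb E (fun p => comb E (w p) z) y =
  comb E (fun p => comb E (fun r => \sig_q u p q * w q r) z) x.
Proof.
transitivity (\sum_y comb E (fun q => comb E (u ^~ q) x) y *
    comb E (fun q => comb E (w q) z) y).
  by apply: eq_bigr => y _; congr (_ * _); rewrite /comb /sum3; ring.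
rewrite (contract1 dtEE); rewrite /comb /sum3; ring.
Qed.

Lemma trace_twoidx (u : 'I_3 -> 'I_3 -> A) :
  \sum_y comb E (fun p => comb E (u p) y) y = \sig_p u p p.
Proof.
transitivity (\sum_y \sig_p (comb E (u p) y * comb E (fun i => kron A i p) y)).
  apply: eq_bigr => y _; rewrite {1}/comb; apply: eq_sum3 => p; congr (_ * _).
  by move: p; refine (ord3P _ _ _); rewrite /comb /sum3 /kron /=; ring.
rewrite sum_sum3; apply: eq_sum3 => p; rewrite (contract1 dtEE).
by move: p; refine (ord3P _ _ _); rewrite /sum3 /kron /=; ring.
Qed.

Definition amb_r (B : comNzRingType) (P : 'I_7 -> B -> B) (f : 'I_7 -> B) : B :=
  \sum_x \sum_y \sum_z amb_shape P f x y * amb_shape P f y z * amb_shape P f z x.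

Lemma amb_r_frame (P : 'I_7 -> A -> A) f h :
  (forall y z, amb_shape P f y z = comb E (fun p => comb E (shape h p) z) y) ->
  amb_r P f = str3 h.
Proof.
move=> sE; rewrite /amb_r.
transitivity (\sum_x comb E (fun p => comb E (fun r =>
   \sig_q shape h p q * (\sig_s shape h q s * shape h s r)) x) x).
  apply: eq_bigr => x _; rewrite -contract_twoidx; apply: eq_bigr => y _.
  rewrite -contract_twoidx -sE mulr_sumr; apply: eq_bigr => z _.
  by rewrite !sE mulrA.
rewrite trace_twoidx /str3; move: (shape h) => S'.
by apply: eq_sum3 => a; rewrite /sum3; ring.
Qed.

End AmbientCube.

(** * C^k maps and the symmetry of second derivatives *)

Lemma near_eq_differentiable (R : numFieldType) (V W : normedModType R)
    (f g : V -> W) (x : V) :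
  (\near x, f x = g x) -> differentiable f x -> differentiable g x.
Proof.
move=> fg df.
have H : g \o shift x = cst (g x) + 'd f x +o_ 0 id.
  apply/eqaddoP => e e0.
  have /eqaddoP/(_ _ e0) fe := diff_locally df.
  have fgx : \forall h \near (0 : V), f (h + x) = g (h + x).
    by have := fg; rewrite (near_shift 0) subr0.
  near=> h; have -> : ((g \o shift x) - (cst (g x) + 'd f x)) h =
      ((f \o shift x) - (cst (f x) + 'd f x)) h.
    rewrite /= !fctE /= -(near fgx h) //; congr (_ - (_ + _)).
    by rewrite (nbhs_singleton fg).
  by near: h.
apply/diff_locallyP; rewrite (diff_unique _ H); first by split => //; exact: diff_continuous.
exact: diff_continuous.
Unshelve. all: by end_near. Qed.

Section Ck.
Variables (R : realType) (V : normedModType R).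
Implicit Types (U : set V) (W : normedModType R).

Lemma open_near_eq W U (f g : V -> W) x : open U -> U x ->
  (forall y, U y -> f y = g y) -> \near x, f x = g x.
Proof.
by move=> Uo Ux fg; have := open_nbhs_nbhs (conj Uo Ux); apply: filterS.
Qed.

Lemma Ck_on_eq W k U (f g : V -> W) : open U ->
  (forall x, U x -> f x = g x) -> Ck_on k U f -> Ck_on k U g.
Proof.
move=> Uo; elim: k f g => [|k IH] f g fg /=.
  move=> fc x Ux; have fgx := open_near_eq Uo Ux fg.
  rewrite /prop_for /continuous_at -(fg x Ux).
  apply: cvg_trans (fc x Ux); apply: near_eq_cvg.
  by apply: filterS fgx => y ->.
move=> [df Df]; split => [x Ux|v].
  by apply: near_eq_differentiable (df x Ux); exact: open_near_eq Ux fg.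
by apply: IH (Df v) => x Ux; apply: near_eq_derive; exact: open_near_eq Ux fg.
Qed.

Lemma Ck_onS W k U (f : V -> W) : Ck_on k.+1 U f -> Ck_on k U f.
Proof.
elim: k f => [|k IH] f.
  by move=> [df _] x Ux; apply: differentiable_continuous; exact: df.
by move=> [df Df]; split => // v; apply: IH; exact: Df.
Qed.

Lemma Ck_on0 W k U (f : V -> W) : Ck_on k U f -> Ck_on 0 U f.
Proof. by elim: k f => [//|k IH] f /Ck_onS; exact: IH. Qed.

Lemma Ck_on_cst W k U (c : W) : Ck_on k U (cst c).
Proof.
elim: k c => [|k IH] c /=; first by move=> x _; exact: cst_continuous.
split=> [x _|v]; first exact: differentiable_cst.
by rewrite (_ : (fun x => _) = cst 0) //; apply/funext => x; rewrite derive_cst.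
Qed.

Lemma Ck_onD W k U (f g : V -> W) : open U ->
  Ck_on k U f -> Ck_on k U g -> Ck_on k U (f + g).
Proof.
move=> Uo; elim: k f g => [|k IH] f g /=.
  by move=> fc gc x Ux; apply: continuousD; [exact: fc|exact: gc].
move=> [df Df] [dg Dg]; split=> [x Ux|v].
  by apply: differentiableD; [exact: df|exact: dg].
apply: (Ck_on_eq Uo _ (IH _ _ (Df v) (Dg v))) => x Ux /=.
by rewrite deriveD //; apply: diff_derivable; [exact: df|exact: dg].
Qed.

Lemma Ck_on_sum W k U (I : Type) (r : seq I) (f : I -> V -> W) : open U ->
  (forall i, Ck_on k U (f i)) -> Ck_on k U (fun x => \sum_(i <- r) f i x).
Proof.
move=> Uo Cf; elim: r => [|i r IH].
  rewrite (_ : (fun x => _) = cst 0); first exact: Ck_on_cst.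
  by apply/funext => x; rewrite big_nil.
rewrite (_ : (fun x => _) = f i + (fun x => \sum_(j <- r) f j x)).
  by apply: Ck_onD => //.
by apply/funext => x; rewrite big_cons.
Qed.

Lemma Ck_onM k U (f g : V -> R^o) : open U ->
  Ck_on k U f -> Ck_on k U g -> Ck_on k U (fun x => f x * g x : R^o).
Proof.
move=> Uo; elim: k f g => [|k IH] f g /=.
  by move=> fc gc x Ux; apply: cvgM; [exact: fc|exact: gc].
move=> Cf Cg; have [df Df] := Cf; have [dg Dg] := Cg; split=> [x Ux|v].
  by apply: differentiableM; [exact: df|exact: dg].
have Cf' : Ck_on k U f by apply: Ck_onS.
have Cg' : Ck_on k U g by apply: Ck_onS.
apply: (Ck_on_eq Uo _ (Ck_onD Uo (IH _ _ Cf' (Dg v)) (IH _ _ Cg' (Df v)))).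
move=> x Ux /=; rewrite fctE.
have dfv : derivable f x v by apply: diff_derivable; exact: df.
have dgv : derivable g x v by apply: diff_derivable; exact: dg.
by have := deriveM dfv dgv; rewrite /GRing.scale /= => <-.
Qed.

Lemma differentiable_row n (f : V -> 'rV[R]_n) x :
  (forall j, differentiable (fun y => f y 0 j : R^o) x) -> differentiable f x.
Proof.
move=> df; rewrite (_ : f = \sum_j (fun y => f y 0 j *: delta_mx 0 j)).
  by apply: differentiable_sum => j; apply: differentiableZl; exact: df.
apply/funext => y; rewrite fct_sumE; apply/rowP => k.
rewrite summxE (bigD1 k) //= big1 ?addr0 ?mxE ?eqxx ?mulr1 //.
by move=> j jk; rewrite !mxE eqxx eq_sym (negbTE jk) mulr0.
Qed.

Lemma differentiable_entry n (f : V -> 'rV[R]_n) x j :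
  differentiable f x -> differentiable (fun y => f y 0 j : R^o) x.
Proof.
move=> df; apply: (@differentiable_comp _ _ _ _ f (fun M : 'rV[R]_n => M 0 j : R^o)) => //.
exact: differentiable_coord.
Qed.

Lemma derive_entry n (f : V -> 'rV[R]_n) x v j : differentiable f x ->
  'D_v f x 0 j = 'D_v (fun y => f y 0 j : R^o) x.
Proof.
move=> /(@diff_derivable _ _ _ _ _ v) df; apply/esym/cvg_lim => //.
pose F h : 'rV[R]_n := h^-1 *: ((f \o shift x) (h *: v) - f x).
have FD : F h @[h --> 0^'] --> 'D_v f x by exact: df.
rewrite (_ : (fun h => _) = fun h => F h 0 j); last first.
  by apply/funext => h; rewrite /F /= !mxE.
apply: (@continuous_cvg _ _ _ (nbhs 0^') _ F (fun M : 'rV[R]_n => M 0 j) ('D_v f x)).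
  exact: coord_continuous.
exact: FD.
Qed.

Lemma Ck_on_row n k U (f : V -> 'rV[R]_n) : open U ->
  Ck_on k U f <-> forall j, Ck_on k U (fun x => f x 0 j : R^o).
Proof.
move=> Uo; elim: k f => [|k IH] f.
  split=> [fc j x Ux|fc x Ux].
    apply: (@continuous_comp _ _ _ f (fun M : 'rV[R]_n => M 0 j : R^o)).
      exact: fc.
    exact: coord_continuous.
  have fE : f = fun y => \sum_j f y 0 j *: (delta_mx 0 j : 'rV[R]_n).
    by apply/funext => y; rewrite [LHS]row_sum_delta.
  rewrite /prop_for /continuous_at {2}fE {1}fE.
  apply: cvg_big; first exact: add_continuous.
  by move=> j _; apply: cvgZr_tmp; exact: fc.
split=> [[df Df] j|Cf].
  split=> [x Ux|v]; first exact/differentiable_entry/df.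
  apply: (Ck_on_eq Uo _ (iffLR (IH _) (Df v) j)) => x Ux.
  by rewrite derive_entry //; exact: df.
have df x : U x -> differentiable f x.
  by move=> Ux; apply: differentiable_row => j; have [dj _] := Cf j; exact: dj.
split=> // v; apply/IH => j; have [_ /(_ v)] := Cf j.
by apply: Ck_on_eq => // x Ux; rewrite derive_entry //; exact: df.
Qed.

Lemma derive_comp n (f : 'rV[R]_n -> R^o) (g : V -> 'rV[R]_n) x v :
  differentiable g x -> differentiable f (g x) ->
  'D_v (f \o g) x = \sum_i ('D_v g x) 0 i * 'D_(delta_mx 0 i) f (g x).
Proof.
move=> dg df; rewrite deriveE; last exact: differentiable_comp.
rewrite diff_comp //= -(deriveE v dg) {1}(row_sum_delta ('D_v g x)) linear_sum.
apply: eq_bigr => i _; rewrite linearZ (deriveE _ df).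
by [].
Qed.

Lemma derivable_line W (f : V -> W) x v s :
  derivable f (s *: v + x) v -> is_derive s 1 (fun t : R => f (t *: v + x)) ('D_v f (s *: v + x)).
Proof.
move=> df.
have E : (fun h : R => h^-1 *: (((fun t : R => f (t *: v + x)) \o shift s) (h *: (1 : R)) - f (s *: v + x)))
  = (fun h => h^-1 *: ((f \o shift (s *: v + x)) (h *: v) - f (s *: v + x))).
  by apply/funext => h /=; rewrite addrA -scalerDl [h *: _]mulr1.
split; first by rewrite /derivable E.
by rewrite /derive E.
Qed.

Lemma mean_value (f : V -> R^o) (x v : V) (t : R) : 0 < t ->
  (forall s, 0 <= s <= t -> derivable f (s *: v + x) v) ->
  exists2 s, 0 < s < t & f (t *: v + x) - f x = t * 'D_v f (s *: v + x).
Proof.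
move=> t0 df; pose phi (s : R) : R := f (s *: v + x).
have dphi s : 0 <= s <= t -> is_derive s 1 phi ('D_v f (s *: v + x)).
  by move=> /df; exact: derivable_line.
have [||s + E] := @MVT _ phi (fun s => 'D_v f (s *: v + x)) 0 t t0.
- by move=> s; rewrite in_itv /= => /andP[s0 st]; apply: dphi; rewrite !ltW.
- apply: derivable_within_continuous => s; rewrite in_itv /= => st.
  by have [] := dphi s st.
rewrite in_itv /= => st; exists s => //.
by move: E; rewrite /phi subr0 scale0r add0r mulrC => ->.
Qed.

End Ck.

Section Clairaut.
Variables (R : realType) (V : normedModType R).

(** The mean value theorem is used twice: in direction v for the increment of f along w, then in
    direction w for the derivative of f along v. *)
Lemma second_difference (U : set V) (f : V -> R^o) (x v w : V) (r t : R) :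
  Ck_on 2 U f -> ball x r `<=` U -> 0 < t -> t * (`|v| + `|w|) < r ->
  exists2 y, `|y - x| <= t * (`|v| + `|w|) &
    f (t *: v + (t *: w + x)) - f (t *: w + x) - (f (t *: v + x) - f x) =
    t ^+ 2 * 'D_w (fun z => 'D_v f z) y.
Proof.
move=> [df Df] rU t0 tr.
have dist a b : 0 <= a <= t -> 0 <= b <= t ->
    `|a *: v + (b *: w + x) - x| <= t * (`|v| + `|w|).
  move=> /andP[a0 at_] /andP[b0 bt]; rewrite addrA addrK mulrDr.
  by apply: (le_trans (ler_normD _ _)); rewrite !normrZ !ger0_norm // lerD // ler_wpM2r.
have inU a b : 0 <= a <= t -> 0 <= b <= t -> U (a *: v + (b *: w + x)).
  move=> ha hb; apply: rU; rewrite -ball_normE /= distrC.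
  exact: le_lt_trans (dist _ _ ha hb) tr.
have t00 : 0 <= (0 : R) <= t by rewrite lexx ltW.
have tt : 0 <= t <= t by rewrite lexx ltW.
have der_v a b : 0 <= a <= t -> 0 <= b <= t -> derivable f (a *: v + (b *: w + x)) v.
  by move=> ha hb; apply: diff_derivable; apply: df; exact: inU.
pose g (z : V) : R^o := f (z + t *: w) - f z.
have shiftE a : a *: v + x + t *: w = a *: v + (t *: w + x) by rewrite -addrA [x + _]addrC.
have dg s : 0 <= s <= t -> is_derive (s *: v + x) v g
    ('D_v f (s *: v + (t *: w + x)) - 'D_v f (s *: v + x)).
  move=> hs; have d1 := derivableP (der_v _ _ hs tt).
  have d2 := der_v _ _ hs t00; rewrite scale0r add0r in d2.
  apply: is_deriveB; last exact: derivableP.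
  have E : (fun h : R => h^-1 *: (((fun z : V => f (z + t *: w)) \o shift (s *: v + x)) (h *: v) - f (s *: v + x + t *: w)))
   = (fun h => h^-1 *: ((f \o shift (s *: v + (t *: w + x))) (h *: v) - f (s *: v + (t *: w + x)))).
    by apply/funext => h /=; rewrite -[h *: v + _ + _]addrA !shiftE.
  split; first by rewrite /derivable E; case: d1.
  by rewrite /derive E.
have [s /andP[s0 st] gE] := @mean_value _ _ g x v t t0 (fun s hs => @ex_derive _ _ _ _ _ _ _ (dg s hs)).
have hs : 0 <= s <= t by rewrite !ltW.
have [_ gv] := dg s hs; rewrite gv in gE.
have [|b /andP[b0 bt] hE] := @mean_value _ _ (fun z => 'D_v f z) (s *: v + x) w t t0.
  move=> b hb; apply: diff_derivable; have [dDf _] := Df v; apply: dDf.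
  by rewrite addrCA; exact: inU.
exists (b *: w + (s *: v + x)).
  by rewrite addrCA; apply: dist => //; rewrite !ltW.
rewrite expr2 -mulrA -hE [t *: w + (s *: v + x)]addrCA -gE /g shiftE.
have aux (a1 a2 a3 a4 : R) : a1 - a2 - (a3 - a4) = a1 - a3 - (a2 - a4) by ring.
by rewrite (addrC x (t *: w)); exact: aux.
Qed.

(** The second difference is symmetric in v and w, so the two mixed derivatives take a common value
    at points as close to x as desired; continuity does the rest. *)
Lemma clairaut (U : set V) (f : V -> R^o) (x v w : V) : open U -> U x ->
  Ck_on 2 U f -> 'D_w (fun z => 'D_v f z) x = 'D_v (fun z => 'D_w f z) x.
Proof.
move=> Uo Ux Cf.
have /nbhs_ballP[r /= r0 rU] := open_nbhs_nbhs (conj Uo Ux).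
have [_ Df] := Cf.
have cvw : {for x, continuous (fun z => 'D_w (fun z => 'D_v f z) z : R^o)}.
  have [_ dDf] := Df v; exact: (dDf w x Ux).
have cwv : {for x, continuous (fun z => 'D_v (fun z => 'D_w f z) z : R^o)}.
  have [_ dDf] := Df w; exact: (dDf v x Ux).
have close2 (e a b b' c : R) : b = b' -> `|a - b| < e / 2 -> `|c - b'| < e / 2 ->
    `|a - c| <= e.
  move=> <- k1 k2; apply: (le_trans (ler_distD b _ _)).
  by rewrite [e]splitr lerD // ltW // distrC.
apply/eqP; rewrite -subr_eq0 -normr_le0; apply/ler_addgt0Pl => e e0; rewrite addr0.
have e2 : 0 < e / 2 by rewrite divr_gt0.
have /cvgrPdist_lt/(_ _ e2) := cvw; have /cvgrPdist_lt/(_ _ e2) := cwv.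
move=> /nbhs_ballP[r1 /= r10 B1] /nbhs_ballP[r2 /= r20 B2].
pose rho := Num.min r (Num.min r1 r2).
have rho0 : 0 < rho by rewrite !lt_min r0 r10 r20.
have n0 : 0 < `|v| + `|w| + 1 by rewrite ltr_wpDl // addr_ge0.
pose t := rho / (`|v| + `|w| + 1) / 2.
have t0 : 0 < t by rewrite !divr_gt0.
have tr : t * (`|v| + `|w|) < rho.
  apply: (@le_lt_trans _ _ (rho / 2)); last by rewrite ltr_pdivrMr // ltr_pMr // ltr1n.
  rewrite (_ : rho / 2 = t * (`|v| + `|w| + 1)); last first.
    by rewrite /t mulrAC divfK // gt_eqF.
  by rewrite ler_wpM2l ?lerDl // ltW.
have tr' : t * (`|w| + `|v|) < rho by rewrite [`|w| + _]addrC.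
have [le1 [le2 le3]] : rho <= r /\ rho <= r1 /\ rho <= r2.
  by rewrite /rho; do !split; rewrite !ge_min lexx ?orbT.
have [y1 d1 E1] := second_difference Cf rU t0 (lt_le_trans tr le1).
have [y2 d2 E2] := second_difference Cf rU t0 (lt_le_trans tr' le1).
have E : 'D_w (fun z => 'D_v f z) y1 = 'D_v (fun z => 'D_w f z) y2.
  apply: (@mulfI _ (t ^+ 2)); first by rewrite expf_neq0 ?gt_eqF.
  apply: (etrans (esym E1)); apply: etrans E2; rewrite [t *: w + (t *: v + x)]addrCA.
  have aux (a1 a2 a3 a4 : R) : a1 - a2 - (a3 - a4) = a1 - a3 - (a2 - a4) by ring.
  exact: aux.
have := B2 y1; have := B1 y2.
rewrite -!ball_normE /= ![`|x - _|]distrC.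
move=> /(_ (le_lt_trans d2 (lt_le_trans tr' le2))) k2 /(_ (le_lt_trans d1 (lt_le_trans tr le3))) k1.
exact: close2 E k1 k2.
Qed.

End Clairaut.

(** * The ring of smooth functions on a chart domain and its derivations *)

Record domain3 (R : realType) := Domain3 {
  dset :> set 'rV[R]_3;
  dset_open : open dset;
  dpoint : 'rV[R]_3;
  dpointP : dset dpoint }.
Arguments dset {R} d _.
Arguments dset_open {R} d.
Arguments dpointP {R} d.

(* Smooth functions on an open set, normalized by the value 0 outside of it so that
   Leibniz equality is equality on the set. *)
Record sfun (R : realType) (U : domain3 R) := SFun {
  sf :> 'rV[R]_3 -> R;
  sf_smooth : smooth_on U (sf : 'rV[R]_3 -> R^o);
  sf_off : forall x, ~ dset U x -> sf x = 0 }.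

Section SmoothRing.
Variables (R : realType) (U : domain3 R).
Local Notation T := (sfun U).
Let Uo := dset_open U.

HB.instance Definition _ := gen_eqMixin T.
HB.instance Definition _ := gen_choiceMixin T.

Lemma sfun_eq (f g : T) : (forall x, dset U x -> f x = g x) -> f = g.
Proof.
case: f g => [f fs f0] [g gs g0] /= fg.
have E : f = g.
  apply/funext => x; have [Ux|nUx] := pselect (dset U x); first exact: fg.
  by rewrite f0 // g0.
by subst g; congr SFun; exact: Prop_irrelevance.
Qed.

Definition cut (f : 'rV[R]_3 -> R) (x : 'rV[R]_3) : R :=
  if `[< dset U x >] then f x else 0.

Lemma cutE f x : dset U x -> cut f x = f x.
Proof. by move=> Ux; rewrite /cut asboolT. Qed.

Lemma cut_off f x : ~ dset U x -> cut f x = 0.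
Proof. by move=> Ux; rewrite /cut asboolF. Qed.

Lemma cut_smooth (f : 'rV[R]_3 -> R) :
  smooth_on U (f : _ -> R^o) -> smooth_on U (cut f : _ -> R^o).
Proof. by move=> fs k; apply: Ck_on_eq (fs k) => // x Ux; rewrite cutE. Qed.

Definition mksfun f (fs : smooth_on U (f : _ -> R^o)) : T :=
  SFun (cut_smooth fs) (@cut_off f).

Let const_smooth (c : R) : smooth_on U (cst c : 'rV[R]_3 -> R^o).
Proof. by move=> k; exact: Ck_on_cst. Qed.

Let zero : T := mksfun (const_smooth 0).
Let one : T := mksfun (const_smooth 1).

Let add_smooth (f g : T) : smooth_on U (fun x => f x + g x : R^o).
Proof. by move=> k; apply: (Ck_onD Uo); exact: sf_smooth. Qed.
Let mul_smooth (f g : T) : smooth_on U (fun x => f x * g x : R^o).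
Proof. by move=> k; apply: (Ck_onM Uo); exact: sf_smooth. Qed.
Let opp_smooth (f : T) : smooth_on U (fun x => - f x : R^o).
Proof.
move=> k; apply: (@Ck_on_eq _ _ _ _ _ (fun x => (-1) * f x : R^o)) => //.
  by move=> x _; rewrite mulN1r.
by apply: (Ck_onM Uo); [exact: Ck_on_cst|exact: sf_smooth].
Qed.

Let add f g : T := mksfun (add_smooth f g).
Let mul f g : T := mksfun (mul_smooth f g).
Let opp f : T := mksfun (opp_smooth f).

Let addA : associative add.
Proof. by move=> f g h; apply: sfun_eq => x Ux /=; rewrite !cutE //= ?cutE // addrA. Qed.
Let addC : commutative add.
Proof. by move=> f g; apply: sfun_eq => x Ux /=; rewrite !cutE //= addrC. Qed.
Let add0 : left_id zero add.
Proof. by move=> f; apply: sfun_eq => x Ux /=; rewrite !cutE //= ?cutE //= add0r. Qed.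
Let addN : left_inverse zero opp add.
Proof. by move=> f; apply: sfun_eq => x Ux /=; rewrite !cutE //= ?cutE //= addNr. Qed.

HB.instance Definition _ := GRing.isZmodule.Build T addA addC add0 addN.

Let mulA : associative mul.
Proof. by move=> f g h; apply: sfun_eq => x Ux /=; rewrite !cutE //= ?cutE // mulrA. Qed.
Let mulC : commutative mul.
Proof. by move=> f g; apply: sfun_eq => x Ux /=; rewrite !cutE //= mulrC. Qed.
Let mul1 : left_id one mul.
Proof. by move=> f; apply: sfun_eq => x Ux /=; rewrite !cutE //= ?cutE //= mul1r. Qed.
Let mulD : left_distributive mul add.
Proof. by move=> f g h; apply: sfun_eq => x Ux /=; rewrite !cutE //= ?cutE //= mulrDl. Qed.
(** This is the purpose of the base point in [domain3]: over the empty set the ring would be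
    zero. *)
Let one0 : one != zero.
Proof.
apply/eqP => /(congr1 (fun f : T => f (dpoint U))) /=.
by rewrite !cutE; [move/eqP; rewrite oner_eq0|exact: dpointP..].
Qed.

HB.instance Definition _ :=
  GRing.Zmodule_isComNzRing.Build T mulA mulC mul1 mulD one0.

End SmoothRing.

Section SmoothDerivations.
Variables (R : realType) (U : domain3 R).
Local Notation T := (sfun U).
Let Uo := dset_open U.

Lemma sfunD (f g : T) x : dset U x -> (f + g) x = f x + g x.
Proof. by move=> Ux; rewrite [LHS](cutE _ Ux). Qed.

Lemma sfunM (f g : T) x : dset U x -> (f * g) x = f x * g x.
Proof. by move=> Ux; rewrite [LHS](cutE _ Ux). Qed.

Lemma sfunN (f : T) x : dset U x -> (- f) x = - f x.
Proof. by move=> Ux; rewrite [LHS](cutE _ Ux). Qed.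

Lemma sfun0 x : dset U x -> (0 : T) x = 0.
Proof. by move=> Ux; rewrite [LHS](cutE _ Ux). Qed.

Lemma sfun1 x : dset U x -> (1 : T) x = 1.
Proof. by move=> Ux; rewrite [LHS](cutE _ Ux). Qed.

Definition eval_at (x : {x | dset U x}) (f : T) : R := f (sval x).

Let eval_zmod x : zmod_morphism (eval_at x).
Proof.
by move=> f g; have Ux := svalP x; rewrite /eval_at sfunD // sfunN.
Qed.

Let eval_monoid x : monoid_morphism (eval_at x).
Proof.
by have Ux := svalP x; split=> [|f g]; rewrite /eval_at ?sfun1 // sfunM.
Qed.

HB.instance Definition _ x := GRing.isZmodMorphism.Build _ _ (eval_at x) (eval_zmod x).
HB.instance Definition _ x := GRing.isMonoidMorphism.Build _ _ (eval_at x) (eval_monoid x).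

Lemma derive_smooth (f : 'rV[R]_3 -> R^o) v :
  smooth_on U f -> smooth_on U (fun x => 'D_v f x : R^o).
Proof. by move=> fs k; have [_ /(_ v)] := fs k.+1. Qed.

Definition pder (i : 'I_3) (f : T) : T :=
  mksfun (derive_smooth (delta_mx 0 i) (@sf_smooth _ _ f)).

Lemma pderE i (f : T) x : dset U x -> pder i f x = 'D_(delta_mx 0 i) f x.
Proof. exact: cutE. Qed.

Lemma sfun_derivable (f : T) x v : dset U x -> derivable (f : _ -> R^o) x v.
Proof. by move=> Ux; apply: diff_derivable; have [df _] := @sf_smooth _ _ f 1%N; exact: df. Qed.

Lemma sfun_near (f : T) (g : 'rV[R]_3 -> R) x : dset U x ->
  (forall y, dset U y -> f y = g y) -> \near x, f x = g x.
Proof. by move=> Ux; exact: open_near_eq. Qed.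

Lemma pder_add i (f g : T) : pder i (f + g) = pder i f + pder i g.
Proof.
apply: sfun_eq => x Ux; rewrite sfunD // !pderE //.
rewrite (near_eq_derive (g := (f : _ -> R^o) + g)).
  by rewrite deriveD //; exact: sfun_derivable.
by apply: sfun_near => // y Uy; rewrite sfunD.
Qed.

Lemma pder_mul i (f g : T) : pder i (f * g) = pder i f * g + f * pder i g.
Proof.
apply: sfun_eq => x Ux; rewrite sfunD // !sfunM // !pderE //.
rewrite (near_eq_derive (g := (f : _ -> R^o) * g)).
  rewrite deriveM; [|exact: sfun_derivable..].
  by rewrite /GRing.scale /= addrC mulrC.
by apply: sfun_near => // y Uy; rewrite sfunM.
Qed.

Lemma pder_comm i j (f : T) : pder i (pder j f) = pder j (pder i f).
Proof.
apply: sfun_eq => x Ux.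
have E p q : pder p (pder q f) x =
    'D_(delta_mx 0 p) (fun y => 'D_(delta_mx 0 q) f y : R^o) x.
  apply: etrans (pderE _ _ Ux) _; apply: near_eq_derive.
  by apply: sfun_near => // y Uy; exact: pderE.
apply: etrans (E i j) _; apply: etrans (esym (E j i)).
exact: (clairaut _ _ Uo Ux (@sf_smooth _ _ f 2%N)).
Qed.

End SmoothDerivations.

(** * The geometry of a chart translated into its ring of smooth functions *)

Lemma cross_cross7 (R : realType) (x y : 'rV[R]_7) : cross x y = cross7 x y.
Proof.
have io (k : 'I_7) : inord k = k by apply: val_inj; rewrite /= inordK.
apply/rowP; refine (ord7P _ _ _ _ _ _ _); rewrite !mxE /=;
rewrite (io j0) (io j1) (io j2) (io j3) (io j4) (io j5) (io j6) /fano /=;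
rewrite /omul /hmul /hconj /cmul /cconj /cd_mul /cd_conj /=; by field.
Qed.

Lemma dot_dot7 (R : realType) (x y : 'rV[R]_7) : dot x y = dot7 x y.
Proof. by []. Qed.

Lemma fano_morph (A B : comNzRingType) (phi : {rmorphism A -> B})
    (x y : 'I_7 -> A) i :
  phi (fano x y i) = fano (phi \o x) (phi \o y) i.
Proof.
by move: i; refine (ord7P _ _ _ _ _ _ _); rewrite /fano /= !rmorphD !rmorphN !rmorphM.
Qed.

Section Chart.
Variables (R : realType) (U : domain3 R) (F : 'rV[R]_3 -> 'rV[R]_7)
  (e : 'I_3 -> 'rV[R]_3 -> 'rV[R]_3).
Hypothesis F_smooth : smooth_on U F.
Hypothesis F_sphere : forall u, dset U u -> dot (F u) (F u) = 1.
Hypothesis e_frame : orthonormal_frame F U e.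
Hypothesis F_lagrangian : forall u v w, dset U u ->
  dot (cross (F u) ('D_v F u)) ('D_w F u) = 0.
Local Notation A := (sfun U).
Let Uo := dset_open U.

Let entry_smooth n (W : 'rV[R]_3 -> 'rV[R]_n) j : smooth_on U W ->
  smooth_on U (fun x => W x 0 j : R^o).
Proof. by move=> Ws k; exact: (iffLR (Ck_on_row _ _ Uo) (Ws k) j). Qed.

Definition chart_pos : 'rV[A]_7 := \row_j mksfun (entry_smooth j F_smooth).
Definition frame_coef (l i : 'I_3) : A := mksfun (entry_smooth i (e_frame.1 l)).
Definition chart_der : 'I_3 -> A -> A := fder (@pder R U) frame_coef.
Definition frame_vec (l : 'I_3) : 'rV[A]_7 := der7 chart_der l chart_pos.
Let D := chart_der.
Let Fs := chart_pos.
Let E := frame_vec.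

Lemma chart_derD l x y : D l (x + y) = D l x + D l y.
Proof. exact: (fder_add (@pder_add R U)). Qed.

Lemma chart_derM l x y : D l (x * y) = D l x * y + x * D l y.
Proof. exact: (fder_mul (@pder_mul R U)). Qed.

Lemma sfun_sum3 (f : 'I_3 -> A) u : dset U u -> (sum3 f) u = \sig_i f i u.
Proof. by move=> Uu; rewrite /sum3 !sfunD. Qed.

Lemma derive_coord (f : 'rV[R]_3 -> R^o) u v : differentiable f u ->
  'D_v f u = \sig_i v 0 i * 'D_(delta_mx 0 i) f u.
Proof.
move=> df; rewrite deriveE // {1}(row_sum_delta v) linear_sum sum3E.
by apply: eq_sum3 => i; rewrite linearZ (deriveE _ df).
Qed.

Let sfun_diff (f : A) u : dset U u -> differentiable (f : _ -> R^o) u.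
Proof. by move=> Uu; have [df _] := @sf_smooth _ _ f 1%N; exact: df. Qed.

Lemma chart_derE l (f : A) u : dset U u -> D l f u = 'D_(e l u) (f : _ -> R^o) u.
Proof.
move=> Uu; rewrite derive_coord; last exact: sfun_diff.
rewrite /D /chart_der /fder sfun_sum3 //; apply: eq_sum3 => i.
by rewrite sfunM // pderE //; congr (_ * _); apply: cutE.
Qed.

(** The three relations connect the functions of the statement, whose values off U are arbitrary, to
    elements of the ring. Each operation of the statement is shown to respect them, so that it can
    be computed in the ring. *)
Definition rep (W : 'rV[R]_3 -> 'rV[R]_7) (w : 'rV[A]_7) : Prop :=
  forall u j, dset U u -> W u 0 j = w 0 j u.

Definition repS (f : 'rV[R]_3 -> R) (a : A) : Prop :=
  forall u, dset U u -> f u = a u.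

Definition repX (X : 'rV[R]_3 -> 'rV[R]_3) (x : 'I_3 -> A) : Prop :=
  forall u, dset U u -> X u = \sig_i x i u *: e i u.

Lemma rep_pos : rep F Fs.
Proof. by move=> u j Uu; rewrite mxE; apply/esym/cutE. Qed.

Lemma rep_differentiable W w u : rep W w -> dset U u -> differentiable W u.
Proof.
move=> Ww Uu; apply: differentiable_row => j.
apply: (near_eq_differentiable (f := w 0 j : _ -> R^o)); last exact: sfun_diff.
by apply: sfun_near => // y Uy; rewrite Ww.
Qed.

Lemma rep_derive X x W w : repX X x -> rep W w ->
  rep (fun u => 'D_(X u) W u) (\sig_i x i *: der7 D i w).
Proof.
move=> Xx Ww u j Uu; have dW := rep_differentiable Ww Uu.
rewrite derive_entry //.
rewrite (near_eq_derive (g := w 0 j : _ -> R^o)); last first.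
  have := @sfun_near _ U (w 0 j) (fun y => W y 0 j) u Uu.
  by move=> /(_ (fun y Uy => esym (Ww y j Uy))); apply: filterS => y ->.
have dw := sfun_diff (w 0 j) Uu.
rewrite (deriveE _ dw) (Xx u Uu) /sum3 !linearD !linearZ /= -!(deriveE _ dw).
rewrite !mxE sfunD // sfunD // !sfunM //.
by rewrite !(chart_derE _ _ Uu).
Qed.

Lemma repX_frame l : repX (e l) (fun i => kron A l i).
Proof.
move=> u Uu; have [k0 k1] : (0 : A) u = 0 /\ (1 : A) u = 1.
  by split; [exact: sfun0|exact: sfun1].
rewrite (eq_sum3 (G := fun i => kron R l i *: e i u)); first by rewrite sum3_kronZ.
by move=> i; congr (_ *: _); move: l i; do 2 (refine (ord3P _ _ _)); rewrite /kron /= ?k0 ?k1.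
Qed.

Lemma rep_frame l : rep (push F (e l)) (E l).
Proof.
have := rep_derive (repX_frame l) rep_pos; rewrite (_ : \sig_i _ = E l) //.
exact: (sum3_kronZ (fun i => der7 D i Fs)).
Qed.

Lemma rep_dot V W v w : rep V v -> rep W w ->
  repS (fun u => dot (V u) (W u)) (dot7 v w).
Proof.
move=> Vv Ww u Uu; rewrite /dot /dot7 !sum7E !sfunD // !sfunM //.
by rewrite !Vv // !Ww.
Qed.

Lemma rep_cross V W v w : rep V v -> rep W w ->
  rep (fun u => cross (V u) (W u)) (cross7 v w).
Proof.
move=> Vv Ww u j Uu; rewrite cross_cross7 !mxE.
apply: etrans (esym (fano_morph (@eval_at R U (exist _ u Uu)) (v 0) (w 0) j)).
congr (fano _ _ _); apply/funext => k.
  by rewrite /eval_at /= Vv.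
by rewrite /eval_at /= Ww.
Qed.

Lemma kron_eval i j u : dset U u -> (kron A i j) u = kron R i j.
Proof.
move=> Uu; have [k0 k1] : (0 : A) u = 0 /\ (1 : A) u = 1.
  by split; [exact: sfun0|exact: sfun1].
by move: i j; do 2 (refine (ord3P _ _ _)); rewrite /kron /= ?k0 ?k1.
Qed.

Let N i := cross7 Fs (E i).

Lemma chart_FF : dot7 Fs Fs = 1.
Proof.
apply: sfun_eq => u Uu; rewrite sfun1 //.
by rewrite -(rep_dot rep_pos rep_pos) // F_sphere.
Qed.

Lemma chart_EE i j : dot7 (E i) (E j) = kron A i j.
Proof.
apply: sfun_eq => u Uu; rewrite -(rep_dot (rep_frame i) (rep_frame j)) // kron_eval //.
rewrite e_frame.2 //; move: i j; do 2 (refine (ord3P _ _ _)); by [].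
Qed.

Lemma chart_EN i j : dot7 (E i) (N j) = 0.
Proof.
apply: sfun_eq => u Uu; have zE : (0 : A) u = 0 by exact: sfun0.
rewrite zE -(rep_dot (rep_frame i) (rep_cross rep_pos (rep_frame j))) //.
by rewrite dot_dot7 dot7C; exact: F_lagrangian.
Qed.

Let twelfth_smooth : smooth_on U (cst (1 / 12) : 'rV[R]_3 -> R^o).
Proof. by move=> k; exact: Ck_on_cst. Qed.
Definition chart_twelfth : A := mksfun twelfth_smooth.
Let tw := chart_twelfth.

Lemma chart_twelfthE : 12 * tw = 1.
Proof.
apply: sfun_eq => u Uu; have twE : tw u = 1 / 12 by apply: cutE.
rewrite sfunM // sfun1 // twE.
have := rmorph_nat (@eval_at R U (exist _ u Uu)) 12; rewrite /eval_at /= => ->.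
by rewrite mul1r divff // pnatr_eq0.
Qed.

Let P := der7 (@pder R U).

Definition frame_dual : 'I_3 -> 'I_3 -> A := coframe (@pder R U) frame_coef Fs.
Let g := frame_dual.

Definition frame_bracket (m l a : 'I_3) : A :=
  \sig_i (D m (frame_coef l i) - D l (frame_coef m i)) * g i a.

Lemma chart_bracket m l x :
  D m (D l x) - D l (D m x) = \sig_a frame_bracket m l a * D a x.
Proof.
apply: (fder_bracket (@pder_add R U) (@pder_mul R U) (@pder_comm R U)).
by move=> y i; exact: (coord_der chart_EE).
Qed.

(** If M is the matrix of the frame in coordinates, orthonormality reads M g M^T = 1, whence the
    inverse metric is M^T M. *)
Lemma sharpE u (a : 'rV[R]_3) : dset U u ->
  sharp F u a = \sig_k (\sum_l a 0 l * e k u 0 l) *: e k u.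
Proof.
move=> Uu; pose M : 'M[R]_3 := \matrix_(k, l) e k u 0 l.
have dF := rep_differentiable rep_pos Uu.
have pushE k : push F (e k) u = \sum_l e k u 0 l *: 'D_(coordv R l) F u.
  rewrite /push deriveE // {1}(row_sum_delta (e k u)) linear_sum.
  by apply: eq_bigr => l _; rewrite linearZ (deriveE _ dF).
have [_ eE] := e_frame.
pose K : 'M[R]_(3, 7) := \matrix_l 'D_(coordv R l) F u.
have metricE : metric F u = K *m K^T.
  by apply/matrixP => i j; rewrite !mxE; apply: eq_bigr => x _; rewrite !mxE.
have pushK k x : push F (e k) u 0 x = (M *m K) k x.
  by rewrite pushE mxE summxE; apply: eq_bigr => l _; rewrite !mxE.
have MgM : M *m (metric F u *m M^T) = 1%:M.
  rewrite metricE -mulmxA mulmxA -trmx_mul; apply/matrixP => i j.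
  rewrite [RHS]mxE -(eE i j u Uu) mxE; apply: eq_bigr => x _.
  by rewrite !pushK [_^T _ _]mxE.
have gi : invmx (metric F u) = M^T *m M.
  have := mulmx1C MgM; rewrite -mulmxA => gM.
  have gu : metric F u \in unitmx by case: (mulmx1_unit gM).
  by rewrite -[RHS]mul1mx -(mulVmx gu) -mulmxA gM mulmx1.
rewrite /sharp gi mulmxA; apply/rowP => j; rewrite mxE sum3E.
rewrite /sum3 !mxE; congr (_ + _ + _); congr (_ * _); rewrite ?mxE //;
  by apply: eq_bigr => l _; rewrite !mxE.
Qed.

Lemma repX_sharp V v : rep V v ->
  repX (fun u => sharp F u (\row_l dot (V u) ('D_(coordv R l) F u)))
    (fun k => dot7 v (E k)).
Proof.
move=> Vv u Uu; rewrite sharpE //; apply: eq_sum3 => k; congr (_ *: _).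
rewrite -(rep_dot Vv (rep_frame k)) // /push.
have dF := rep_differentiable rep_pos Uu.
rewrite deriveE // {2}(row_sum_delta (e k u)) linear_sum /dot.
under [RHS]eq_bigr do rewrite summxE mulr_sumr.
rewrite exchange_big /=; apply: eq_bigr => l _.
rewrite !mxE mulr_suml; apply: eq_bigr => x _.
by rewrite linearZ /= mxE -(deriveE _ dF) -mulrA; congr (_ * _); rewrite mulrC.
Qed.

End Chart.

Section ChartTensors.
Variables (R : realType) (U : domain3 R) (F : 'rV[R]_3 -> 'rV[R]_7)
  (e : 'I_3 -> 'rV[R]_3 -> 'rV[R]_3).
Hypothesis F_smooth : smooth_on U F.
Hypothesis F_sphere : forall u, dset U u -> dot (F u) (F u) = 1.
Hypothesis e_frame : orthonormal_frame F U e.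
Hypothesis F_lagrangian : forall u v w, dset U u ->
  dot (cross (F u) ('D_v F u)) ('D_w F u) = 0.
Local Notation A := (sfun U).

Let D := chart_der e_frame.
Let Fs := chart_pos F_smooth.
Let E := frame_vec F_smooth e_frame.
Let N i := cross7 Fs (E i).
Let p := @pder R U.
Let P := der7 p.
Let ec := frame_coef e_frame.
Let g := frame_dual F_smooth e_frame.
Let D_add := chart_derD e_frame.
Let D_mul := chart_derM e_frame.
Let dFF := chart_FF F_smooth F_sphere.
Let dEE := chart_EE F_smooth e_frame.
Let dEN := chart_EN F_smooth e_frame F_lagrangian.
Let D_beta := chart_bracket F_smooth e_frame.
Let tw := chart_twelfth U.
Let twE := chart_twelfthE U.
Let DF l : der7 D l Fs = E l := erefl.

Let G := conn7 D E.
Let h := sff7 D Fs E.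
Let t := cov7 D Fs E tw.

Lemma repD V W (v w : 'rV[A]_7) : rep V v -> rep W w -> rep (fun u => V u + W u) (v + w).
Proof. by move=> Vv Ww u j Uu; rewrite mxE Vv // Ww // mxE sfunD. Qed.

Lemma repB V W (v w : 'rV[A]_7) : rep V v -> rep W w -> rep (fun u => V u - W u) (v - w).
Proof. by move=> Vv Ww u j Uu; rewrite !mxE Vv // Ww // sfunD // sfunN. Qed.

Lemma repZ f W a (w : 'rV[A]_7) : repS f a -> rep W w -> rep (fun u => f u *: W u) (a *: w).
Proof. by move=> fa Ww u j Uu; rewrite mxE Ww // fa // mxE sfunM. Qed.

Definition rep3 (X : 'rV[R]_3 -> 'rV[R]_3) (x : 'I_3 -> A) : Prop :=
  forall u j, dset U u -> X u 0 j = x j u.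

Let coords := frame_coords ec.

Let ecE a l u : dset U u -> ec a l u = e a u 0 l.
Proof. by move=> Uu; exact: cutE. Qed.

Let coordsE x l u : dset U u -> coords x l u = (\sig_a x a u *: e a u) 0 l.
Proof.
move=> Uu; rewrite /coords /frame_coords sfun_sum3 // /sum3 !mxE.
by rewrite !sfunM // !ecE.
Qed.

Lemma repX_rep3 X x : repX e X x -> rep3 X (coords x).
Proof. by move=> Xx u l Uu; rewrite coordsE // Xx. Qed.

Lemma rep3_repX X x : rep3 X (coords x) -> repX e X x.
Proof. by move=> Xx u Uu; apply/rowP => l; rewrite Xx // coordsE. Qed.

Lemma rep_push X x : repX e X x -> rep (push F X) (lin7 x E).
Proof. by move=> Xx; exact: (rep_derive e_frame Xx (rep_pos F_smooth)). Qed.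

Lemma rep_dir X x W w : repX e X x -> rep W w -> rep (fun u => 'D_(X u) W u) (dir7 D x w).
Proof. exact: rep_derive. Qed.

Lemma repX_coord l : repX e (coord_field l) (g l).
Proof.
apply: rep3_repX => u j Uu.
have -> : coords (g l) j = kron A l j by exact: (coef_coframe dEE).
rewrite kron_eval // mxE eqxx /=.
by move: l j {Uu}; do 2 (refine (ord3P _ _ _)).
Qed.

Lemma rep_coord_dir l W w : rep W w -> rep (fun u => 'D_(coordv R l) W u) (P l w).
Proof. by move=> Ww; rewrite (_ : P l w = dir7 D (g l) w);
  [exact: (rep_dir (repX_coord l) Ww)
  |exact: esym (dir7_coframe dEE l w)]. Qed.

Lemma repS_dir X x (f : 'rV[R]_3 -> R) a : repX e X x -> repS f a ->
  repS (fun u => 'D_(X u) (f : _ -> R^o) u) (\sig_i x i * D i a).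
Proof.
move=> Xx fa u Uu; have af : \near u, a u = f u.
  by apply: sfun_near => // y Uy; rewrite fa.
have da : differentiable (a : _ -> R^o) u.
  by have [da _] := @sf_smooth _ _ a 1%N; exact: da.
have -> : 'D_(X u) (f : _ -> R^o) u = 'D_(X u) (a : _ -> R^o) u.
  by apply: near_eq_derive; apply: filterS af => y ->.
rewrite sfun_sum3 // (eq_sum3 (G := fun i => x i u * 'D_(e i u) (a : _ -> R^o) u)).
  by rewrite (Xx u Uu) deriveE // /sum3 !linearD !linearZ -!(deriveE _ da).
by move=> i; rewrite sfunM // (chart_derE e_frame).
Qed.

Lemma repS_coord_dir l (f : 'rV[R]_3 -> R) a : repS f a ->
  repS (fun u => 'D_(coordv R l) (f : _ -> R^o) u) (p l a).
Proof.
move=> fa; rewrite (_ : p l a = \sig_i g l i * D i a); last exact: (coord_der dEE).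
exact: (repS_dir (repX_coord l) fa).
Qed.

Let gamma := coord_conn p ec Fs.

Lemma christoffel_rep i j : rep3 (christoffel F i j) (coords (gamma i j)).
Proof.
move=> u l' Uu; rewrite coordsE //.
have gmE a b : repS (fun v => metric F v a b) (dot7 (P a Fs) (P b Fs)).
  move=> v Uv; rewrite /metric mxE.
  exact: (rep_dot (rep_coord_dir a (rep_pos F_smooth)) (rep_coord_dir b (rep_pos F_smooth))).
have dgE k a b := repS_coord_dir k (gmE a b) Uu.
have rowE l : (p i (dot7 (P j Fs) (P l Fs)) u + p j (dot7 (P i Fs) (P l Fs)) u
    - p l (dot7 (P i Fs) (P j Fs)) u) = 2 * dot7 (P i (P j Fs)) (P l Fs) u.
  rewrite -sfunN // -sfunD // -sfunD //.
  have := koszul (@pder_add R U) (@pder_mul R U) (@pder_comm R U) Fs i j l.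
  move=> /(congr1 (fun f : A => f u)) => ->; rewrite sfunM //.
  by have := rmorph_nat (@eval_at R U (exist _ u Uu)) 2; rewrite /eval_at /= => ->.
rewrite /christoffel (sharpE F_smooth e_frame) //; congr (fun_of_matrix _ 0 l').
apply: eq_sum3 => k; congr (_ *: _).
transitivity (\sum_l dot7 (P i (P j Fs)) (P l Fs) u * e k u 0 l).
  apply: eq_bigr => l _; congr (_ * _); rewrite mxE !dgE rowE mulrA mulVf ?mul1r //.
rewrite /gamma coord_connE sum3E sfun_sum3 //; apply: eq_sum3 => l.
by rewrite sfunM // ecE.
Qed.

Lemma nabla_rep X Y x y : repX e X x -> repX e Y y ->
  repX e (nabla F X Y) (frame_nabla D E x y).
Proof.
move=> Xx Yy; apply: rep3_repX => u l Uu.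
rewrite /coords (nabla_coords (@pder_add R U) (@pder_mul R U) dEE).
rewrite mxE sfunD //; congr (_ + _).
  have dY : differentiable Y u.
    apply: differentiable_row => j.
    apply: (near_eq_differentiable (f := coords y j : _ -> R^o)).
      by apply: sfun_near => // v Uv; rewrite (repX_rep3 Yy).
    by have [da _] := @sf_smooth _ _ (coords y j) 1%N; exact: da.
  rewrite derive_entry //; apply: (repS_dir Xx _ Uu) => v Uv.
  exact: (repX_rep3 Yy).
rewrite summxE sum3E sfun_sum3 //; apply: eq_sum3 => q.
rewrite summxE sum3E sfun_sum3 //; apply: eq_sum3 => m.
rewrite mxE sfunM // sfunM //; congr (_ * _ * _).
- exact: (repX_rep3 Xx).
- exact: (repX_rep3 Yy).
- exact: christoffel_rep.
Qed.

Lemma nablabar_rep X x W w : repX e X x -> rep W w ->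
  rep (nablabar F X W) (dir7 D x w - dot7 (dir7 D x w) Fs *: Fs).
Proof.
move=> Xx Ww; have dW := rep_dir Xx Ww; apply: repB => //.
by apply: repZ; [apply: rep_dot => //|]; exact: rep_pos.
Qed.

Lemma sff_rep X Y x y : repX e X x -> repX e Y y ->
  rep (sff F X Y) (lin7 (bil3 h x y) N).
Proof.
move=> Xx Yy.
have := repB (nablabar_rep Xx (rep_push Yy)) (rep_push (nabla_rep Xx Yy)).
by rewrite (sff_part D_add D_mul dFF DF dEE dEN twE).
Qed.

Lemma nablaperp_rep X x W w : repX e X x -> rep W w ->
  rep (nablaperp F X W) (lin7 (fun k => dot7 (dir7 D x w) (N k)) N).
Proof.
move=> Xx Ww; have nW := nablabar_rep Xx Ww.
have := repB nW (rep_push (repX_sharp F_smooth e_frame nW)).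
by rewrite (normal_part D_add D_mul dFF DF dEE dEN twE).
Qed.

Lemma Jpush_rep Z z : repX e Z z -> rep (Jop F (push F Z)) (lin7 z N).
Proof.
move=> Zz; have := rep_cross (rep_pos F_smooth) (rep_push Zz).
by rewrite cross7_linr.
Qed.

Lemma shape_op_rep xi w X x : repX e X x -> rep xi (lin7 w N) ->
  repX e (shape_op F xi X) (fun j => \sig_i \sig_m x i * w m * h i j m).
Proof.
move=> Xx xiw u Uu; rewrite /shape_op (sharpE F_smooth e_frame) //; apply: eq_sum3 => k; congr (_ *: _).
have hE l : repS (fun u => dot (sff F X (coord_field l) u) (xi u))
    (\sig_m bil3 h x (g l) m * w m).
  rewrite (_ : sum3 _ = dot7 (lin7 (bil3 h x (g l)) N) (lin7 w N)).
    exact: rep_dot (sff_rep Xx (repX_coord l)) xiw.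
  rewrite dot7_lin; apply: eq_sum3 => m; congr (_ * _).
  by rewrite dot7C (frame_NN_lin D_add D_mul dFF DF dEE twE).
transitivity ((\sig_l (\sig_m bil3 h x (g l) m * w m) * ec k l) u).
  rewrite sfun_sum3 // sum3E; apply: eq_sum3 => l.
  by rewrite mxE hE // sfunM // ecE.
by congr (sf _ u); exact: (coframe_contract dEE).
Qed.

Lemma Gtensor_rep X Y x y : repX e X x -> repX e Y y ->
  rep (Gtensor F X Y) (lin7 (bil3 (fun i j k => sign7 Fs E * eps3 A i j k) x y) N).
Proof.
move=> Xx Yy; rewrite -(torsion_part D_add D_mul D_beta dFF DF dEE dEN twE).
have JY := rep_cross (rep_pos F_smooth) (rep_push Yy).
apply: repB; first exact: (nablabar_rep Xx JY).
exact: (rep_cross (rep_pos F_smooth) (nablabar_rep Xx (rep_push Yy))).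
Qed.

Let rep_lin V v f f' : (forall k, f k = f' k) -> rep V (lin7 f v) -> rep V (@lin7 A f' v).
Proof. by move=> ff; rewrite (_ : lin7 f v = lin7 f' v) //; apply: eq_sum3 => k; rewrite ff. Qed.

Lemma nabla_sff_rep X Y Z x y z : repX e X x -> repX e Y y -> repX e Z z ->
  rep (nabla_sff F X Y Z) (lin7 (fun k => (\sig_i x i * (D i (bil3 h y z k) +
      \sig_b bil3 h y z b * (G i b k + sign7 Fs E * eps3 A i b k)))
  - bil3 h (frame_nabla D E x y) z k - bil3 h y (frame_nabla D E x z) k) N).
Proof.
move=> Xx Yy Zz.
have := repB (repB (nablaperp_rep Xx (sff_rep Yy Zz))
  (sff_rep (nabla_rep Xx Yy) Zz)) (sff_rep Yy (nabla_rep Xx Zz)).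
rewrite !lin7B; apply: rep_lin => k; do 2 congr (_ - _).
by rewrite (dir_normal_frame D_add D_mul D_beta dFF DF dEE dEN twE).
Qed.

Lemma quarterE u : dset U u -> (3 * tw) u = 4^-1.
Proof.
move=> Uu; have [r3 r12] : (3 : A) u = 3 /\ (12 : A) u = 12.
  by split; [have := rmorph_nat (@eval_at R U (exist _ u Uu)) 3
            |have := rmorph_nat (@eval_at R U (exist _ u Uu)) 12]; rewrite /eval_at.
have te : 12 * tw u = 1 by rewrite -r12 -sfunM // twE sfun1.
by rewrite sfunM // r3; lra.
Qed.

(** The tensor T of the statement, defined with the Levi-Civita and normal connections and a
    correction by G, is the covariant derivative of h with torsion; in [t] the derivative index
    comes last. *)
Lemma Ttensor_rep X Y Z x y z : repX e X x -> repX e Y y -> repX e Z z ->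
  rep (Ttensor F X Y Z) (lin7 (tri3 (fun l i j k => t i j k l) x y z) N).
Proof.
move=> Xx Yy Zz.
have Gs X' Y' Z' x' y' z' (Xx' : repX e X' x') (Yy' : repX e Y' y') (Zz' : repX e Z' z') :=
  Gtensor_rep Xx' (shape_op_rep Yy' (Jpush_rep Zz')).
have G1 := Gs _ _ _ _ _ _ Xx Yy Zz; have G2 := Gs _ _ _ _ _ _ Yy Zz Xx.
have G3 := Gs _ _ _ _ _ _ Zz Xx Yy.
have quarter : repS (fun=> 4^-1) (3 * tw) by move=> u Uu; rewrite quarterE.
have := repB (nabla_sff_rep Xx Yy Zz) (repZ quarter (repD (repD G1 G2) G3)).
rewrite !lin7D lin7Z lin7B.
apply: rep_lin => k; exact: (cov7_torsion D_add D_mul D_beta dFF DF dEE dEN twE).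
Qed.

End ChartTensors.

(** * Evaluation at a point and the bound in a chart *)

Section Morphism.
Variables (A B : comNzRingType) (phi : {rmorphism A -> B}).
Implicit Types h : 'I_3 -> 'I_3 -> 'I_3 -> A.

Lemma rmorph_sum3 f : phi (sum3 f) = \sig_i phi (f i).
Proof. by rewrite /sum3 !rmorphD. Qed.

Lemma rmorph_kron i j : phi (kron A i j) = kron B i j.
Proof. by move: i j; do 2 (refine (ord3P _ _ _)); rewrite /kron /= ?rmorph1 ?rmorph0. Qed.

Lemma rmorph_eps3 i j k : phi (eps3 A i j k) = eps3 B i j k.
Proof.
by move: i j k; do 3 (refine (ord3P _ _ _));
   rewrite /eps3 /= ?rmorphN ?rmorph1 ?rmorph0.
Qed.

Ltac push_morph := repeat first
  [ rewrite rmorph_sum3; apply: eq_sum3 => ?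
  | rewrite rmorphB; congr (_ - _) | rewrite rmorphD; congr (_ + _)
  | rewrite rmorphM; congr (_ * _) | rewrite rmorphXn; congr (_ ^+ _)
  | rewrite rmorph_nat | rewrite rmorph1 | rewrite rmorph_kron | rewrite rmorph_eps3].

Lemma rmorph_shape h a b : phi (shape h a b) = shape (fun i j k => phi (h i j k)) a b.
Proof. by push_morph. Qed.

Lemma rmorph_str1 h : phi (str1 h) = str1 (fun i j k => phi (h i j k)).
Proof. by rewrite /str1; push_morph; rewrite rmorph_shape. Qed.

Lemma rmorph_str2 h : phi (str2 h) = str2 (fun i j k => phi (h i j k)).
Proof. by rewrite /str2; push_morph; rewrite rmorph_shape. Qed.

Lemma rmorph_str3 h : phi (str3 h) = str3 (fun i j k => phi (h i j k)).
Proof. by rewrite /str3; push_morph; rewrite rmorph_shape. Qed.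

Lemma rmorph_curv_act tau h m l a b c : phi (curv_act tau h m l a b c) =
  curv_act (phi tau) (fun i j k => phi (h i j k)) m l a b c.
Proof. by rewrite /curv_act /curv; push_morph. Qed.

Lemma rmorph_div_form h t H : phi (div_form h t H) =
  div_form (fun i j k => phi (h i j k)) (fun a b c d => phi (t a b c d))
    (fun m a b c d => phi (H m a b c d)).
Proof.
rewrite /div_form /hdt /htt /dshape /normsq4 /=; push_morph; rewrite ?rmorph_str1 ?rmorph_shape //.
Qed.

Lemma rmorph_harmonic3 h : harmonic3 h -> harmonic3 (fun i j k => phi (h i j k)).
Proof.
case=> h1 h2 h3; split=> [i j k|i j k|i]; [by rewrite h1|by rewrite h2|].
by rewrite -rmorph_sum3 h3 rmorph0.
Qed.

Lemma rmorph_harmonic4 t : harmonic4 t ->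
  harmonic4 (fun i j k l => phi (t i j k l)).
Proof.
case=> h1 h2 h3 h4; split=> [i j k l|i j k l|i j k l|i j]; first by rewrite h1.
- by rewrite h2.
- by rewrite h3.
by rewrite -rmorph_sum3 h4 rmorph0.
Qed.

(** Passing to [- tau] turns the torsion term into the shape required by the pointwise bound; the
    curvature is unchanged, as it contains only the square. *)
Lemma rmorph_ricci h t H tau :
  (forall m l a b c, H m a b c l - H l a b c m =
     curv_act tau h m l a b c + 2 * - tau * (\sig_p eps3 A m l p * t a b c p)) ->
  forall m l a b c, phi (H m a b c l) - phi (H l a b c m) =
     curv_act (phi (- tau)) (fun i j k => phi (h i j k)) m l a b c
     + 2 * phi (- tau) * (\sig_p eps3 B m l p * phi (t a b c p)).
Proof.
move=> ric m l a b c; rewrite -rmorphB ric rmorphD rmorph_curv_act.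
rewrite !rmorphM rmorph_nat rmorph_sum3; congr (_ + _ * _).
  by rewrite /curv_act /curv rmorphN sqrrN.
by apply: eq_sum3 => p; rewrite rmorphM rmorph_eps3.
Qed.

End Morphism.

Section PointwiseBound.
Variable R : realFieldType.
Implicit Types h : 'I_3 -> 'I_3 -> 'I_3 -> R.

Lemma str1_ge0 h : 0 <= str1 h.
Proof. by do 3 (apply: sum3_ge0 => ?); rewrite -expr2 sqr_ge0. Qed.

Lemma str1_eq0 h : str1 h = 0 -> h = fun _ _ _ => 0.
Proof.
have sum0 (f : 'I_3 -> R) : (forall i, 0 <= f i) -> sum3 f = 0 -> forall i, f i = 0.
  move=> f0 s0; have [] := (f0 i0, f0 i1, f0 i2) => [[a0 a1] a2].
  by move: s0; rewrite /sum3 => s0; refine (ord3P _ _ _); lra.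
move=> s0; apply/funext => a; apply/funext => c; apply/funext => d; apply/eqP.
rewrite -sqrf_eq0 expr2; apply/eqP.
have sq i j : 0 <= \sig_d h i j d * h i j d.
  by apply: sum3_ge0 => ?; rewrite -expr2 sqr_ge0.
have e1 : \sig_c \sig_d h a c d * h a c d = 0.
  by apply: (sum0 (fun a => shape h a a) _ s0 a) => i; exact: sum3_ge0.
have e2 : \sig_d h a c d * h a c d = 0 by exact: (sum0 _ (sq a) e1 c).
by apply: (sum0 (fun d => h a c d * h a c d) _ e2 d) => i; rewrite -expr2 sqr_ge0.
Qed.

Definition simons_bound (s q r : R) : R :=
  if 0 < s then - (11 / 36) * s ^+ 3 + 55 / 36 * (s * q) - 3 * r
    + 5 / 24 * s ^+ 2 + 25 / 24 * q + (25 * r) / (16 * s)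
  else 0.

(** For s > 0 this is [div_form_lower_bound] divided by 36. Where s = 0 the whole of h vanishes and
    both sides are 0, in agreement with the convention for F. *)
Lemma pointwise_bound h t H tau : 16 * tau ^+ 2 = 1 ->
  harmonic3 h -> harmonic4 t -> (forall m, harmonic4 (H m)) ->
  (forall m l a b c, H m a b c l - H l a b c m =
     curv_act tau h m l a b c + 2 * tau * (\sig_p eps3 R m l p * t a b c p)) ->
  13 / 180 * (\sig_i (2 * hdt h t i) ^+ 2) + 1 / 180 * (str1 h * normsq4 t)
    + simons_bound (str1 h) (str2 h) (str3 h) <= 1 / 36 * div_form h t H.
Proof.
move=> tau2 h3 t4 H4 ric; rewrite /simons_bound; case: ltP => s0.
  have := div_form_lower_bound tau2 h3 t4 H4 ric s0; rewrite /=.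
  set d := div_form _ _ _; set B := 1 / 180 * _; set X := _ + _ + 25 * _ / _.
  by rewrite /sum3 => le; lra.
have s00 : str1 h = 0 by apply/eqP; rewrite eq_le s0 str1_ge0.
have hE := str1_eq0 s00; rewrite s00 {h3 ric s0 s00}hE.
rewrite /div_form /str1 /hdt /htt /dshape /shape /sum3; lra.
Qed.

End PointwiseBound.

Section Traces.
Variables (A : comNzRingType) (h hc : 'I_3 -> 'I_3 -> 'I_3 -> A).
Hypothesis h_harmonic : harmonic3 h.
Hypothesis hcE : forall i j k, hc i j k = h i j k.
Let M : 'M[A]_3 := \matrix_(i, j) \sum_a \sum_b hc a b i * hc a b j.

Let ME i j : M i j = shape h i j.
Proof.
rewrite mxE sum3E; apply: eq_sum3 => a; rewrite sum3E; apply: eq_sum3 => b.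
by have [h12 h23 _] := h_harmonic; rewrite !hcE !(h23 a b) !(h12 a).
Qed.

Lemma shape_trace1 : \tr M = str1 h.
Proof. by rewrite /mxtrace sum3E; apply: eq_sum3 => a. Qed.

Lemma shape_trace2 : \tr (M ^+ 2) = str2 h.
Proof.
rewrite /mxtrace sum3E expr2; apply: eq_sum3 => a; rewrite mxE sum3E.
by apply: eq_sum3 => b; rewrite !ME.
Qed.

Lemma shape_trace3 : \tr (M ^+ 3) = str3 h.
Proof.
rewrite /mxtrace sum3E exprS expr2; apply: eq_sum3 => a; rewrite mxE sum3E.
apply: eq_sum3 => b; rewrite [(M *m M) _ _]mxE sum3E -sum3Ml; apply: eq_sum3 => c.
by rewrite !ME mulrA.
Qed.

End Traces.

Lemma normsq4_rotate (A : comNzRingType) (t : 'I_3 -> 'I_3 -> 'I_3 -> 'I_3 -> A) tc :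
  (forall l i j k, tc l i j k = t i j k l) ->
  \sum_l \sum_i \sum_j \sum_k tc l i j k ^+ 2 = normsq4 t.
Proof.
move=> tE; transitivity (\sig_l \sig_i \sig_j \sig_k t i j k l ^+ 2).
  by do 4 (rewrite sum3E; apply: eq_sum3 => ?); rewrite tE.
by rewrite /normsq4 /sum3; ring.
Qed.

Section ChartScalars.
Variables (R : realType) (U : domain3 R) (F : 'rV[R]_3 -> 'rV[R]_7)
  (e : 'I_3 -> 'rV[R]_3 -> 'rV[R]_3).
Hypothesis F_smooth : smooth_on U F.
Hypothesis F_sphere : forall u, dset U u -> dot (F u) (F u) = 1.
Hypothesis e_frame : orthonormal_frame F U e.
Hypothesis F_lagrangian : forall u v w, dset U u ->
  dot (cross (F u) ('D_v F u)) ('D_w F u) = 0.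
Local Notation A := (sfun U).

Let D := chart_der e_frame.
Let Fs := chart_pos F_smooth.
Let E := frame_vec F_smooth e_frame.
Let N i := cross7 Fs (E i).
Let p := @pder R U.
Let P := der7 p.
Let ec := frame_coef e_frame.
Let g := frame_dual F_smooth e_frame.
Let D_add := chart_derD e_frame.
Let D_mul := chart_derM e_frame.
Let dFF := chart_FF F_smooth F_sphere.
Let dEE := chart_EE F_smooth e_frame.
Let dEN := chart_EN F_smooth e_frame F_lagrangian.
Let D_beta := chart_bracket F_smooth e_frame.
Let tw := chart_twelfth U.
Let twE := chart_twelfthE U.
Let DF l : der7 D l Fs = E l := erefl.

Let G := conn7 D E.
Let h := sff7 D Fs E.
Let t := cov7 D Fs E tw.

Lemma hcomp_rep i j k : repS (hcomp F e i j k) (h i j k).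
Proof.
have := rep_dot (sff_rep F_smooth F_sphere e_frame F_lagrangian
   (repX_frame e i) (repX_frame e j))
  (Jpush_rep F_smooth e_frame (repX_frame e k)).
rewrite (_ : dot7 _ _ = h i j k) // [lin7 (fun i => kron A k i) _]sum3_kronZ.
rewrite (frame_NN_lin D_add D_mul dFF DF dEE twE).
exact: bil3_kron.
Qed.

Lemma Tcomp_rep l i j k : repS (Tcomp F e l i j k) (t i j k l).
Proof.
have := rep_dot (Ttensor_rep F_smooth F_sphere e_frame F_lagrangian
   (repX_frame e l) (repX_frame e i) (repX_frame e j))
  (Jpush_rep F_smooth e_frame (repX_frame e k)).
rewrite (_ : dot7 _ _ = t i j k l) // [lin7 (fun i => kron A k i) _]sum3_kronZ.
rewrite (frame_NN_lin D_add D_mul dFF DF dEE twE).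
exact: (tri3_kron (fun l i j k => t i j k l)).
Qed.

Lemma grad_rep (phi : 'rV[R]_3 -> R) a u : dset U u -> repS phi a ->
  let grad := sharp F u (\row_l 'D_(coordv R l) (phi : _ -> R^o) u) in
  dot ('D_grad F u) ('D_grad F u) = \sig_i D i a u ^+ 2.
Proof.
move=> Uu pa grad; pose X u := sharp F u (\row_l 'D_(coordv R l) (phi : _ -> R^o) u).
have Xx : repX e X (fun k => D k a).
  move=> v Uv; rewrite /X (sharpE F_smooth e_frame) //; apply: eq_sum3 => k.
  congr (_ *: _); rewrite sum3E /D /chart_der /fder sfun_sum3 //; apply: eq_sum3 => l.
  rewrite mxE sfunM // mulrC; congr (_ * _); first by apply/esym/cutE.
  exact: (repS_coord_dir F_smooth e_frame l pa).
have pX := rep_push F_smooth e_frame Xx.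
have := rep_dot pX pX Uu; rewrite dot7_orthonormal // => ->.
by rewrite sfun_sum3 //; apply: eq_sum3 => k; rewrite expr2 -sfunM.
Qed.

Section AtPoint.
Variables (u : 'rV[R]_3) (Uu : dset U u).
Local Notation ev := (@eval_at R U (exist _ u Uu)).
Let hu i j k := h i j k u.
Let tu i j k l := t i j k l u.

Let hu_harmonic : harmonic3 hu.
Proof.
apply: (rmorph_harmonic3 ev).
exact: (sff7_harmonic D_add D_mul D_beta dFF DF dEE dEN twE).
Qed.

Let hcE i j k : hcomp F e i j k u = hu i j k.
Proof. exact: (hcomp_rep i j k Uu). Qed.

Lemma Smat_trace1 : \tr (Smat F e u) = str1 hu.
Proof. exact: (shape_trace1 hu_harmonic hcE). Qed.

Lemma Smat_trace2 : \tr (Smat F e u ^+ 2) = str2 hu.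
Proof. exact: (shape_trace2 hu_harmonic hcE). Qed.

Lemma Smat_trace3 : \tr (Smat F e u ^+ 3) = str3 hu.
Proof. exact: (shape_trace3 hu_harmonic hcE). Qed.

Lemma Tcomp_normsq :
  \sum_l \sum_i \sum_j \sum_k Tcomp F e l i j k u ^+ 2 = normsq4 tu.
Proof. by apply: (normsq4_rotate (t := tu)) => l i j k; exact: (Tcomp_rep l i j k Uu). Qed.

Lemma chart_bound (phi : 'rV[R]_3 -> R) : repS phi (str1 h) ->
  let grad := sharp F u (\row_l 'D_(coordv R l) (phi : _ -> R^o) u) in
  let s := \tr (Smat F e u) in
  13 / 180 * dot ('D_grad F u) ('D_grad F u)
  + 1 / 180 * (s * \sum_l \sum_i \sum_j \sum_k Tcomp F e l i j k u ^+ 2)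
  + Ffun s (\tr (Smat F e u ^+ 2)) (\tr (Smat F e u ^+ 3)) <=
  1 / 36 * div_form h t (cov27 D Fs E tw) u.
Proof.
move=> phis.
have dsE i : D i (str1 h) = 2 * hdt h t i.
  apply: (der_str1 D_add D_mul h (tau7 Fs E tw)).
  exact: (conn7_skew D_add D_mul dEE twE).
cbv zeta; rewrite Smat_trace1 Smat_trace2 Smat_trace3 Tcomp_normsq.
rewrite (grad_rep Uu phis).
set dv := (X in _ <= _ * X).
have -> : dv = ev (div_form h t (cov27 D Fs E tw)) by [].
rewrite rmorph_div_form {dv}.
apply: le_trans (pointwise_bound (tau := ev (- tau7 Fs E tw)) _ hu_harmonic _ _ _).
- rewrite le_eqVlt; apply/orP; left; apply/eqP; congr (_ * _ + _ + _).
  apply: eq_sum3 => i; congr (_ ^+ 2).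
  rewrite dsE.
  rewrite sfunM // -[X in X * _]/(ev 2) rmorph_nat; congr (_ * _).
  by rewrite -/(ev (hdt _ _ _)) /hdt; do 3 (rewrite rmorph_sum3; apply: eq_sum3 => ?);
    rewrite rmorphM.
- have := congr1 ev (tau7_sq D_add D_mul D_beta dFF DF dEE dEN twE).
  by rewrite rmorphM rmorphXn rmorph_nat rmorph1 rmorphN sqrrN.
- by apply: (rmorph_harmonic4 ev); exact: (cov7_harmonic D_add D_mul D_beta dFF DF dEE dEN twE).
- by move=> m; apply: (rmorph_harmonic4 ev);
    exact: (cov27_harmonic D_add D_mul D_beta dFF DF dEE dEN twE).
apply: (@rmorph_ricci _ _ ev h t (cov27 D Fs E tw) (tau7 Fs E tw)).
exact: (cov7_ricci D_add D_mul D_beta dFF DF dEE dEN twE).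
Qed.

End AtPoint.
End ChartScalars.

(** * Integrals of compactly supported partial derivatives on R^3 *)

Section VanishingFubini.
Local Open Scope ereal_scope.
Context (R : realType) d1 d2 (T1 : measurableType d1) (T2 : measurableType d2).
Variables (m1 : {sigma_finite_measure set T1 -> \bar R})
  (m2 : {sigma_finite_measure set T2 -> \bar R}).

Lemma integral_prod2_last (f : T1 * T2 -> \bar R) : (m1 \x m2).-integrable setT f ->
  (forall x, \int[m2]_y f (x, y) = 0) -> \int[m1 \x m2]_w f w = 0.
Proof.
move=> ih h0; rewrite -integral12_prod_meas1 //.
by rewrite (eq_integral (cst 0%E)) ?integral0 // => x _; exact: h0.
Qed.

Lemma integral_prod2_first (f : T1 * T2 -> \bar R) : (m1 \x m2).-integrable setT f ->
  (forall y, \int[m1]_x f (x, y) = 0) -> \int[m1 \x m2]_w f w = 0.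
Proof.
move=> ih h0; rewrite -integral21_prod_meas1 //.
by rewrite (eq_integral (cst 0%E)) ?integral0 // => x _; exact: h0.
Qed.

End VanishingFubini.

Section VanishingFubini3.
Local Open Scope ereal_scope.
Context (R : realType) d1 d2 d3 (T1 : measurableType d1) (T2 : measurableType d2)
  (T3 : measurableType d3).
Variables (m1 : {sigma_finite_measure set T1 -> \bar R})
  (m2 : {sigma_finite_measure set T2 -> \bar R})
  (m3 : {sigma_finite_measure set T3 -> \bar R}).

(* The instance of the library on m1 \x m2 itself is only found for
   subprobabilities. *)
Let m12 : set (T1 * T2) -> \bar R := m1 \x m2.

HB.instance Definition _ := Measure.on m12.

Let m12_sigma_finite : sigma_finite setT m12.
Proof.
have /sigma_finiteP[F [TF ndF Foo]] := sigma_finiteT m1.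
have /sigma_finiteP[G [TG ndG Goo]] := sigma_finiteT m2.
exists (fun n => F n `*` G n) => [|k].
  apply/seteqP; split=> [[x y] _|//].
  have [[n _ Fnx] [k _ Gky]] : (\bigcup_n F n) x /\ (\bigcup_n G n) y by rewrite -TF -TG.
  exists (maxn n k) => //; split.
    by move: x Fnx; exact/subsetPset/ndF/leq_maxl.
  by move: y Gky; exact/subsetPset/ndG/leq_maxr.
have [mF Fk] := Foo k; have [mG Gk] := Goo k; split; first exact: measurableX.
by rewrite /m12 product_measure1E // lte_mul_pinfty // ge0_fin_numE.
Qed.

HB.instance Definition _ := Measure_isSigmaFinite.Build _ _ _ m12 m12_sigma_finite.

Variable f : T1 * T2 * T3 -> \bar R.
Hypothesis f_integrable : (m12 \x m3).-integrable setT f.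
Hypothesis slice_integrable : forall z, (m1 \x m2).-integrable setT (fun w => f (w, z)).

Lemma integral_prod3_last : (forall x y, \int[m3]_z f (x, y, z) = 0) ->
  \int[m12 \x m3]_w f w = 0.
Proof. by move=> f0; apply: integral_prod2_last => // -[x y]. Qed.

Lemma integral_prod3_mid : (forall x z, \int[m2]_y f (x, y, z) = 0) ->
  \int[m12 \x m3]_w f w = 0.
Proof.
move=> f0; apply: integral_prod2_first => // z.
by apply: (integral_prod2_last (slice_integrable z)) => x; exact: f0.
Qed.

Lemma integral_prod3_first : (forall y z, \int[m1]_x f (x, y, z) = 0) ->
  \int[m12 \x m3]_w f w = 0.
Proof.
move=> f0; apply: integral_prod2_first => // z.
by apply: (integral_prod2_first (slice_integrable z)) => y; exact: f0.
Qed.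

End VanishingFubini3.

Section EuclideanIntegral.
Variable R : realType.
Local Notation leb := (@lebesgue_measure R).

(** Lebesgue measure lives on the product sigma-algebra of triples, openness on row vectors. An open
    set is a countable union of boxes with rational centre and size, which are measurable on the
    product side. *)
Lemma open_measurable3 (O : set 'rV[R]_3) : open O -> measurable (@row3 R @^-1` O).
Proof.
move=> Oo.
pose box (q : rat * rat * rat * rat) : set (R * R * R) :=
  (ball (ratr q.1.1.1 : R) (ratr q.2) `*` ball (ratr q.1.1.2 : R) (ratr q.2))
  `*` ball (ratr q.1.2 : R) (ratr q.2).
have -> : @row3 R @^-1` O = \bigcup_q (if `[< box q `<=` @row3 R @^-1` O >] then box q else set0).
  apply/seteqP; split=> [x Ox|x [q _]]; last by case: asboolP => // qO /qO.
  have [r r0 rO] : exists2 r : R, 0 < r & ball (row3 x) r `<=` O.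
    by have /nbhs_ballP[r r0 rO] := open_nbhs_nbhs (conj Oo Ox); exists r.
  have [d] := @rat_in_itvoo R 0 (r / 2) ltac:(by rewrite divr_gt0).
  rewrite in_itv /= => /andP[d0 dr].
  have near_rat (y : R) : exists a : rat, ball (ratr a : R) (ratr d) y.
    have [a] := @rat_in_itvoo R (y - ratr d) (y + ratr d) ltac:(by lra).
    by rewrite in_itv /= => /andP[ya ay]; exists a; rewrite /ball /= ltr_norml; lra.
  have [a xa] := near_rat x.1.1; have [b xb] := near_rat x.1.2.
  have [c xc] := near_rat x.2.
  exists (a, b, c, d) => //; case: asboolP => [_|]; first by split=> //; split.
  case=> y [[/= ya yb] yc]; apply: rO; split=> // i j; rewrite !mxE.
  have near2 (q : rat) (u v : R) : ball (ratr q : R) (ratr d) u ->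
      ball (ratr q : R) (ratr d) v -> ball u r v.
    by rewrite /ball /= !ltr_norml => *; lra.
  by move: j; refine (ord3P _ _ _) => /=; [exact: near2 xa ya|exact: near2 xb yb|exact: near2 xc yc].
apply: countable_bigcupT_measurable => [|q]; first exact: countableP.
case: ifP => // _.
by apply: measurableX; [apply: measurableX|]; exact: measurable_ball.
Qed.

Lemma measurable_fun_open d (T : measurableType d) (D : set T) (f : T -> R) :
  (forall O, open O -> measurable (D `&` f @^-1` O)) -> measurable_fun D f.
Proof.
move=> fO; apply: (measurability (@RGenOpens.G R)); first exact: RGenOpens.measurableE.
by move=> _ [_ [a [b ->]] <-]; apply: fO; exact: itv_open.
Qed.

Lemma continuous_measurable3 (f : 'rV[R]_3 -> R) : continuous f ->
  measurable_fun [set: R * R * R] (f \o @row3 R).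
Proof.
move=> fc; apply: measurable_fun_open => O Oo; rewrite setTI.
by apply: (@open_measurable3 (f @^-1` O)); apply: open_comp => // x _; exact: fc.
Qed.

Lemma bounded_support_integrable d (T : measurableType d)
    (mu : {measure set T -> \bar R}) (f : T -> R) (B : set T) (C : R) :
  measurable B -> (mu B < +oo)%E -> measurable_fun setT f ->
  (forall x, `|f x| <= C) -> (forall x, ~ B x -> f x = 0) ->
  mu.-integrable setT (EFin \o f).
Proof.
move=> mB Bfin mf fC f0.
rewrite (_ : EFin \o f = (EFin \o f) \_ B).
  apply: (iffLR (integrable_mkcond _ mB)); apply: measurable_bounded_integrable => //.
    exact: measurable_funTS.
  exists C; split; first by rewrite num_real.
  by move=> M CM x _ /=; exact: le_trans (fC x) (ltW CM).
apply/funext => x; rewrite /patch; case: ifPn => // /negP; rewrite inE => /f0 fx.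
by rewrite /= fx.
Qed.

Lemma integral_derive_line (L : R) (F f : R -> R) : 0 < L ->
  (forall x : R, is_derive x 1 (F : R -> R^o) (f x)) -> continuous f ->
  (forall x, L <= `|x| -> F x = 0 /\ f x = 0) ->
  (\int[leb]_x (f x)%:E = 0)%E.
Proof.
move=> L0 dF fc FL.
have [FL1 _] := FL L ltac:(by rewrite ger0_norm // ltW).
have [FL2 _] := FL (- L) ltac:(by rewrite normrN ger0_norm // ltW).
have cF x : {for x, continuous F}.
  by apply: differentiable_continuous; apply/derivable1_diffP; have [] := dF x.
transitivity (\int[leb]_(x in `[(- L)%R, L]) (f x)%:E)%E.
  rewrite integral_mkcond [RHS]integral_mkcond; apply: eq_integral => x _.
  rewrite /patch in_setT; case: ifPn => // /negP; rewrite inE /= in_itv /= => xL.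
  have [|_ -> //] := FL x; rewrite leNgt; apply/negP; rewrite ltr_norml => /andP[? ?].
  by apply: xL; rewrite !ltW.
rewrite (continuous_FTC2 (F := F)) ?FL1 ?FL2 ?subee //; first by lra.
- by apply: continuous_subspaceT => x; exact: fc.
- split; first by move=> x _; have [] := dF x.
    exact: cvg_at_right_filter (cF _).
  exact: cvg_at_left_filter (cF _).
by move=> x _; rewrite derive1E; have [_ ->] := dF x.
Qed.

Definition slot (i : 'I_3) (w : R * R * R) (t : R) : R * R * R :=
  match i : nat with 0%N => (t, w.1.2, w.2) | 1%N => (w.1.1, t, w.2)
        | _ => (w.1.1, w.1.2, t) end.

Lemma row3_slot i w t : row3 (slot i w t) = t *: coordv R i + row3 (slot i w 0).
Proof.
by move: i; refine (ord3P _ _ _); apply/rowP; refine (ord3P _ _ _);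
  rewrite !mxE /= ?mulr0 ?mulr1 ?addr0 ?add0r.
Qed.

Lemma row3_slot_entry i w t : row3 (slot i w t) 0 i = t.
Proof. by move: i; refine (ord3P _ _ _); rewrite mxE. Qed.

Section Divergence.
Variables (F : 'rV[R]_3 -> R) (i : 'I_3) (L C : R).
Let f (x : 'rV[R]_3) : R := 'D_(coordv R i) (F : _ -> R^o) x.
Hypothesis L0 : 0 < L.
Hypothesis F_derivable : forall x : 'rV[R]_3, derivable (F : _ -> R^o) x (coordv R i).
Hypothesis f_continuous : continuous f.
Hypothesis f_bounded : forall x : 'rV[R]_3, `|f x| <= C.
Hypothesis F_support : forall (x : 'rV[R]_3) j, L <= `|x 0 j| -> F x = 0 /\ f x = 0.

Let mf : measurable_fun [set: R * R * R] (f \o @row3 R).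
Proof. exact: continuous_measurable3. Qed.

Let line0 w : (\int[leb]_t (f (row3 (slot i w t)))%:E = 0)%E.
Proof.
apply: (integral_derive_line (F := fun t => F (row3 (slot i w t))) L0) => [t||t Lt].
- have e : (fun t => F (row3 (slot i w t))) =
      (fun t => F (t *: coordv R i + row3 (slot i w 0))).
    by apply/funext => z; rewrite row3_slot.
  by rewrite e (row3_slot i w t); exact: derivable_line (@F_derivable _).
- move=> t; apply: continuous_comp; last exact: f_continuous.
  rewrite (_ : (fun t => _) = (fun t => t *: coordv R i + row3 (slot i w 0))).
    by apply: cvgD; [exact: scalel_continuous|exact: cvg_cst].
  by apply/funext => z; rewrite row3_slot.
by apply: (F_support (j := i)); rewrite row3_slot_entry.
Qed.

Let K : set R := `[- L, L]%classic.

Let mK : measurable K.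
Proof. exact: measurable_itv. Qed.

Let fin_itv : (leb K < +oo)%E.
Proof. by rewrite lebesgue_measure_itv /=; case: ifP => // _; rewrite -EFinB ltry. Qed.

Let finK : leb K \is a fin_num.
Proof. by rewrite ge0_fin_numE. Qed.

Let supp1 x : ~ K x -> L <= `|x|.
Proof.
move=> xL; rewrite leNgt; apply/negP; rewrite ltr_norml => /andP[? ?].
by apply: xL; rewrite /K /= in_itv /= !ltW.
Qed.

Let plane_integrable z : (leb \x leb)%E.-integrable setT
  (fun w => (f (row3 (w, z)))%:E).
Proof.
have bsi := @bounded_support_integrable _ _ (leb \x leb)%E (fun w => f (row3 (w, z))) (K `*` K) C; apply: bsi.
- exact: measurableX.
- rewrite [X in (X < _)%E](_ : _ = (leb K * leb K)%E); last exact: product_measure1E.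
  by rewrite ltey_eq fin_numM ?finK.
- by apply: (measurableT_comp mf); exact: measurable_pair2.
- by move=> x; exact: f_bounded.
move=> x /not_andP[] /supp1 xL.
  by have [] := @F_support (row3 (x, z)) i0 ltac:(by rewrite mxE /=; exact: xL).
by have [] := @F_support (row3 (x, z)) i1 ltac:(by rewrite mxE /=; exact: xL).
Qed.

Let space_integrable : ((leb \x leb) \x leb)%E.-integrable setT (fun w => (f (row3 w))%:E).
Proof.
have bsi := @bounded_support_integrable _ _ (@lebesgue3 R) (fun w => f (row3 w)) ((K `*` K) `*` K) C; apply: bsi.
- by do 2 apply: measurableX => //.
- rewrite [X in (X < _)%E](_ : _ = ((leb K * leb K) * leb K)%E).
    by rewrite ltey_eq !fin_numM ?finK.
  transitivity ((leb \x leb)%E (K `*` K) * leb K)%E.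
    by apply: product_measure1E => //; exact: measurableX.
  by congr (_ * _)%E; exact: product_measure1E.
- exact: mf.
- by move=> x; exact: f_bounded.
move=> [[x y] z] /not_andP[/not_andP[]|] /supp1 xL.
- by have [] := @F_support (row3 (x, y, z)) i0 ltac:(by rewrite mxE /=; exact: xL).
- by have [] := @F_support (row3 (x, y, z)) i1 ltac:(by rewrite mxE /=; exact: xL).
by have [] := @F_support (row3 (x, y, z)) i2 ltac:(by rewrite mxE /=; exact: xL).
Qed.

Lemma integrable_partial_derivative :
  (@lebesgue3 R).-integrable setT (fun w => (f (row3 w))%:E).
Proof. exact: space_integrable. Qed.

(** By Fubini the integral in the direction i of differentiation can be isolated; it vanishes on
    every line by the fundamental theorem of calculus. The cases differ in how many times the
    product measure has to be split. *)
Lemma integral_partial_derivative : (\int[@lebesgue3 R]_w (f (row3 w))%:E = 0)%E.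
Proof.
have [iE|[iE|iE]] : i = i2 \/ i = i1 \/ i = i0.
- by clear; move: i; refine (ord3P _ _ _); [right; right|right; left|left].
- apply: (@integral_prod3_last _ _ _ _ _ _ _ leb leb leb _ space_integrable).
  by move=> x y; have := line0 (x, y, 0); rewrite /slot iE.
- apply: (@integral_prod3_mid _ _ _ _ _ _ _ leb leb leb _ space_integrable plane_integrable).
  by move=> x z; have := line0 (x, 0, z); rewrite /slot iE.
apply: (@integral_prod3_first _ _ _ _ _ _ _ leb leb leb _ space_integrable plane_integrable).
by move=> y z; have := line0 (0, y, z); rewrite /slot iE.
Qed.

End Divergence.
End EuclideanIntegral.

(** * Functions of class C^1 for the partition of unity *)

Section C1.
Variables (R : realType) (V : normedModType R) (U : set V).
Hypothesis Uo : open U.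

Lemma Ck1_comp1 (q : V -> R^o) (m m' : R -> R) : Ck_on 1 U q ->
  (forall x, U x -> is_derive (q x : R) 1 (m : R -> R^o) (m' (q x))) ->
  (forall x, U x -> {for (q x : R), continuous m'}) ->
  Ck_on 1 U (fun x => m (q x) : R^o).
Proof.
move=> [dq Dq] dm cm'.
have diffm x : U x -> differentiable (m : R -> R^o) (q x).
  by move=> Ux; apply/derivable1_diffP; have [] := dm x Ux.
split=> [x Ux|v]; first exact: (differentiable_comp (dq x Ux) (diffm x Ux)).
apply: (@Ck_on_eq _ _ _ _ _ (fun x => m' (q x) * 'D_v q x : R^o)) => //.
  move=> x Ux; rewrite (deriveE _ (differentiable_comp (dq x Ux) (diffm x Ux))).
  rewrite diff_comp; [|exact: dq|exact: diffm].
  rewrite /= -(deriveE _ (dq x Ux)); have [_ mE] := dm x Ux.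
  rewrite -mE (deriveE _ (diffm x Ux)).
  rewrite -{2}['D_v q x]mulr1 -[_ * 1]/('D_v q x *: (1 : R^o)) linearZ.
  by rewrite /GRing.scale /= mulrC.
move=> x Ux; apply: cvgM; last exact: (Dq v x Ux).
apply: (@continuous_comp _ _ _ q m'); last exact: cm'.
by apply: differentiable_continuous; exact: dq.
Qed.

Lemma Ck1_inv (q : V -> R^o) : (forall x, U x -> q x != 0) -> Ck_on 1 U q ->
  Ck_on 1 U (fun x => (q x)^-1 : R^o).
Proof.
move=> q0 Cq; apply: (@Ck1_comp1 q (fun y => y^-1) (fun y => - y ^- 2)) => // x Ux.
  by have := is_deriveV (f := id) (q0 x Ux) (is_derive_id (q x : R^o) 1);
     rewrite /GRing.scale /= mulr1.
apply: cvgN; apply: cvgV; first by rewrite expf_neq0 // q0.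
exact: exprn_continuous.
Qed.

(** Only first derivatives of the partition of unity occur, so a bump of class C^1 is enough, and
    the square of the positive part is the simplest one. *)
Definition sqpos (y : R) : R := Num.max 0 y ^+ 2.

Lemma sqpos_ge0 y : 0 <= sqpos y.
Proof. exact: sqr_ge0. Qed.

Lemma sqpos_gt0 y : 0 < sqpos y = (0 < y).
Proof.
rewrite /sqpos; case: (ltP 0 y) => y0; first by rewrite exprn_gt0.
by rewrite expr0n /= ltxx.
Qed.

(** The error of the linear approximation is at most h^2 for either sign of y and of y + h, so the
    difference quotient is within |h| of the limit. *)
Lemma sqpos_derive (y : R) : is_derive y 1 (sqpos : R -> R^o) (2 * Num.max 0 y).
Proof.
have cv : (fun h : R => h^-1 *: ((sqpos \o shift y) (h *: (1 : R)) - sqpos y : R^o))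
    @ 0^' --> (2 * Num.max 0 y : R^o).
  apply/cvgrPdist_le => e e0; near=> h.
  have h0 : h != 0 by near: h; exact: nbhs_dnbhs_neq.
  have he : `|h| <= e by near: h; apply: dnbhs0_le.
  apply: le_trans he.
  have -> : h *: (1 : R) = h by rewrite /GRing.scale /= mulr1.
  rewrite /GRing.scale /= /shift; set X := sqpos (h + y) - sqpos y.
  have -> : 2 * Num.max 0 y - h^-1 * X = - (h^-1 * (X - 2 * Num.max 0 y * h)).
    by field.
  rewrite normrN normrM normfV ler_pdivrMl ?normr_gt0 // -expr2 -normrX.
  rewrite [X in _ <= X]ger0_norm ?sqr_ge0 // ler_norml /X /sqpos.
  have [y0|y0] := ltP 0 y; have [hy|hy] := ltP 0 (h + y);
    by apply/andP; split; nra.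
exact: DeriveDef (cvgP _ cv) (cvg_lim _ cv).
Unshelve. all: by end_near. Qed.

Lemma Ck1_sqpos (q : V -> R^o) : Ck_on 1 U q -> Ck_on 1 U (fun x => sqpos (q x) : R^o).
Proof.
move=> Cq; apply: (@Ck1_comp1 q sqpos (fun y => 2 * Num.max 0 y)) => // x Ux.
  exact: sqpos_derive.
apply: cvgM; first exact: cvg_cst.
apply: (@continuous_max _ _ (cst 0) id); [exact: cvg_cst|exact: cvg_id].
Qed.

End C1.

(** * Transfer of integrals to a chart along a density *)

Section DensityTransfer.
Local Open Scope ereal_scope.
Import HBNNSimple.
Context d d' (X : measurableType d) (Y : measurableType d') (R : realType).
Variables (lam : {measure set X -> \bar R}) (mu : {measure set Y -> \bar R}).
Variables (D : set X) (C : set Y) (psi : X -> Y) (J : X -> R).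
Hypotheses (mD : measurable D) (mC : measurable C) (mpsi : measurable_fun D psi)
  (psiC : forall x, D x -> C (psi x))
  (mJ : measurable_fun D J) (J0 : forall x, (0 <= J x)%R).
Hypothesis mu_density : forall B, measurable B -> B `<=` C ->
  mu B = \int[lam]_(x in D `&` psi @^-1` B) (J x)%:E.

Let mcomp (h : Y -> R) : measurable_fun setT h -> measurable_fun D (fun x => h (psi x)).
Proof. by move=> mh; exact: (measurable_comp measurableT (@subsetT _ _) mh mpsi). Qed.

Let term_eq (h : {nnsfun Y >-> R}) : \int[mu]_(y in C) (h y)%:E =
  \int[lam]_(x in D) ((h (psi x))%:E * (J x)%:E).
Proof.
have mA k : measurable (h @^-1` [set k]) by exact: measurable_sfunP.
have mDA k : measurable (D `&` psi @^-1` (h @^-1` [set k])) by exact: mpsi.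
have k0 k : range h k -> (0 <= k)%R by move=> [y _ <-].
transitivity (\sum_(k \in range h) k%:E * mu (C `&` h @^-1` [set k])).
  under eq_integral do rewrite fimfunE -fsumEFin //.
  rewrite ge0_integral_fsum //; last 2 first.
  - by move=> y; exact/measurable_EFinP/measurable_funM.
  - by move=> y x _; rewrite nnfun_muleindic_ge0.
  apply: eq_fsbigr => r _; rewrite integralZl_indic_nnsfun // integral_indic //.
  by rewrite setIC.
transitivity (\sum_(k \in range h) \int[lam]_(x in D)
    (k%:E * ((\1_(h @^-1` [set k]) (psi x))%:E * (J x)%:E))); last first.
  rewrite -ge0_integral_fsum //; last 2 first.
  - move=> k; apply: emeasurable_funM; first exact: measurable_cst.
    apply: emeasurable_funM; last exact/measurable_EFinP; apply/measurable_EFinP.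
    exact: mcomp.
  - move=> k x Dx; have [[y _ <-]|nk] := pselect (range h k).
      by rewrite !mule_ge0 // lee_fin.
    rewrite indicE memNset ?mul0e ?mule0 // => hk; apply: nk.
    by exists (psi x).
  apply: eq_integral => x _.
  transitivity (\sum_(k \in range h) (k * \1_(h @^-1` [set k]) (psi x))%:E * (J x)%:E).
    by apply: eq_fsbigr => k _; rewrite EFinM muleA.
  rewrite -ge0_mule_fsuml; last by move=> k; rewrite nnfun_muleindic_ge0.
  by rewrite fsumEFin // -fimfunE.
apply: eq_fsbigr => k; rewrite inE => /k0 k_ge0.
rewrite ge0_integralZl //; last 2 first.
- apply: emeasurable_funM; last exact/measurable_EFinP; apply/measurable_EFinP.
  exact: mcomp.
- by move=> x Dx; rewrite mule_ge0 // lee_fin.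
congr (_ * _); rewrite mu_density; last 2 first.
- exact: measurableI.
- exact: subIsetl.
rewrite (_ : D `&` psi @^-1` (C `&` _) = D `&` psi @^-1` (h @^-1` [set k])); last first.
  by apply/seteqP; split=> x [Dx] /=; [case|move=> hx; split => //; split => //; exact: psiC].
rewrite integral_mkcondr; apply: eq_integral => x _; rewrite /patch indicE.
case: ifPn => xk; first by rewrite mem_set ?mul1e //; move: xk; rewrite inE.
by rewrite memNset ?mul0e //; move/negP: xk; rewrite inE.
Qed.

(** The density is given on sets only; it passes to simple functions by [term_eq] and to nonnegative
    functions by monotone convergence. *)
Lemma ge0_integral_density (g : Y -> \bar R) : measurable_fun setT g ->
  (forall y, 0 <= g y) ->
  \int[mu]_(y in C) g y = \int[lam]_(x in D) (g (psi x) * (J x)%:E).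
Proof.
move=> mg g0; pose f_ := nnsfun_approx measurableT mg.
transitivity (limn (fun n => \int[mu]_(y in C) (f_ n y)%:E)).
  rewrite -monotone_convergence //.
  - apply: eq_integral => y _; apply/esym/cvg_lim => //.
    by apply: cvg_nnsfun_approx => //.
  - by move=> n; apply/measurable_EFinP; exact: measurable_funTS.
  - by move=> n y _; rewrite lee_fin.
  - by move=> y _ m n mn; rewrite lee_fin; exact/lefP/nd_nnsfun_approx.
rewrite [X in limn X](_ : _ = (fun n => \int[lam]_(x in D) ((f_ n (psi x))%:E * (J x)%:E)));
  last by apply/funext => n; exact: term_eq.
rewrite -monotone_convergence //; last 3 first.
- move=> n; apply: emeasurable_funM; last exact/measurable_EFinP; apply/measurable_EFinP.
  exact: mcomp.
- by move=> n x _; rewrite mule_ge0 // lee_fin.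
- move=> x _ m n mn; rewrite -!EFinM lee_fin ler_wpM2r //; exact/lefP/nd_nnsfun_approx.
apply: eq_integral => x Dx; apply/cvg_lim => //.
have fg : (f_ n (psi x))%:E @[n --> \oo] --> g (psi x) by exact: cvg_nnsfun_approx.
exact: cvgeZr.
Qed.

End DensityTransfer.

Lemma rmorph_act3_eq0 (A B : comNzRingType) (phi : {rmorphism A -> B}) w h a b k :
  (forall x y z, phi (h x y z) = 0) -> phi (act3 w h a b k) = 0.
Proof.
move=> h0; rewrite /act3 rmorph_sum3 /sum3 !rmorphD !rmorphM !h0.
by rewrite !mulr0 !addr0.
Qed.

Lemma sum3_eq0 (R : realFieldType) (F : 'I_3 -> R) : (forall i, 0 <= F i) -> sum3 F = 0 ->
  forall i, F i = 0.
Proof.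
by move=> F0; have := F0 i0; have := F0 i1; have := F0 i2; rewrite /sum3 => ? ? ? ?;
  refine (ord3P _ _ _); lra.
Qed.

Lemma normsq4_ge0 (R : realFieldType) (t : 'I_3 -> 'I_3 -> 'I_3 -> 'I_3 -> R) : 0 <= normsq4 t.
Proof. by rewrite /normsq4; do 4 apply: sum3_ge0 => ?; exact: sqr_ge0. Qed.

Lemma normsq4_eq0 (R : realFieldType) (t : 'I_3 -> 'I_3 -> 'I_3 -> 'I_3 -> R) :
  normsq4 t = 0 -> forall a b c d, t a b c d = 0.
Proof.
move=> t0 a b c d; apply/eqP; rewrite -sqrf_eq0; apply/eqP; move: d; apply: sum3_eq0.
  by move=> i; exact: sqr_ge0.
move: c; apply: sum3_eq0; first by move=> ?; apply: sum3_ge0 => ?; exact: sqr_ge0.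
move: b; apply: sum3_eq0; first by move=> ?; do 2 apply: sum3_ge0 => ?; exact: sqr_ge0.
move: a; apply: sum3_eq0; first by move=> ?; do 3 apply: sum3_ge0 => ?; exact: sqr_ge0.
exact: t0.
Qed.

Lemma ge0_integral_mono d (T : measurableType d) (R : realType) (mu : {measure set T -> \bar R})
  (f1 f2 : T -> \bar R) : (forall x, 0 <= f1 x)%E -> (forall x, f1 x <= f2 x)%E ->
  (\int[mu]_x f1 x <= \int[mu]_x f2 x)%E.
Proof.
move=> f0 f12; rewrite !ge0_integralTE //; last by move=> x; exact: le_trans (f12 x).
by apply: le_ereal_sup => _ [h hf <-]; exists h => // x; exact: le_trans (hf x) (f12 x).
Qed.

(* The integral of a nonnegative function is a supremum over the simple functions
   below it, hence monotone even on nonmeasurable functions. *)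
Lemma integral_mono d (T : measurableType d) (R : realType) (mu : {measure set T -> \bar R})
  (f1 f2 : T -> R) : (forall x, f1 x <= f2 x) ->
  (\int[mu]_x (f1 x)%:E <= \int[mu]_x (f2 x)%:E)%E.
Proof.
move=> f12; rewrite integralE [leRHS]integralE; apply: leeB; apply: ge0_integral_mono => x.
- exact: funepos_ge0.
- by rewrite !funepos.unlock -!EFin_max lee_fin ge_max !le_max f12 lexx orbT.
- exact: funeneg_ge0.
by rewrite !funeneg.unlock -!EFinN -!EFin_max lee_fin ge_max !le_max lerN2 f12 lexx orbT.
Qed.

Lemma sqr_lt_itv (R : realFieldType) (a r : R) : 0 < r -> a * a < r * r -> - r <= a <= r.
Proof.
move=> r0 ar; apply/andP; split; rewrite leNgt; apply/negP => h.
  have h2 : 0 < - r - a by lra.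
  by have := mulr_gt0 h2 h2; have := mulr_gt0 h2 r0; lra.
have h2 : 0 < a - r by lra.
by have := mulr_gt0 h2 h2; have := mulr_gt0 h2 r0; lra.
Qed.

Lemma lin3_exchange (R : comNzRingType) n (a : 'I_3 -> R) (G : 'I_3 -> 'I_3 -> R)
  (w : 'I_3 -> 'rV[R]_n) :
  \sig_l a l *: (\sig_b G l b *: w b) = \sig_b (\sig_l a l * G l b) *: w b.
Proof. by apply/rowP => y; rewrite /sum3 !mxE; ring. Qed.

Lemma lin7_tri3_eq0 (A : comNzRingType) (b : 'I_3 -> 'I_3 -> 'I_3 -> 'I_3 -> A) x y z v :
  (forall l i j k, b l i j k = 0) -> lin7 (tri3 b x y z) v = 0.
Proof. by move=> b0; rewrite /lin7 /tri3 /sum3 !b0 !mulr0 !addr0 !scale0r !addr0. Qed.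

Local Notation coord := Defs.coord (only parsing).

Record pointed_chart (R : realType) (M : topologicalType) (At : atlas3 R M) :=
  PointedChart { pchart : chart At; pbase : 'rV[R]_3; pbaseP : dom pchart pbase }.

Definition cdom (R : realType) (M : topologicalType) (At : atlas3 R M)
  (c : pointed_chart At) : domain3 R := Domain3 (@dom_open _ _ At (pchart c)) (pbaseP c).

Lemma dot_eq0 (R : realType) n (x : 'rV[R]_n) : dot x x = 0 -> x = 0.
Proof.
rewrite /dot => x0; apply/rowP => j; rewrite mxE; apply/eqP; rewrite -sqrf_eq0 expr2.
have := @psumr_eq0P _ _ xpredT (fun i => x 0 i * x 0 i) _ x0 j isT => -> //.
by move=> i _; rewrite -expr2 sqr_ge0.
Qed.

Lemma sfun_nat (R : realType) (U : domain3 R) n x : dset U x -> (n%:R : sfun U) x = n%:R.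
Proof. by move=> Ux; exact: (rmorph_nat (@eval_at R U (exist _ x Ux)) n). Qed.

Lemma lin3_entry (R : realType) n (a : 'I_3 -> R) (v : 'I_3 -> 'rV[R]_n) x :
  (\sig_i a i *: v i) 0 x = \sig_i a i * v i 0 x.
Proof. by rewrite /sum3 !mxE. Qed.

Lemma dotBl (R : realType) n (x y z : 'rV[R]_n) : dot (x - y) z = dot x z - dot y z.
Proof. by rewrite /dot -sumrB; apply: eq_bigr => i _; rewrite !mxE mulrBl. Qed.

Lemma derive_sum3 (R : realType) (V W : normedModType R) (g : V -> W) x a v :
  differentiable g x -> 'D_(\sig_i a i *: v i) g x = \sig_i a i *: 'D_(v i) g x.
Proof. by move=> dg; rewrite !deriveE // /sum3 !linearD !linearZ !deriveE. Qed.

(** * Global gradients and the ambient field on the manifold *)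

Section Global.
Variables (R : realType) (M : ptopologicalType) (At : atlas3 R M) (f : M -> 'rV[R]_7).
Hypothesis f_imm : immersion_in_S6 At f.
Hypothesis f_lag : lagrangian At f.
Variable e : chart At -> 'I_3 -> 'rV[R]_3 -> 'rV[R]_3.
Hypothesis e_frames : orthonormal_frames f e.
Implicit Types (c : pointed_chart At) (phi psi : M -> R).

Let F (c : chart At) := f \o param c.

Lemma chart_smooth c : smooth_on (cdom c) (F (pchart c)).
Proof. by case: f_imm => _ fs _; exact: fs. Qed.

Lemma chart_sphere c u : dset (cdom c) u -> dot (F (pchart c) u) (F (pchart c) u) = 1.
Proof. by move=> _; case: f_imm => fs _ _; exact: fs. Qed.

Lemma chart_frame c : orthonormal_frame (F (pchart c)) (cdom c) (e (pchart c)).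
Proof. exact: e_frames. Qed.

Lemma chart_lagrangian c u v w : dset (cdom c) u ->
  dot (cross (F (pchart c) u) ('D_v (F (pchart c)) u)) ('D_w (F (pchart c)) u) = 0.
Proof.
move=> Uu; have : [set cross (f (param (pchart c) u)) ('D_v (f \o param (pchart c)) u) | v in setT]
    (cross (F (pchart c) u) ('D_v (F (pchart c)) u)) by exists v.
by rewrite (f_lag Uu) => -[_]; exact.
Qed.

Definition cder c := chart_der (chart_frame c).
Definition cpos c := chart_pos (@chart_smooth c).
Definition cvec c := frame_vec (@chart_smooth c) (chart_frame c).
Definition csff c := sff7 (@cder c) (cpos c) (cvec c).
Definition ccov c := cov7 (@cder c) (cpos c) (cvec c) (chart_twelfth (cdom c)).
Definition ccov2 c := cov27 (@cder c) (cpos c) (cvec c) (chart_twelfth (cdom c)).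
Definition cgrad c x := tgrad (@cder c) (cvec c) x.

Definition grad_at (c : chart At) u phi : 'rV[R]_7 :=
  \sig_i 'D_(e c i u) (phi \o param c : _ -> R^o) u *: 'D_(e c i u) (F c) u.

Lemma grad_atE (c : chart At) u phi x : grad_at c u phi 0 x =
  \sig_i 'D_(e c i u) (phi \o param c : _ -> R^o) u * 'D_(e c i u) (F c) u 0 x.
Proof. exact: lin3_entry. Qed.

Lemma frame_basis (c : chart At) u v : dom c u ->
  exists a : 'I_3 -> R, v = \sig_i a i *: e c i u.
Proof.
move=> Uu; pose pc := PointedChart Uu.
have [G GE] : exists G : 'I_3 -> 'I_3 -> R,
    forall l, delta_mx 0 l = \sig_a G l a *: e c a u.
  exists (fun l a => frame_dual (@chart_smooth pc) (chart_frame pc) l a u) => l.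
  exact: (repX_coord (@chart_smooth pc) (chart_frame pc) l Uu).
exists (fun a => \sig_l v 0 l * G l a); rewrite [LHS](row_sum_delta v) sum3E.
rewrite (eq_sum3 (G := fun l => v 0 l *: \sig_a G l a *: e c a u)); last by move=> l; rewrite GE.
by apply/rowP => x; rewrite /sum3 !mxE; ring.
Qed.

Let diffF (c : chart At) u : dom c u -> differentiable (F c) u.
Proof. by case: f_imm => _ fs _ Uu; have [df _] := fs c 1%N; exact: df. Qed.

Let frame_dot (c : chart At) u i j : dom c u ->
  dot7 ('D_(e c i u) (F c) u) ('D_(e c j u) (F c) u) = kron R i j.
Proof.
move=> Uu; have [_ eE] := e_frames c; rewrite -dot_dot7 [LHS](eE i j u Uu).
by move: i j; do 2 (refine (ord3P _ _ _)).
Qed.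

Lemma grad_at_dot (c : chart At) u phi v : dom c u ->
  differentiable (phi \o param c : _ -> R^o) u ->
  dot (grad_at c u phi) ('D_v (F c) u) = 'D_v (phi \o param c : _ -> R^o) u.
Proof.
move=> Uu dphi; have [a ->] := frame_basis v Uu.
rewrite !derive_sum3 //; last exact: diffF.
pose b i := 'D_(e c i u) (phi \o param c : _ -> R^o) u.
transitivity (dot7 (lin7 b (fun i => 'D_(e c i u) (F c) u))
  (lin7 a (fun i => 'D_(e c i u) (F c) u))) => //.
rewrite dot7_orthonormal; last by move=> i j; exact: frame_dot.
by apply: eq_sum3 => i; rewrite mulrC.
Qed.

Lemma overlap_open (c c' : chart At) : open (dom c `&` param c @^-1` cod c').
Proof.
rewrite openE => u [Uu Cu]; apply: filterI.
  exact: (open_nbhs_nbhs (conj (@dom_open _ _ At c) Uu)).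
exact: (param_continuous Uu (open_nbhs_nbhs (conj (@cod_open _ _ At c') Cu))).
Qed.

Lemma derive_transition (c c' : chart At) u phi v : dom c u -> cod c' (param c u) ->
  differentiable (phi \o param c' : _ -> R^o) (coord c' (param c u)) ->
  'D_v (phi \o param c : _ -> R^o) u =
  'D_('D_v (coord c' \o param c) u) (phi \o param c' : _ -> R^o) (coord c' (param c u)).
Proof.
move=> Uu Cu dphi.
have dt : differentiable (coord c' \o param c) u.
  by have [dt _] := transition_smooth c c' 1%N; exact: dt.
transitivity ('D_v ((phi \o param c' : _ -> R^o) \o (coord c' \o param c)) u).
  apply: near_eq_derive.
  apply: (@open_near_eq _ _ _ (dom c `&` param c @^-1` cod c')); [exact: overlap_open|by []|].
  by move=> w [Uw Cw]; rewrite /= coordK.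
by rewrite derive_comp // derive_coord // sum3E.
Qed.

(** Both candidates are tangent vectors, and by the chain rule they have the same product with every
    tangent vector. Their difference is therefore orthogonal to itself. *)
Lemma grad_at_indep (c c' : chart At) u u' phi : dom c u -> dom c' u' ->
  param c u = param c' u' -> differentiable (phi \o param c : _ -> R^o) u ->
  differentiable (phi \o param c' : _ -> R^o) u' -> grad_at c u phi = grad_at c' u' phi.
Proof.
move=> Uu Uu' pE dphi dphi'.
have Cu : cod c' (param c u) by rewrite pE; exact: param_cod.
have Cu' : cod c (param c' u') by rewrite -pE; exact: param_cod.
have uE : coord c' (param c u) = u' by rewrite pE paramK.
have uE' : coord c (param c' u') = u by rewrite -pE paramK.
have T' v : 'D_v (phi \o param c' : _ -> R^o) u' =
    'D_('D_v (coord c \o param c') u') (phi \o param c : _ -> R^o) u.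
  by have := @derive_transition c' c u' phi v Uu' Cu'; rewrite uE'; apply.
have TF (a b : chart At) w w' v : dom a w -> dom b w' -> cod b (param a w) ->
    coord b (param a w) = w' ->
    'D_v (F a) w = 'D_('D_v (coord b \o param a) w) (F b) w'.
  move=> Uw Uw' Cw wE; apply/rowP => x; rewrite !derive_entry; [|exact: diffF..].
  have := @derive_transition a b w (fun p => f p 0 x) v Uw Cw.
  rewrite wE; apply; exact: (differentiable_entry x (diffF Uw')).
pose t := coord c' \o param c; pose t' := coord c \o param c'.
have V1 : grad_at c u phi =
    'D_('D_(\sig_i 'D_(e c i u) (phi \o param c : _ -> R^o) u *: e c i u) t u) (F c') u'.
  by rewrite -(TF _ _ _ _ _ Uu Uu' Cu uE) derive_sum3 //; exact: diffF.
have V2 : grad_at c' u' phi =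
    'D_(\sig_i 'D_(e c' i u') (phi \o param c' : _ -> R^o) u' *: e c' i u') (F c') u'.
  by rewrite derive_sum3 //; exact: diffF.
have orth y : dot (grad_at c u phi - grad_at c' u' phi) ('D_y (F c') u') = 0.
  apply: etrans (dotBl _ _ _) _; apply/eqP; rewrite subr_eq0; apply/eqP.
  apply: etrans _ (esym (grad_at_dot y Uu' dphi')).
  apply: etrans (congr1 (dot _) (TF _ _ _ _ y Uu' Uu Cu' uE')) _.
  by apply: etrans (grad_at_dot _ Uu dphi) _; exact: esym (T' y).
pose w := grad_at c u phi - grad_at c' u' phi.
apply/eqP; rewrite -subr_eq0; apply/eqP; apply: dot_eq0; rewrite -/w.
have wE : w = 'D_('D_(\sig_i 'D_(e c i u) (phi \o param c : _ -> R^o) u *: e c i u) t u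
    - \sig_i 'D_(e c' i u') (phi \o param c' : _ -> R^o) u' *: e c' i u') (F c') u'.
  by rewrite /w V1 V2 !(deriveE _ (diffF Uu')) linearB.
by rewrite {2}wE.
Qed.

(** The value is read in the chart chosen at p; by [gradM_chart] any other chart gives the same
    result when phi is differentiable in charts. *)
Definition gradM (x : 'I_7) phi : M -> R := fun p =>
  grad_at (chart_at At p) (coord (chart_at At p) p) phi 0 x.

Lemma gradM_chart (c : chart At) u phi x : dom c u ->
  (forall (c' : chart At) u', dom c' u' -> differentiable (phi \o param c' : _ -> R^o) u') ->
  gradM x phi (param c u) = grad_at c u phi 0 x.
Proof.
move=> Uu dphi; have Cp := chart_atP At (param c u); have Du := coord_dom Cp.
have pE : param c u = param (chart_at At (param c u)) (coord (chart_at At (param c u)) (param c u)).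
  exact: esym (coordK Cp).
by rewrite /gradM -(grad_at_indep Uu Du pE (dphi _ _ Uu) (dphi _ _ Du)).
Qed.

(** Lets the ambient expressions be formed once on M, with [gradM] as their derivations, and be
    evaluated in the ring of every chart. *)
Definition represents phi (a : forall c, sfun (cdom c)) : Prop :=
  forall c, repS (phi \o param (pchart c)) (a c).

Lemma represents_differentiable phi a (c : chart At) u : represents phi a ->
  dom c u -> differentiable (phi \o param c : _ -> R^o) u.
Proof.
move=> pa Uu; pose pc := PointedChart Uu.
apply: (near_eq_differentiable (f := a pc : _ -> R^o)).
  by apply: (@sfun_near _ (cdom pc)) => // y Uy; rewrite -(pa pc y Uy).
by have [da _] := @sf_smooth _ _ (a pc) 1%N; exact: da.
Qed.

Lemma represents_grad phi a x : represents phi a ->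
  represents (gradM x phi) (fun c => cgrad x (a c)).
Proof.
move=> pa c u Uu; apply: etrans (gradM_chart x Uu _) _.
  by move=> c' u'; exact: represents_differentiable pa.
rewrite grad_atE; apply: etrans (esym (sfun_sum3 _ Uu)); apply: eq_sum3 => i.
have dE : 'D_(e (pchart c) i u) (phi \o param (pchart c) : _ -> R^o) u = cder i (a c) u.
  have := repS_dir (chart_frame c) (repX_frame (e (pchart c)) i) (pa c) Uu.
  by move=> ->; congr (sf _ u); exact: (sum3_kronl (fun j => cder j (a c))).
have vE : 'D_(e (pchart c) i u) (F (pchart c)) u 0 x = cvec c i 0 x u.
  exact: (rep_frame (@chart_smooth c) (chart_frame c) i).
by rewrite dE vE mulrC; apply: esym; exact: sfunM.
Qed.

Lemma representsD phi psi a b : represents phi a -> represents psi b ->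
  represents (phi + psi) (fun c => a c + b c).
Proof. by move=> pa pb c u Uu; rewrite sfunD // -pa // -pb. Qed.

Lemma representsM phi psi a b : represents phi a -> represents psi b ->
  represents (phi * psi) (fun c => a c * b c).
Proof. by move=> pa pb c u Uu; rewrite sfunM // -pa // -pb. Qed.

Lemma representsN phi a : represents phi a -> represents (- phi) (fun c => - a c).
Proof. by move=> pa c u Uu; rewrite sfunN // -pa. Qed.

Lemma represents0 : represents 0 (fun c => 0).
Proof. by move=> c u Uu; rewrite sfun0. Qed.

Lemma represents1 : represents 1 (fun c => 1).
Proof. by move=> c u Uu; rewrite sfun1. Qed.

Lemma represents_nat n : represents n%:R (fun c => n%:R).
Proof.
elim: n => [|n IH]; first exact: represents0.
rewrite (_ : (fun c => n.+1%:R) = (fun c => 1 + n%:R)); last first.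
  by apply: functional_extensionality_dep => c; rewrite mulrS.
by rewrite mulrS; apply: representsD => //; exact: represents1.
Qed.

Lemma represents_sum (I : Type) (r : seq I) (phi : I -> M -> R) a :
  (forall i, represents (phi i) (fun c => a c i)) ->
  represents (\sum_(i <- r) phi i) (fun c => \sum_(i <- r) a c i).
Proof.
move=> pa; elim: r => [|i r IH].
  rewrite big_nil (_ : (fun c => _) = (fun c => 0)); first exact: represents0.
  by apply: functional_extensionality_dep => c; rewrite big_nil.
rewrite big_cons (_ : (fun c => _) = (fun c => a c i + \sum_(i <- r) a c i)).
  exact: representsD.
by apply: functional_extensionality_dep => c; rewrite big_cons.
Qed.

Let fM (a : 'I_7) : M -> R := fun p => f p 0 a.

Lemma represents_pos a : represents (fM a) (fun c => cpos c 0 a).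
Proof. by move=> c u Uu; exact: (rep_pos (@chart_smooth c)). Qed.

Lemma represents_fano (x y : 'I_7 -> M -> R) x' y' i :
  (forall j, represents (x j) (fun c => x' c j)) ->
  (forall j, represents (y j) (fun c => y' c j)) ->
  represents (fano x y i) (fun c => fano (x' c) (y' c) i).
Proof.
move=> xx yy; move: i; refine (ord7P _ _ _ _ _ _ _); rewrite /fano /=;
by repeat first [apply: representsD | apply: representsN | apply: representsM | exact: xx | exact: yy].
Qed.

Ltac represent := repeat first [exact: represents_pos | apply: representsD
  | apply: representsN | apply: representsM | exact: represents_nat
  | apply: represents_fano => ? | apply: represents_grad
  | (apply: represents_sum => ?)].

Lemma represents_sff x y z : represents (amb_sff gradM fM x y z)
  (fun c => amb_sff (@cgrad c) (cpos c 0) x y z).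
Proof. by rewrite /amb_sff /amb_normal /amb_proj; represent. Qed.

Lemma represents_shape y z : represents (amb_shape gradM fM y z)
  (fun c => amb_shape (@cgrad c) (cpos c 0) y z).
Proof. by rewrite /amb_shape; represent; exact: represents_sff. Qed.

Lemma represents_s : represents (amb_s gradM fM) (fun c => amb_s (@cgrad c) (cpos c 0)).
Proof. by rewrite /amb_s; represent; exact: represents_shape. Qed.

Lemma represents_q : represents (amb_q gradM fM) (fun c => amb_q (@cgrad c) (cpos c 0)).
Proof. by rewrite /amb_q; represent; exact: represents_shape. Qed.

Lemma represents_r : represents (amb_r gradM fM) (fun c => amb_r (@cgrad c) (cpos c 0)).
Proof. rewrite /amb_r; do 3 (apply: represents_sum => ?).
by apply: representsM; [apply: representsM|]; exact: represents_shape. Qed.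

Lemma represents_field x : represents (amb_field gradM fM x)
  (fun c => amb_field (@cgrad c) (cpos c 0) x).
Proof.
rewrite /amb_field /amb_last; repeat first [exact: represents_s | exact: represents_q
  | exact: represents_shape | exact: represents_sff | exact: represents_nat
  | apply: represents_grad | apply: representsD | apply: representsN
  | apply: representsM | (apply: represents_sum => ?)].
Qed.

Lemma represents_div : represents (amb_div gradM fM)
  (fun c => amb_div (@cgrad c) (cpos c 0)).
Proof.
rewrite /amb_div; apply: represents_sum => x.
by apply: represents_grad; exact: represents_field.
Qed.

Let cDadd c l x y : @cder c l (x + y) = cder l x + cder l y.
Proof. exact: (chart_derD (chart_frame c)). Qed.
Let cDmul c l x y : @cder c l (x * y) = cder l x * y + x * cder l y.
Proof. exact: (chart_derM (chart_frame c)). Qed.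
Let cbeta c := chart_bracket (@chart_smooth c) (chart_frame c).
Let cFF c := chart_FF (@chart_smooth c) (@chart_sphere c).
Let cDF c l : der7 (@cder c) l (cpos c) = cvec c l := erefl.
Let cEE c := chart_EE (@chart_smooth c) (chart_frame c).
Let cEN c := chart_EN (@chart_smooth c) (chart_frame c) (@chart_lagrangian c).
Let ctw c := chart_twelfthE (cdom c).

Ltac frame_facts c := first [exact: (@cDadd c) | exact: (@cDmul c) | exact: (@cbeta c)
  | exact: (@cFF c) | exact: (@cDF c) | exact: (@cEE c) | exact: (@cEN c) | exact: (@ctw c)].

Lemma div_chart c : amb_div (@cgrad c) (cpos c 0) =
  2 * div_form (csff c) (ccov c) (ccov2 c).
Proof. by eapply amb_div_frame; frame_facts c. Qed.

Lemma s_chart c : amb_s (@cgrad c) (cpos c 0) = str1 (csff c).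
Proof. by eapply amb_s_frame; frame_facts c. Qed.

Lemma q_chart c : amb_q (@cgrad c) (cpos c 0) = str2 (csff c).
Proof. by eapply amb_q_frame; frame_facts c. Qed.

Lemma r_chart c : amb_r (@cgrad c) (cpos c 0) = str3 (csff c).
Proof.
apply: (amb_r_frame (@cEE c)) => y z.
by eapply amb_shape_frame; frame_facts c.
Qed.

Definition div_field : M -> R := amb_div gradM fM.

Lemma div_fieldE c u : dset (cdom c) u ->
  div_field (param (pchart c) u) = 2 * div_form (csff c) (ccov c) (ccov2 c) u.
Proof.
move=> Uu; apply: etrans (represents_div Uu) _; rewrite div_chart sfunM //.
by rewrite sfun_nat.
Qed.

Let sfunE c u (Uu : dset (cdom c) u) (x : sfun (cdom c)) :
  x u = @eval_at R (cdom c) (exist _ u Uu) x := erefl.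

Let smat (c : chart At) u := Smat (F c) (e c) u.

Lemma smat_trace1 c u : dset (cdom c) u ->
  \tr (smat (pchart c) u) = amb_s gradM fM (param (pchart c) u).
Proof.
move=> Uu; apply: etrans (esym (represents_s Uu)); rewrite s_chart (sfunE Uu) rmorph_str1.
exact: (Smat_trace1 (@chart_smooth c) (@chart_sphere c) (chart_frame c) (@chart_lagrangian c) Uu).
Qed.

Lemma smat_trace2 c u : dset (cdom c) u ->
  \tr (smat (pchart c) u ^+ 2) = amb_q gradM fM (param (pchart c) u).
Proof.
move=> Uu; apply: etrans (esym (represents_q Uu)); rewrite q_chart (sfunE Uu) rmorph_str2.
exact: (Smat_trace2 (@chart_smooth c) (@chart_sphere c) (chart_frame c) (@chart_lagrangian c) Uu).
Qed.

Lemma smat_trace3 c u : dset (cdom c) u ->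
  \tr (smat (pchart c) u ^+ 3) = amb_r gradM fM (param (pchart c) u).
Proof.
move=> Uu; apply: etrans (esym (represents_r Uu)); rewrite r_chart (sfunE Uu) rmorph_str3.
exact: (Smat_trace3 (@chart_smooth c) (@chart_sphere c) (chart_frame c) (@chart_lagrangian c) Uu).
Qed.

Let pAt p := PointedChart (coord_dom (chart_atP At p)).

Let pAtK p : param (pchart (pAt p)) (coord (chart_at At p) p) = p.
Proof. exact: (coordK (chart_atP At p)). Qed.

Lemma s_fun_amb : s_fun f e = amb_s gradM fM.
Proof.
apply/funext => p; apply: etrans (smat_trace1 (c := pAt p) (coord_dom (chart_atP At p))) _.
by rewrite pAtK.
Qed.

Lemma q_fun_amb : q_fun f e = amb_q gradM fM.
Proof.
apply/funext => p; apply: etrans (smat_trace2 (c := pAt p) (coord_dom (chart_atP At p))) _.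
by rewrite pAtK.
Qed.

Lemma r_fun_amb : r_fun f e = amb_r gradM fM.
Proof.
apply/funext => p; apply: etrans (smat_trace3 (c := pAt p) (coord_dom (chart_atP At p))) _.
by rewrite pAtK.
Qed.

Lemma s_fun_chart c : repS (s_fun f e \o param (pchart c)) (str1 (csff c)).
Proof. by move=> u Uu; rewrite s_fun_amb -s_chart; exact: represents_s. Qed.

(** Holds in an arbitrary chart around the point, not only in the one chosen there, and keeps only
    the sign of the gradient term. This form allows h and T to be followed on a neighbourhood within
    one frame. *)
Lemma chart_le c u (p := param (pchart c) u) : dset (cdom c) u ->
  exists2 g, 0 <= g & 13 / 180 * g + 1 / 180 * (s_fun f e p *
    \sum_l \sum_i \sum_j \sum_k Tcomp (F (pchart c)) (e (pchart c)) l i j k u ^+ 2)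
  + Ffun (s_fun f e p) (q_fun f e p) (r_fun f e p) <= 1 / 72 * div_field p.
Proof.
move=> Uu; have := chart_bound (F_smooth := @chart_smooth c) (e_frame := chart_frame c)
  (@chart_sphere c) (@chart_lagrangian c) Uu (@s_fun_chart c).
cbv zeta; rewrite [\tr (Smat _ _ _)](smat_trace1 Uu) [\tr (Smat _ _ _ ^+ 2)](smat_trace2 Uu).
rewrite [\tr (Smat _ _ _ ^+ 3)](smat_trace3 Uu) s_fun_amb q_fun_amb r_fun_amb.
set g := dot _ _ => le; exists g.
  by rewrite /g /dot; apply: sumr_ge0 => i _; rewrite -expr2 sqr_ge0.
apply: le_trans le _; rewrite /p div_fieldE //.
have half (d : R) : 1 / 36 * d = 1 / 72 * (2 * d) by field.
by rewrite -half; exact: lexx.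
Qed.

Lemma integrand_le p : 13 / 180 * grad_normsq At f (s_fun f e) p
  + 1 / 180 * (s_fun f e p * T_normsq f e p)
  + Ffun (s_fun f e p) (q_fun f e p) (r_fun f e p) <= 1 / 72 * div_field p.
Proof.
have Uu := coord_dom (chart_atP At p); pose c := pAt p.
have := chart_bound (F_smooth := @chart_smooth c) (e_frame := chart_frame c)
  (@chart_sphere c) (@chart_lagrangian c) Uu (@s_fun_chart c).
move=> le; apply: le_trans le _; have := div_fieldE (c := c) Uu; rewrite pAtK => ->.
have half (d : R) : 1 / 36 * d = 1 / 72 * (2 * d) by field.
by rewrite -half; exact: lexx.
Qed.

(** * Volume density and flux in charts *)

Definition cdens c : sfun (cdom c) := det3 (frame_dual (@chart_smooth c) (chart_frame c)).

Lemma cdens_neq0 c u : dset (cdom c) u -> cdens c u != 0.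
Proof.
have d0 : det3 (frame_coef (chart_frame c)) * cdens c = 1 by exact: (det3_coframe (@cEE c)).
move=> Uu; have d1 : (det3 (frame_coef (chart_frame c)) * cdens c) u = (1 : sfun (cdom c)) u.
  by rewrite d0.
move: d1; rewrite sfunM // sfun1 // => d1; apply/eqP => dz.
by move: d1; rewrite dz mulr0 => /eqP; rewrite eq_sym oner_eq0.
Qed.

(** The metric is G G^T with G the matrix of the coframe. The signed density [cdens] is kept besides
    its absolute value because it lies in the ring and can be differentiated there. *)
Lemma volume_density c u : dset (cdom c) u ->
  Num.sqrt (\det (metric (F (pchart c)) u)) = `|cdens c u|.
Proof.
move=> Uu; pose g := frame_dual (@chart_smooth c) (chart_frame c).
pose G : 'M[R]_3 := \matrix_(i, a) g i a u.
have -> : metric (F (pchart c)) u = G *m G^T.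
  apply/matrixP => i j; rewrite !mxE sum3E.
  have rd k := rep_coord_dir (@chart_smooth c) (chart_frame c) k (rep_pos (@chart_smooth c)).
  apply: etrans (rep_dot (rd i) (rd j) Uu) _.
  rewrite (metric_coframe (@cEE c)) sfun_sum3 //; apply: eq_sum3 => a.
  by rewrite sfunM // !mxE.
rewrite det_mulmx det_tr -expr2 sqrtr_sqr det3_matrix; congr `|_|.
rewrite /cdens (sfunE Uu) rmorph_det3; congr det3.
by apply/funext => i; apply/funext => a; rewrite mxE.
Qed.

Definition cfield c : 'I_3 -> sfun (cdom c) := coord_vector (frame_coef (chart_frame c))
  (fun i => 2 * simons_field (@cder c) (conn7 (@cder c) (cvec c)) (csff c)
    (tau7 (cpos c) (cvec c) (chart_twelfth (cdom c))) i).

Lemma field_chart c x : amb_field (@cgrad c) (cpos c 0) x =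
  comb (cvec c) (fun i => 2 * simons_field (@cder c) (conn7 (@cder c) (cvec c)) (csff c)
    (tau7 (cpos c) (cvec c) (chart_twelfth (cdom c))) i) x.
Proof. by eapply amb_field_frame; frame_facts c. Qed.

Lemma divergence_chart c : \sig_j pder j (cdens c * @cfield c j) =
  cdens c * amb_div (@cgrad c) (cpos c 0).
Proof.
rewrite /amb_div (funext (@field_chart c)).
exact: (divergence_coord (@pder_add R (cdom c)) (@pder_mul R (cdom c))
  (@pder_comm R (cdom c)) (@cEE c) (@ctw c)).
Qed.

Definition along_field phi : M -> R := fun p => \sum_x amb_field gradM fM x p * gradM x phi p.

Lemma along_field_chart c u phi : dset (cdom c) u ->
  (forall (c' : chart At) u', dom c' u' -> differentiable (phi \o param c' : _ -> R^o) u') ->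
  along_field phi (param (pchart c) u) =
  \sig_j @cfield c j u * 'D_(coordv R j) (phi \o param (pchart c) : _ -> R^o) u.
Proof.
move=> Uu dphi; pose w i := (2 * simons_field (@cder c) (conn7 (@cder c) (cvec c)) (csff c)
    (tau7 (cpos c) (cvec c) (chart_twelfth (cdom c))) i) u.
pose v := \sig_i w i *: e (pchart c) i u.
have wE x : amb_field gradM fM x (param (pchart c) u) = 'D_v (F (pchart c)) u 0 x.
  apply: etrans (represents_field x Uu) _; rewrite field_chart.
  apply: etrans (sfun_sum3 _ Uu) _; rewrite /v derive_sum3; last exact: diffF.
  apply: etrans _ (esym (lin3_entry _ _ _)); apply: eq_sum3 => i.
  apply: etrans (sfunM _ _ Uu) _; congr (_ * _).
  exact: esym (rep_frame (@chart_smooth c) (chart_frame c) i x Uu).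
transitivity (dot (grad_at (pchart c) u phi) ('D_v (F (pchart c)) u)).
  by apply: eq_bigr => x _; rewrite wE (gradM_chart x Uu dphi) mulrC.
rewrite (grad_at_dot v Uu (dphi _ _ Uu)) (derive_coord _ (dphi _ _ Uu)).
apply: eq_sum3 => j; congr (_ * _).
apply: etrans (lin3_entry _ _ _) _; apply: etrans _ (esym (sfun_sum3 _ Uu)).
apply: eq_sum3 => i; apply: etrans _ (esym (sfunM _ _ Uu)); congr (_ * _).
by apply: esym; apply: cutE.
Qed.

Definition C1 phi := forall c : chart At, Ck_on 1 (dom c) (phi \o param c : _ -> R^o).

Lemma C1_differentiable phi (c : chart At) u : C1 phi -> dom c u ->
  differentiable (phi \o param c : _ -> R^o) u.
Proof. by move=> Cphi Uu; have [d _] := Cphi c; exact: d. Qed.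

Lemma param_preimage_open (c : chart At) (O : set M) : open O ->
  open (dom c `&` param c @^-1` O).
Proof.
move=> Oo; rewrite openE => u [Uu Ou]; apply: filterI.
  exact: (open_nbhs_nbhs (conj (@dom_open _ _ At c) Uu)).
exact: (param_continuous Uu (open_nbhs_nbhs (conj Oo Ou))).
Qed.

Lemma continuous_charts (g : M -> R) :
  (forall (c : chart At) u, dom c u -> {for u, continuous (g \o param c)}) -> continuous g.
Proof.
move=> gc p; have Cp := chart_atP At p; set c := chart_at At p in Cp.
have cc : {for p, continuous ((g \o param c) \o coord c)}.
  by apply: continuous_comp; [exact: (Defs.coord_continuous Cp)|exact: (gc _ _ (coord_dom Cp))].
have ep : \near p, ((g \o param c) \o coord c) p = g p.
  apply: filterS (open_nbhs_nbhs (conj (@cod_open _ _ At c) Cp)) => z Cz /=.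
  by rewrite coordK.
have gp : g p = ((g \o param c) \o coord c) p by rewrite /= coordK.
by rewrite /continuous_at gp; apply: cvg_trans cc; exact: near_eq_cvg.
Qed.

Lemma measurable_continuous (g : M -> R) : continuous g ->
  measurable_fun [set: g_sigma_algebraType (@open M)] g.
Proof.
move=> gc; apply: measurable_fun_open => O Oo; rewrite setTI.
by apply: sub_sigma_algebra; apply: open_comp => // x _; exact: gc.
Qed.

(** The divergence of rho times the field, by the product rule. *)
Definition flux rho : M -> R := fun p => rho p * div_field p + along_field rho p.

Lemma flux_chart c u rho : C1 rho -> dset (cdom c) u -> flux rho (param (pchart c) u) =
  rho (param (pchart c) u) * amb_div (@cgrad c) (cpos c 0) u
  + \sig_j @cfield c j u * 'D_(coordv R j) (rho \o param (pchart c) : _ -> R^o) u.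
Proof.
move=> Crho Uu; rewrite /flux along_field_chart //; last first.
  by move=> c' u'; exact: C1_differentiable.
by congr (_ * _ + _); exact: (represents_div Uu).
Qed.

Lemma flux_continuous rho : C1 rho -> continuous (flux rho).
Proof.
move=> Crho; apply: continuous_charts => c u Uu; pose pc := PointedChart Uu.
have Uo := @dom_open _ _ At c.
have sc (a : sfun (cdom pc)) : Ck_on 0 (dom c) (a : _ -> R^o) by exact: (@sf_smooth _ _ a 0%N).
have [_ Dr] := Crho c.
suff : Ck_on 0 (dom c) (flux rho \o param c : _ -> R^o) by exact.
apply: (@Ck_on_eq _ _ _ _ _ (fun v => rho (param c v) * amb_div (@cgrad pc) (cpos pc 0) v
  + \sig_j @cfield pc j v * 'D_(coordv R j) (rho \o param c : _ -> R^o) v : R^o)) => //.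
  by move=> v Uv; apply: esym; exact: (flux_chart (c := pc) Crho Uv).
apply: (@Ck_onD _ _ R^o 0 _ (fun v => rho (param c v) * amb_div (@cgrad pc) (cpos pc 0) v)) => //.
  by apply: Ck_onM => //; exact: Ck_on0 (Crho c).
have cM j := Ck_onM Uo (sc (@cfield pc j)) (Dr (coordv R j)).
by apply: (@Ck_onD _ _ R^o 0) => //; apply: (@Ck_onD _ _ R^o 0).
Qed.

Lemma flux_off rho (O : set M) p : open O -> (forall z, O z -> rho z = 0) -> O p ->
  flux rho p = 0.
Proof.
move=> Oo rho0 Op; rewrite /flux rho0 // mul0r add0r /along_field big1 // => x _.
have Cp := chart_atP At p; have Up := coord_dom Cp.
suff -> : gradM x rho p = 0 by rewrite mulr0.
apply: etrans (grad_atE _ _ _ _) _.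
transitivity (\sig_i (fun=> 0 : R) i); last by rewrite /sum3 !addr0.
apply: eq_sum3 => i.
rewrite (near_eq_derive (g := cst 0 : _ -> R^o)); first by rewrite derive_cst mul0r.
apply: (@open_near_eq _ _ _ (dom (chart_at At p) `&` param (chart_at At p) @^-1` O)).
- exact: param_preimage_open.
- by split=> //=; rewrite coordK.
by move=> z [_ Oz]; exact: rho0.
Qed.

Variable dM : {measure set (g_sigma_algebraType (@open M)) -> \bar R}.
Hypothesis dM_volume : riemannian_volume At f dM.

Lemma density_measurable c : measurable_fun (@row3 R @^-1` dom (pchart c))
  (fun w => `|cdens c (row3 w)|).
Proof.
apply: measurable_fun_open => O Oo.
rewrite (_ : _ `&` _ = @row3 R @^-1` (dom (pchart c) `&` (fun u => `|cdens c u|) @^-1` O)) //.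
apply: open_measurable3; rewrite openE => u [Uu Ou]; apply: filterI.
  exact: (open_nbhs_nbhs (conj (@dom_open _ _ At (pchart c)) Uu)).
have cu : {for u, continuous (fun u => `|cdens c u|)}.
  apply: (@continuous_comp _ _ _ (cdens c : _ -> R^o) (fun y : R^o => `|y| : R)).
    exact: (@sf_smooth _ _ (cdens c) 0%N u Uu).
  exact: norm_continuous.
exact: (cu _ (open_nbhs_nbhs (conj Oo Ou))).
Qed.

Lemma chart_transfer c (g : M -> R) : measurable_fun [set: g_sigma_algebraType (@open M)] g ->
  (forall p, ~ cod (pchart c) p -> g p = 0) ->
  (\int[dM]_p (g p)%:E = \int[@lebesgue3 R]_(w in @row3 R @^-1` dom (pchart c))
    (g (param (pchart c) (row3 w)) * `|cdens c (row3 w)|)%:E)%E.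
Proof.
move=> mg g0; set D := _ @^-1` _.
pose C : set (g_sigma_algebraType (@open M)) := cod (pchart c).
have mD : measurable D by apply: open_measurable3; exact: dom_open.
have mC : measurable C by apply: sub_sigma_algebra; exact: cod_open.
pose psi w : g_sigma_algebraType (@open M) := param (pchart c) (row3 w).
have mpsi : measurable_fun D psi.
  apply: (@measurability _ _ _ (g_sigma_algebraType (@open M)) D psi (@open M)); first by [].
  move=> _ [B oB <-].
  rewrite (_ : D `&` _ = @row3 R @^-1` (dom (pchart c) `&` param (pchart c) @^-1` B)) //.
  by apply: open_measurable3; exact: (@param_preimage_open (pchart c) B oB).
have mJ := @density_measurable c.
have dens B : measurable B -> B `<=` C -> (dM B =
    \int[@lebesgue3 R]_(w in D `&` psi @^-1` B)
      (`|cdens c (row3 w)|)%:E)%E.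
  move=> mB BC; rewrite (dM_volume mB BC); apply: eq_integral => w.
  by rewrite inE => -[Dw _]; congr EFin; exact: volume_density.
have T (h : M -> R) : measurable_fun [set: g_sigma_algebraType (@open M)] h -> (forall p, 0 <= h p) ->
    (forall p, ~ C p -> h p = 0) -> (\int[dM]_p (h p)%:E = \int[@lebesgue3 R]_(w in D)
      (h (param (pchart c) (row3 w)) * `|cdens c (row3 w)|)%:E)%E.
  move=> mh h0 hC; transitivity (\int[dM]_(p in C) (h p)%:E)%E.
    rewrite [RHS]integral_mkcond; apply: eq_integral => p _; rewrite /patch.
    by case: ifPn => // /negP; rewrite inE => nC; rewrite hC.
  have psiC w : D w -> C (psi w) by move=> Dw; exact: param_cod.
  have J0 w : 0 <= `|cdens c (row3 w)| by [].
  have mh' : measurable_fun [set: g_sigma_algebraType (@open M)] (EFin \o h) by exact/measurable_EFinP.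
  have h0' y : (0 <= (EFin \o h) y)%E by rewrite /= lee_fin.
  have E0 := @ge0_integral_density _ _ _ _ _ (@lebesgue3 R) dM D C psi (fun w => `|cdens c (row3 w)|)
    mD mC mpsi psiC mJ J0 dens (EFin \o h) mh' h0'.
  by apply: etrans E0 _; apply: eq_integral => w _; rewrite /= EFinM.
rewrite integralE [RHS]integralE; congr (_ - _)%E.
- transitivity (\int[dM]_p (Num.max (g p) 0)%:E)%E.
    by apply: eq_integral => p _; rewrite funepos.unlock EFin_max.
  rewrite T; last 3 first.
  + by apply: measurable_maxr => //; exact: measurable_cst.
  + by move=> p; rewrite le_max lexx orbT.
  + by move=> p nC; rewrite g0 // maxxx.
  apply: eq_integral => w _; rewrite funepos.unlock -EFin_max; congr EFin.
  by rewrite maxr_pMl // mul0r.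
transitivity (\int[dM]_p (Num.max (- g p) 0)%:E)%E.
  by apply: eq_integral => p _; rewrite funeneg.unlock EFin_max.
rewrite T; last 3 first.
+ by apply: measurable_maxr; [exact: measurableT_comp|exact: measurable_cst].
+ by move=> p; rewrite le_max lexx orbT.
+ by move=> p nC; rewrite g0 // oppr0 maxxx.
apply: eq_integral => w _; rewrite funeneg.unlock -EFinN -EFin_max; congr EFin.
by rewrite maxr_pMl // mul0r mulNr.
Qed.

(** * The divergence theorem by bump functions in cubes *)

Definition cube (u0 : 'rV[R]_3) r : set 'rV[R]_3 :=
  [set v | forall i, `[u0 0 i - r, u0 0 i + r]%classic (v 0 i)].

Lemma cube_compact u0 r : compact (cube u0 r).
Proof. by apply: (@rV_compact R 3 (fun i => `[u0 0 i - r, u0 0 i + r]%classic)) => i; exact: segment_compact. Qed.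

Lemma cube_closed u0 r : closed (cube u0 r).
Proof. apply: compact_closed; [exact: norm_hausdorff|exact: cube_compact]. Qed.

Let norm_close (x y : R) : 2 * `|x - y| < `|y| -> `|x| = Num.sg y * x.
Proof.
have [y0|y0|<-] := ltgtP 0 y.
- rewrite (gtr0_sg y0) (gtr0_norm y0) mul1r => xy; apply: ger0_norm.
  have := ler_norm (y - x); rewrite distrC; lra.
- rewrite (ltr0_sg y0) (ltr0_norm y0) mulN1r => xy; apply: ler0_norm.
  have := ler_norm (x - y); lra.
by rewrite subr0 normr0 => h; have := normr_ge0 x; lra.
Qed.

(** Within one chart, the signed density times the flux is the coordinate divergence of rho times
    density times field, whose components are of class C^1 with support in the cube. The closeness
    hypothesis forces the density to keep the sign it has at the centre. *)
Lemma local_flux_integral c u0 r rho (O : set M) : C1 rho -> 0 < r ->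
  cube u0 r `<=` dom (pchart c) ->
  (forall u, cube u0 r u -> 2 * `|cdens c u - cdens c u0| < `|cdens c u0|) ->
  open O -> (forall p, O p -> rho p = 0) ->
  (forall p, ~ O p -> exists2 u, cube u0 r u & p = param (pchart c) u) ->
  (\int[dM]_p (flux rho p)%:E = 0)%E.
Proof.
move=> Crho r0 sub close Oo rhoO supp.
pose a j := cdens c * @cfield c j.
pose Phi j u : R := rho (param (pchart c) u) * a j u.
have Uo := @dom_open _ _ At (pchart c).
have no : open (~` cube u0 r) by rewrite openC; exact: cube_closed.
have inO u : dom (pchart c) u -> ~ cube u0 r u -> O (param (pchart c) u).
  move=> Uu ncu; apply: contrapT => /supp[u' cu' pE]; apply: ncu.
  by rewrite -(paramK Uu) pE paramK //; exact: sub.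
have Phi0 j u : ~ cube u0 r u -> Phi j u = 0.
  move=> ncu; have [Uu|nU] := pselect (dom (pchart c) u).
    by rewrite /Phi rhoO ?mul0r //; exact: inO.
  by rewrite /Phi sf_off ?mulr0.
have Cdom j : Ck_on 1 (dom (pchart c)) (Phi j : _ -> R^o).
  by apply: Ck_onM; [exact: Uo|exact: Crho|exact: (@sf_smooth _ _ (a j) 1%N)].
have Cout j : Ck_on 1 (~` cube u0 r) (Phi j : _ -> R^o).
  apply: (@Ck_on_eq _ _ _ _ _ (cst 0)) => //; first by move=> u /(Phi0 j).
  exact: Ck_on_cst.
have reg j u : differentiable (Phi j : _ -> R^o) u /\
    {for u, continuous (fun v => 'D_(coordv R j) (Phi j : _ -> R^o) v : R^o)}.
  have [cu|ncu] := pselect (cube u0 r u).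
    by have [d D] := Cdom j; split; [apply: d; exact: sub|apply: (D (coordv R j)); exact: sub].
  by have [d D] := Cout j; split; [exact: d|exact: (D (coordv R j))].
pose g j (u : 'rV[R]_3) : R := 'D_(coordv R j) (Phi j : _ -> R^o) u.
have g0 j u : ~ cube u0 r u -> g j u = 0.
  move=> ncu; rewrite /g (near_eq_derive (g := cst 0 : _ -> R^o)) ?derive_cst //.
  by apply: (@open_near_eq _ _ _ (~` cube u0 r)) => // v /(Phi0 j).
have gc j : continuous (g j) by move=> u; exact: (reg j u).2.
have bnd j : exists C, forall u, `|g j u| <= C.
  have fc : {within cube u0 r, continuous (g j)} by exact: continuous_subspaceT.
  have /compact_bounded[B [_ Bb]] := continuous_compact fc (@cube_compact u0 r).
  exists (`|B| + 1) => u; have [cu|ncu] := pselect (cube u0 r u).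
    apply: (Bb (`|B| + 1)); last by exists u.
    by rewrite (le_lt_trans (ler_norm B)) // ltrDl.
  by rewrite g0 // normr0 addr_ge0.
pose L := `|u0 0 i0| + `|u0 0 i1| + `|u0 0 i2| + r + 1.
have [n0 [n1 n2]] : 0 <= `|u0 0 i0| /\ 0 <= `|u0 0 i1| /\ 0 <= `|u0 0 i2| by [].
have L0 : 0 < L by rewrite /L; lra.
have outL (u : 'rV[R]_3) j : L <= `|u 0 j| -> ~ cube u0 r u.
  move=> Lu cu; have := cu j; rewrite /= in_itv /= => /andP[ua ub].
  have uj : `|u 0 j - u0 0 j| <= r by rewrite ler_norml; lra.
  have uL : `|u0 0 j| <= L - r - 1.
    by rewrite /L; move: j {Lu ua ub uj}; refine (ord3P _ _ _); lra.
  have := ler_normD (u 0 j - u0 0 j) (u0 0 j); rewrite subrK; lra.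
have gL j (u : 'rV[R]_3) k : L <= `|u 0 k| -> Phi j u = 0 /\ g j u = 0.
  by move=> /outL ncu; split; [exact: Phi0|exact: g0].
have dPhi j (u : 'rV[R]_3) : derivable (Phi j : _ -> R^o) u (coordv R j).
  by apply: diff_derivable; exact: (reg j u).1.
have intg0 j : (\int[@lebesgue3 R]_w (g j (row3 w))%:E = 0)%E.
  have [C Cb] := bnd j.
  exact: (@integral_partial_derivative _ (Phi j) j L C L0 (dPhi j) (gc j) Cb (@gL j)).
have intg j : (@lebesgue3 R).-integrable setT (fun w => (g j (row3 w))%:E).
  have [C Cb] := bnd j.
  exact: (@integrable_partial_derivative _ (Phi j) j L C (gc j) Cb (@gL j)).
have sumE u : dom (pchart c) u -> \sig_j g j u = cdens c u * flux rho (param (pchart c) u).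
  move=> Uu; have gE j : g j u = 'D_(coordv R j) (rho \o param (pchart c) : _ -> R^o) u * a j u
      + rho (param (pchart c) u) * pder j (a j) u.
    have d1 : derivable (rho \o param (pchart c) : _ -> R^o) u (coordv R j).
      by apply: diff_derivable; exact: C1_differentiable.
    have d2 : derivable (a j : _ -> R^o) u (coordv R j) by exact: (@sfun_derivable _ (cdom c)).
    apply: etrans (deriveM d1 d2) _; rewrite addrC; congr (_ + _); first exact: mulrC.
    by congr (_ * _); apply: esym; exact: (@pderE _ (cdom c)).
  rewrite (eq_sum3 gE) (flux_chart (c := c)) //.
  have dv : \sig_j pder j (a j) u = cdens c u * amb_div (@cgrad c) (cpos c 0) u.
    apply: etrans (esym (sfun_sum3 (U := cdom c) (fun j => pder j (a j)) Uu)) _.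
    apply: etrans (congr1 (fun x : sfun (cdom c) => x u) (divergence_chart c)) _.
    exact: (@sfunM _ (cdom c)).
  have aE j : a j u = cdens c u * @cfield c j u by exact: (@sfunM _ (cdom c)).
  transitivity (rho (param (pchart c) u) * (\sig_j pder j (a j) u)
    + cdens c u * \sig_j @cfield c j u * 'D_(coordv R j) (rho \o param (pchart c) : _ -> R^o) u).
    rewrite -!sum3Ml -sum3D; apply: eq_sum3 => j; rewrite aE.
    by rewrite addrC; congr (_ + _); rewrite mulrC mulrA.
  by rewrite dv; move: (\sig_j _) => Z; ring.
apply: etrans (chart_transfer (c := c) (measurable_continuous (flux_continuous Crho)) _) _.
  move=> p ncp; apply: (flux_off Oo rhoO); apply: contrapT => /supp[u cu pE].
  by apply: ncp; rewrite pE; apply: param_cod; exact: sub.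
pose sg := Num.sg (cdens c u0).
(* On the cube the absolute value of the density is the constant sign [sg] times the density; off
   the cube both integrands vanish, so the integral may be extended to the whole space. *)
transitivity (\int[@lebesgue3 R]_w (sg%:E * ((g i0 (row3 w))%:E + (g i1 (row3 w))%:E
    + (g i2 (row3 w))%:E)))%E.
  rewrite [LHS]integral_mkcond; apply: eq_integral => w _; rewrite /patch.
  rewrite -!EFinD -EFinM; have [cu|ncu] := pselect (cube u0 r (row3 w)).
    rewrite mem_set; last exact: sub.
    congr EFin; rewrite (norm_close (close _ cu)) -/sg.
    by rewrite -[_ + _ + _]/(\sig_j g j (row3 w)) sumE; [ring|exact: sub].
  rewrite !g0 // !addr0 mulr0; case: ifPn => //; rewrite inE => Uw.
  by rewrite (flux_off Oo rhoO (inO _ Uw ncu)) mul0r.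
have i01 := integrableD measurableT (intg i0) (intg i1).
rewrite integralZl //; last exact: (integrableD measurableT i01 (intg i2)).
rewrite integralD // integralD // !intg0.
by rewrite !adde0 mule0.
Qed.

Hypothesis M_hausdorff : hausdorff_space M.
Hypothesis M_compact : compact [set: M].

Lemma nbhs_cube (u0 : 'rV[R]_3) (N : set 'rV[R]_3) : nbhs u0 N ->
  exists2 r, 0 < r & cube u0 r `<=` N.
Proof.
move=> /nbhs_ballP[d /= d0 db]; exists (d / 2); first by rewrite divr_gt0.
move=> u cu; apply: db; split; first exact: d0.
move=> i j; rewrite (ord1 i); have := cu j; rewrite /= in_itv /= => /andP[ua ub].
have h : `|u0 0 j - u 0 j| < d by rewrite ltr_norml; lra.
exact: h.
Qed.

Lemma good_cube c u0 N : dset (cdom c) u0 -> nbhs u0 N -> exists r,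
  [/\ 0 < r, cube u0 r `<=` dom (pchart c), cube u0 r `<=` N &
    forall u, cube u0 r u -> 2 * `|cdens c u - cdens c u0| < `|cdens c u0|].
Proof.
move=> Uu N0.
have cu : {for u0, continuous (cdens c : _ -> R^o)}.
  by exact: (@sf_smooth _ _ (cdens c) 0%N u0 Uu).
have N1 : nbhs u0 (dom (pchart c)).
  exact: (open_nbhs_nbhs (conj (@dom_open _ _ At (pchart c)) Uu)).
have d0 : 0 < `|cdens c u0| / 2 by rewrite divr_gt0 // normr_gt0 cdens_neq0.
have N2 : nbhs u0 (fun u => `|cdens c u0 - cdens c u| < `|cdens c u0| / 2).
  by move/cvgrPdist_lt : cu => /(_ _ d0).
have [r r0 sub] := nbhs_cube (filterI N0 (filterI N1 N2)).
exists r; split=> // u /sub[? [? h]] //.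
by move: h; rewrite distrC; lra.
Qed.

Lemma cube_measurable (u0 : 'rV[R]_3) r : measurable (@row3 R @^-1` cube u0 r).
Proof.
rewrite -[_ @^-1` _]setCK; apply: measurableC.
by apply: (@open_measurable3 R (~` cube u0 r)); rewrite openC; exact: cube_closed.
Qed.

Lemma cube_volume (u0 : 'rV[R]_3) r : 0 < r ->
  (@lebesgue3 R (@row3 R @^-1` cube u0 r) = ((2 * r) ^+ 3)%:E)%E.
Proof.
move=> r0; pose I j : set R := `[u0 0 j - r, u0 0 j + r]%classic.
have -> : @row3 R @^-1` cube u0 r = (I i0 `*` I i1) `*` I i2.
  apply/seteqP; split=> [[[x y] z] h|[[x y] z] [[h0 h1] h2]].
    by split; [split|]; [have := h i0|have := h i1|have := h i2]; rewrite /= mxE.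
  by move=> /=; refine (ord3P _ _ _); rewrite /= mxE.
have mI j : measurable (I j) by exact: measurable_itv.
have l j : @lebesgue_measure R (I j) = (2 * r)%:E.
  rewrite lebesgue_measure_itv /= lte_fin ifT; last by lra.
  by rewrite -EFinB; congr EFin; ring.
transitivity (((2 * r)%:E * (2 * r)%:E) * (2 * r)%:E)%E.
  rewrite -{1}(l i0) -{1}(l i1) -{1}(l i2).
  transitivity ((@lebesgue_measure R \x @lebesgue_measure R)%E (I i0 `*` I i1)
      * @lebesgue_measure R (I i2))%E.
    by apply: product_measure1E; [apply: measurableX; exact: mI|exact: mI].
  by congr (_ * _)%E; apply: product_measure1E; exact: mI.
by rewrite -!EFinM; congr EFin; ring.
Qed.

Lemma C1_continuous phi : C1 phi -> continuous phi.
Proof.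
move=> Cphi; apply: continuous_charts => c u Uu.
exact: (differentiable_continuous (C1_differentiable Cphi Uu)).
Qed.

Lemma superlevel_open (g : M -> R) a : continuous g -> open [set z | a < g z].
Proof.
by move=> gc; apply: (@open_comp _ _ g [set y | a < y]); [move=> z _; exact: gc|exact: open_gt].
Qed.

Lemma open_measurableM (O : set M) : open O ->
  measurable (O : set (g_sigma_algebraType (@open M))).
Proof. by move=> Oo; exact: sub_sigma_algebra. Qed.

Definition bump c (u0 : 'rV[R]_3) (r : R) (z : M) : R :=
  if `[< cod (pchart c) z >] then
    sqpos (r * r + -1 * \sum_i ((coord (pchart c) z 0 i + - u0 0 i)
                                * (coord (pchart c) z 0 i + - u0 0 i)))
  else 0.

Lemma bump_ge0 c u0 r z : 0 <= bump c u0 r z.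
Proof. by rewrite /bump; case: ifP => // _; exact: sqpos_ge0. Qed.

Lemma bump_center c u0 r : 0 < r -> dset (cdom c) u0 -> 0 < bump c u0 r (param (pchart c) u0).
Proof.
move=> r0 Uu; rewrite /bump asboolT; last exact: param_cod.
rewrite paramK // sqpos_gt0 big1; first by rewrite mulr0 addr0 mulr_gt0.
by move=> i _; rewrite subrr mulr0.
Qed.

Section Bump.
Variables (c : pointed_chart At) (u0 : 'rV[R]_3) (r : R).
Hypothesis r0 : 0 < r.
Hypothesis sub : cube u0 r `<=` dom (pchart c).
Let K : set M := param (pchart c) @` cube u0 r.

Lemma bump_off z : ~ K z -> bump c u0 r z = 0.
Proof.
move=> nK; rewrite /bump; case: asboolP => // Cz.
apply/eqP; rewrite eq_le sqpos_ge0 andbT leNgt sqpos_gt0; apply/negP => h; apply: nK.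
exists (coord (pchart c) z); last exact: coordK.
pose x i := coord (pchart c) z 0 i + - u0 0 i.
have p i : 0 <= x i * x i by rewrite -expr2 sqr_ge0.
have {}h : x i0 * x i0 + x i1 * x i1 + x i2 * x i2 < r * r.
  have : 0 < r * r + -1 * (x i0 * x i0 + x i1 * x i1 + x i2 * x i2) by move: h; rewrite sum3E.
  by move: (_ + _ + _) => y; lra.
have all i : - r <= x i <= r.
  apply: sqr_lt_itv => //; move: (p i0) (p i1) (p i2); move: i; refine (ord3P _ _ _);
  move: h; set a0 := x i0 * x i0; set a1 := x i1 * x i1; set a2 := x i2 * x i2; lra.
by move=> i; rewrite /= in_itv /=; have := all i; rewrite /x; lra.
Qed.

Let K_closed : closed K.
Proof.
apply: compact_closed => //; apply: continuous_compact; last exact: cube_compact.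
apply: continuous_in_subspaceT => u; rewrite inE => cu.
by apply: param_continuous; exact: sub.
Qed.

(** The domain of any other chart is covered by two open sets: where the first chart applies the
    explicit formula is C^1, and away from the image of the cube the function is 0. The image is
    closed, being compact in a Hausdorff space. *)
Lemma bump_C1 : C1 (bump c u0 r).
Proof.
move=> c'; pose U1 := dom c' `&` param c' @^-1` cod (pchart c).
pose U2 := dom c' `&` param c' @^-1` (~` K).
have U1o : open U1 by exact: overlap_open.
have U2o : open U2 by apply: param_preimage_open; rewrite openC; exact: K_closed.
have B1 : Ck_on 1 U1 (bump c u0 r \o param c' : _ -> R^o).
  pose t := coord (pchart c) \o param c'.
  have tC : Ck_on 1 U1 t by exact: (transition_smooth c' (pchart c) 1%N).
  have ti i : Ck_on 1 U1 (fun x => t x 0 i : R^o).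
    by have [h _] := @Ck_on_row R _ 3 1 U1 t U1o; exact: h tC i.
  have wi i : Ck_on 1 U1 (fun x => t x 0 i + - u0 0 i : R^o).
    apply: (@Ck_onD _ _ R^o 1 U1 (fun x => t x 0 i) (cst (- u0 0 i)) U1o (ti i)).
    exact: Ck_on_cst.
  have sq i := Ck_onM U1o (wi i) (wi i).
  have sm : Ck_on 1 U1 (fun x => \sum_i ((t x 0 i + - u0 0 i) * (t x 0 i + - u0 0 i)) : R^o).
    exact: (@Ck_on_sum _ _ R^o 1 U1 _ _ _ U1o sq).
  have [S [SC SE]] : exists S : 'rV[R]_3 -> R^o, Ck_on 1 U1 S /\
      forall x, S x = \sum_i ((t x 0 i + - u0 0 i) * (t x 0 i + - u0 0 i)).
    by exists (fun x => \sum_i ((t x 0 i + - u0 0 i) * (t x 0 i + - u0 0 i)) : R^o).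
  have mC := Ck_onM U1o (@Ck_on_cst _ _ R^o 1 U1 (-1)) SC.
  have qC := Ck_onD U1o (@Ck_on_cst _ _ R^o 1 U1 (r * r)) mC.
  apply: (Ck_on_eq U1o _ (Ck1_sqpos U1o qC)) => u [Uu Cu].
  change (sqpos (r * r + -1 * S u) = bump c u0 r (param c' u)).
  by rewrite SE /bump asboolT.
have B2 : Ck_on 1 U2 (bump c u0 r \o param c' : _ -> R^o).
  apply: (@Ck_on_eq _ _ _ _ _ (cst 0)) => //; last exact: Ck_on_cst.
  by move=> u [_ nK]; rewrite /= bump_off.
have pick u : dom c' u -> U1 u \/ U2 u.
  move=> Uu; have [Cu|nC] := pselect (cod (pchart c) (param c' u)); [by left|right].
  by split=> // -[v cv vE]; apply: nC; rewrite -vE; apply: param_cod; exact: sub.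
have [d1 D1] := B1; have [d2 D2] := B2; split=> [u Uu|v u Uu].
  by have [h|h] := pick u Uu; [exact: d1|exact: d2].
by have [h|h] := pick u Uu; [exact: (D1 v u h)|exact: (D2 v u h)].
Qed.

Hypothesis close : forall u, cube u0 r u -> 2 * `|cdens c u - cdens c u0| < `|cdens c u0|.

(** The set lies in the image of the cube, where the density is below twice its absolute value at
    the centre. *)
Lemma bump_volume : (dM [set z | (0 < bump c u0 r z)%R] < +oo)%E.
Proof.
set V := [set z | _].
have Vo : open V by apply: superlevel_open; apply: C1_continuous; exact: bump_C1.
have VK z : V z -> K z by rewrite /V /= => h; apply: contrapT => /bump_off e0; move: h; rewrite e0 ltxx.
have VC : V `<=` cod (pchart c).
  by move=> z /VK[u cu <-]; apply: param_cod; exact: sub.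
rewrite (dM_volume (open_measurableM Vo) VC); set E := [set x | _].
have mE : measurable E.
  by apply: (@open_measurable3 R (dom (pchart c) `&` param (pchart c) @^-1` V)); exact: param_preimage_open.
have Ecube w : E w -> cube u0 r (row3 w).
  by move=> [Dw /VK[u cu uE]]; rewrite -(paramK Dw) -uE paramK //; exact: sub.
have IE : (\int[@lebesgue3 R]_(w in E) (Num.sqrt (\det (metric (F (pchart c)) (row3 w))))%:E
    = \int[@lebesgue3 R]_(w in E) (`|cdens c (row3 w)|)%:E)%E.
  by apply: eq_integral => w; rewrite inE => -[Dw _]; congr EFin; exact: volume_density.
suff : (\int[@lebesgue3 R]_(w in E) (`|cdens c (row3 w)|)%:E < +oo)%E.
  by rewrite -IE => h; exact: h.
have mJ : measurable_fun E (fun w => (`|cdens c (row3 w)|)%:E).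
  apply/measurable_EFinP; apply: measurable_funS (@density_measurable c).
    by apply: open_measurable3; exact: dom_open.
  by move=> w [].
apply: (@le_lt_trans _ _ (\int[@lebesgue3 R]_(w in E) (cst (2 * `|cdens c u0|)%:E) w)%E).
  apply: ge0_le_integral => //.
  move=> w /Ecube/close h; rewrite lee_fin.
  have := ler_normD (cdens c (row3 w) - cdens c u0) (cdens c u0).
  by rewrite subrK; have := normr_ge0 (cdens c u0); lra.
rewrite integral_cst //; apply: lte_mul_pinfty; rewrite ?lee_fin ?mulr_ge0 //.
apply: (@le_lt_trans _ _ (@lebesgue3 R (@row3 R @^-1` cube u0 r))).
  by apply: le_measure; rewrite ?inE //; exact: cube_measurable.
by rewrite [X in (X < _)%E](_ : _ = ((2 * r) ^+ 3)%:E) ?ltry //; exact: cube_volume.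
Qed.

Lemma bump_flux rho : C1 rho -> (forall z, bump c u0 r z = 0 -> rho z = 0) ->
  (\int[dM]_p (flux rho p)%:E = 0)%E.
Proof.
move=> Crho rho0.
apply: (@local_flux_integral c u0 r rho (~` K)) => //.
- by rewrite openC; exact: K_closed.
- by move=> p /bump_off; exact: rho0.
by move=> p /contrapT[u cu <-]; exists u.
Qed.

End Bump.

(** All that the gluing needs to know of a bump function; the last clause is the divergence theorem
    for functions that vanish wherever b does. *)
Definition local_bump b := [/\ C1 b, forall z, 0 <= b z, (dM [set z | (0 < b z)%R] < +oo)%E &
  forall rho, C1 rho -> (forall z, b z = 0 -> rho z = 0) -> (\int[dM]_p (flux rho p)%:E = 0)%E].

Lemma local_bump_at p : exists b, local_bump b /\ 0 < b p.
Proof.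
have Uu := coord_dom (chart_atP At p); set u := coord _ _ in Uu.
have [r [r0 sub _ close]] := @good_cube (pAt p) u setT Uu filterT.
exists (bump (pAt p) u r); split; last first.
  by have := @bump_center (pAt p) u r r0 Uu; rewrite pAtK.
split; [exact: bump_C1|exact: bump_ge0|exact: bump_volume|].
by move=> rho; exact: bump_flux.
Qed.

Lemma C1_cst (a : R) : C1 (fun=> a).
Proof. by move=> c; exact: Ck_on_cst. Qed.

Lemma C1D a b : C1 a -> C1 b -> C1 (fun z => a z + b z).
Proof.
by move=> Ca Cb c; exact: (@Ck_onD _ _ R^o 1 _ (a \o param c) (b \o param c) (@dom_open _ _ At c) (Ca c) (Cb c)).
Qed.

Lemma C1M a b : C1 a -> C1 b -> C1 (fun z => a z * b z).
Proof.
by move=> Ca Cb c; exact: (@Ck_onM _ _ 1 _ (a \o param c) (b \o param c) (@dom_open _ _ At c) (Ca c) (Cb c)).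
Qed.

Lemma C1V a : (forall z, a z != 0) -> C1 a -> C1 (fun z => (a z)^-1).
Proof.
move=> a0 Ca c; apply: (@Ck1_inv _ _ _ (@dom_open _ _ At c) (a \o param c)); last exact: Ca.
by move=> u _; exact: a0.
Qed.

Lemma C1_sum (I : Type) (s : seq I) (b : I -> M -> R) : (forall i, C1 (b i)) ->
  C1 (fun z => \sum_(i <- s) b i z).
Proof.
move=> Cb c; apply: (@Ck_on_sum _ _ R^o 1 _ _ s (fun i => b i \o param c)).
  exact: dom_open.
by move=> i; exact: Cb.
Qed.

Lemma finite_bump_cover : exists (s : seq M) (b : M -> M -> R),
  (forall p, local_bump (b p)) /\ forall z, 0 < \sum_(p <- s) b p z.
Proof.
have [b bP] := boolp.choice local_bump_at.
have Cb p : C1 (b p) by have [[]] := bP p.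
have b0 p z : 0 <= b p z by have [[_ h _ _] _] := bP p; exact: h.
move: M_compact; rewrite compact_cover => cc.
have [|z _|D' _ cov] := cc M setT (fun p => [set z | 0 < b p z]).
- by move=> p _; apply: superlevel_open; exact: C1_continuous.
- by exists z => //=; exact: (bP z).2.
exists (finmap.enum_fset D'), b; split; first by move=> p; exact: (bP p).1.
move=> z; have [p /= pD bz] := cov z I.
rewrite (big_rem p) //=.
have : 0 <= \sum_(q <- rem p (finmap.enum_fset D')) b q z by apply: sumr_ge0 => q _; exact: b0.
by move: (\sum_(q <- _) _) bz => x; lra.
Qed.

Lemma volume_finite : (dM [set: M] < +oo)%E.
Proof.
have [s [b [bP B0]]] := finite_bump_cover.
have Cb p : C1 (b p) by have [] := bP p.
have fin (l : seq M) : (dM [set z | (0 < \sum_(p <- l) b p z)%R] < +oo)%E.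
  elim: l => [|p l IH].
    rewrite (_ : [set z | _] = set0) ?measure0 //.
    by apply/seteqP; split=> // z /=; rewrite big_nil ltxx.
  have [_ _ fp _] := bP p.
  have mp := open_measurableM (superlevel_open 0 (C1_continuous (Cb p))).
  have ml := open_measurableM (superlevel_open 0 (C1_continuous (C1_sum l Cb))).
  have mpl := open_measurableM (superlevel_open 0 (C1_continuous (C1_sum (p :: l) Cb))).
  apply: (@le_lt_trans _ _ (dM ([set z | (0 < b p z)%R] `|` [set z | (0 < \sum_(p <- l) b p z)%R]))).
    apply: le_measure; rewrite ?inE //; first exact: measurableU.
    move=> z /=; rewrite big_cons; case: (ltP 0 (b p z)) => [?|bz]; first by left.
    by move=> h; right; move: h; move: (\sum_(q <- _) _) bz => x; lra.
  by apply: le_lt_trans (measureU2 _ mp ml) _; exact: lte_add_pinfty.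
have := fin s; rewrite (_ : [set z | _] = setT) //.
by apply/seteqP; split=> // z _ /=; exact: B0.
Qed.

Lemma continuous_integrable (g : M -> R) : continuous g -> dM.-integrable setT (EFin \o g).
Proof.
move=> gc; have [C Cb] : exists C, forall z, `|g z| <= C.
  have fc : {within [set: M], continuous g} by exact: continuous_subspaceT.
  have /compact_bounded[B [_ Bb]] := continuous_compact fc M_compact.
  exists (`|B| + 1) => z; apply: (Bb (`|B| + 1)); last by exists z.
  by rewrite (le_lt_trans (ler_norm B)) // ltrDl.
apply: (@bounded_support_integrable R _ _ dM g setT C) => //; first exact: volume_finite.
  exact: measurable_continuous.
by move=> x /(_ I).
Qed.

Lemma fluxD a b p : C1 a -> C1 b -> flux (fun z => a z + b z) p = flux a p + flux b p.
Proof.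
move=> Ca Cb; have Uu := coord_dom (chart_atP At p); set u := coord _ _ in Uu.
suff H : flux (fun z => a z + b z) (param (pchart (pAt p)) u)
    = flux a (param (pchart (pAt p)) u) + flux b (param (pchart (pAt p)) u).
  by move: H; rewrite pAtK.
set c := pAt p in Uu *.
apply: etrans (flux_chart (c := c) (C1D Ca Cb) Uu) _.
rewrite (flux_chart (c := c) Ca Uu) (flux_chart (c := c) Cb Uu).
have dd j : 'D_(coordv R j) ((fun z => a z + b z) \o param (pchart c) : _ -> R^o) u =
    'D_(coordv R j) (a \o param (pchart c) : _ -> R^o) u
    + 'D_(coordv R j) (b \o param (pchart c) : _ -> R^o) u.
  apply: (@deriveD _ _ R^o (a \o param (pchart c)) (b \o param (pchart c)));
  by apply: diff_derivable; exact: C1_differentiable.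
rewrite (eq_sum3 (G := fun j => @cfield c j u * 'D_(coordv R j) (a \o param (pchart c) : _ -> R^o) u
  + @cfield c j u * 'D_(coordv R j) (b \o param (pchart c) : _ -> R^o) u)); last first.
  by move=> j; rewrite dd mulrDr.
by rewrite sum3D; cbv beta; rewrite mulrDl addrACA.
Qed.

Lemma flux1 p : flux (fun=> 1) p = div_field p.
Proof.
rewrite /flux mul1r /along_field big1 ?addr0 // => x _.
suff -> : gradM x (fun=> 1) p = 0 by rewrite mulr0.
apply: etrans (grad_atE _ _ _ _) _.
transitivity (\sig_i (fun=> 0 : R) i); last by rewrite /sum3 !addr0.
apply: eq_sum3 => i; rewrite [X in X * _](_ : _ = 0) ?mul0r //.
exact: derive_cst.
Qed.

Lemma div_field_continuous : continuous div_field.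
Proof. by rewrite -(funext flux1); apply: flux_continuous; exact: C1_cst. Qed.

(** Normalized by their positive sum, finitely many bumps add up to 1. Since [flux] is additive and
    [flux] of 1 is the divergence, the integral splits into integrals that vanish. *)
Lemma integral_div_field : (\int[dM]_p (div_field p)%:E = 0)%E.
Proof.
have [s [b [bP B0]]] := finite_bump_cover.
have Cb p : C1 (b p) by have [] := bP p.
have Bn z : \sum_(p <- s) b p z != 0 by rewrite lt0r_neq0.
pose rho p z := b p z * (\sum_(q <- s) b q z)^-1.
have Crho p : C1 (rho p) by apply: C1M => //; apply: C1V => //; exact: C1_sum.
have rhoI p : (\int[dM]_z (flux (rho p) z)%:E = 0)%E.
  by have [_ _ _ h] := bP p; apply: h => // z bz; rewrite /rho bz mul0r.
have S l : (\int[dM]_z (flux (fun y => \sum_(p <- l) rho p y) z)%:E = 0)%E.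
  elim: l => [|p l IH].
    transitivity (\int[dM]_z (cst 0%E : M -> \bar R) z)%E; last exact: integral0.
    apply: eq_integral => z _; congr EFin; apply: (@flux_off _ setT) => //; first exact: openT.
    by move=> y _; rewrite big_nil.
  transitivity (\int[dM]_z ((flux (rho p) z)%:E + (flux (fun y => \sum_(q <- l) rho q y) z)%:E))%E.
    apply: eq_integral => z _; rewrite -EFinD; congr EFin; rewrite -fluxD //; last exact: C1_sum.
    by congr (flux _ z); apply/funext => y; rewrite big_cons.
  rewrite integralD //; first by rewrite rhoI IH adde0.
    by apply: continuous_integrable; exact: flux_continuous.
  by apply: continuous_integrable; apply: flux_continuous; exact: C1_sum.
rewrite -(S s); apply: eq_integral => z _; congr EFin; rewrite -flux1; congr (flux _ z).
by apply/funext => y; rewrite /rho -mulr_suml mulfV.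
Qed.

Lemma integral_bound : (\int[dM]_p
  (13 / 180 * grad_normsq At f (s_fun f e) p + 1 / 180 * (s_fun f e p * T_normsq f e p)
   + Ffun (s_fun f e p) (q_fun f e p) (r_fun f e p))%:E <= 0)%E.
Proof.
have h := integral_mono dM integrand_le.
suff e0 : (\int[dM]_p (1 / 72 * div_field p)%:E = 0)%E by apply: le_trans h _; rewrite e0.
transitivity (\int[dM]_p ((1 / 72)%:E * (div_field p)%:E))%E.
  by apply: eq_integral => p _; rewrite -EFinM.
rewrite integralZl //; first by rewrite integral_div_field mule0.
exact: continuous_integrable div_field_continuous.
Qed.

(** V contains the image of a small cube on which the density exceeds half its absolute value at the
    centre. *)
Lemma open_volume_gt0 c u (V : set M) : open V -> V `<=` cod (pchart c) -> dset (cdom c) u ->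
  V (param (pchart c) u) -> (0 < dM V)%E.
Proof.
move=> Vo VC Uu Vu.
have Eo := @param_preimage_open (pchart c) V Vo.
have [r [r0 sub subV close]] := good_cube Uu (open_nbhs_nbhs (conj Eo (conj Uu Vu))).
rewrite (dM_volume (open_measurableM Vo) VC); set E := [set x | _].
have mE : measurable E by exact: (@open_measurable3 R _ Eo).
have mW := @cube_measurable u r; set W := _ @^-1` _ in mW.
have WE : W `<=` E by move=> w /subV.
have mJ : measurable_fun E (fun w => (`|cdens c (row3 w)|)%:E).
  apply/measurable_EFinP; apply: measurable_funS (@density_measurable c).
    by apply: open_measurable3; exact: dom_open.
  by move=> w [].
have IE : (\int[@lebesgue3 R]_(w in E) (Num.sqrt (\det (metric (F (pchart c)) (row3 w))))%:E
    = \int[@lebesgue3 R]_(w in E) (`|cdens c (row3 w)|)%:E)%E.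
  by apply: eq_integral => w; rewrite inE => -[Dw _]; congr EFin; exact: volume_density.
suff : (0 < \int[@lebesgue3 R]_(w in E) (`|cdens c (row3 w)|)%:E)%E.
  by rewrite -IE => h; exact: h.
have k0 : 0 < `|cdens c u| / 2 by rewrite divr_gt0 // normr_gt0 cdens_neq0.
apply: (@lt_le_trans _ _ (\int[@lebesgue3 R]_(w in W) (cst (`|cdens c u| / 2)%:E) w)%E).
  rewrite integral_cst // [X in (_ < _ * X)%E](_ : _ = ((2 * r) ^+ 3)%:E); last exact: cube_volume.
  by rewrite -EFinM lte_fin mulr_gt0 // exprn_gt0 // mulr_gt0.
apply: (@le_trans _ _ (\int[@lebesgue3 R]_(w in W) (`|cdens c (row3 w)|)%:E)%E).
  apply: ge0_le_integral => //.
  - by move=> w _; rewrite lee_fin ltW.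
  - exact: measurable_funS mJ.
  move=> w /close h; rewrite lee_fin.
  by have := ler_normB (cdens c (row3 w)) (cdens c (row3 w) - cdens c u); rewrite subKr; lra.
by apply: ge0_subset_integral => // w _; rewrite lee_fin.
Qed.

Lemma integral_eq0_continuous (g : M -> R) : continuous g -> (forall p, 0 <= g p) ->
  (\int[dM]_p (g p)%:E = 0)%E -> forall p, g p = 0.
Proof.
move=> gc g0 Ig p; apply/eqP; rewrite eq_le g0 andbT leNgt; apply/negP => gp.
have Uu := coord_dom (chart_atP At p).
pose m := g p / 2; have m0 : 0 < m by rewrite divr_gt0.
pose V := [set z | m < g z] `&` cod (chart_at At p).
have Vo : open V by apply: openI; [exact: superlevel_open|exact: cod_open].
have mV := open_measurableM Vo.
have VV : (0 < dM V)%E.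
  apply: (@open_volume_gt0 (pAt p) _ V Vo _ Uu) => [z []//|].
  by rewrite pAtK; split; [rewrite /= /m; lra|exact: chart_atP].
have mg := measurable_continuous gc.
have : (0 < m%:E * dM V)%E by rewrite mule_gt0.
rewrite ltNge => /negP; apply; rewrite -(integral_cst dM mV) -Ig.
apply: (@le_trans _ _ (\int[dM]_(z in V) (g z)%:E)%E).
  apply: ge0_le_integral => //.
  - by move=> z _; rewrite lee_fin ltW.
  - by apply/measurable_EFinP; exact: measurable_funS mg.
  by move=> z [/= mz _]; rewrite lee_fin ltW.
apply: ge0_subset_integral => //; first by apply/measurable_EFinP.
by move=> z _; rewrite lee_fin.
Qed.

(** * Vanishing of T when F is nonnegative *)

Section Rigidity.
Hypothesis F_ge0 : forall p, 0 <= Ffun (s_fun f e p) (q_fun f e p) (r_fun f e p).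

Let str1_at c u (Uu : dset (cdom c) u) :
  str1 (csff c) u = str1 (fun i j k => csff c i j k u).
Proof. by rewrite (sfunE Uu) rmorph_str1. Qed.

Let sT_le c u : dset (cdom c) u -> 0 <= 1 / 180 * (str1 (csff c) u
    * normsq4 (fun a b k l => ccov c a b k l u)) <= 1 / 72 * div_field (param (pchart c) u).
Proof.
move=> Uu; have [g g0] := chart_le Uu.
rewrite (Tcomp_normsq (@chart_smooth c) (@chart_sphere c) (chart_frame c) (@chart_lagrangian c) Uu).
have sE : s_fun f e (param (pchart c) u) = str1 (csff c) u by exact: (@s_fun_chart c u Uu).
have := F_ge0 (param (pchart c) u); move: (Ffun _ _ _) => fF fF0; rewrite sE => le.
apply/andP; split.
  by apply: mulr_ge0; [lra|apply: mulr_ge0; [rewrite (str1_at Uu); exact: str1_ge0|exact: normsq4_ge0]].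
apply: le_trans le; set x := 1 / 180 * _.
have : 0 <= 13 / 180 * g by apply: mulr_ge0 => //; lra.
by move: (13 / 180 * g) => y; rewrite -/x; lra.
Qed.

Let div_field0 : forall p, div_field p = 0.
Proof.
apply: integral_eq0_continuous => [|p|]; [exact: div_field_continuous| |exact: integral_div_field].
have := @sT_le (pAt p) _ (coord_dom (chart_atP At p)); rewrite pAtK => /andP[h1 h2].
by have := le_trans h1 h2; rewrite pmulr_rge0 //; lra.
Qed.

Lemma ccov_eq0 c a b k l : ccov c a b k l = 0.
Proof.
apply: sfun_eq => u Uu; rewrite sfun0 //; apply: contrapT => nz.
pose t := ccov c a b k l.
have sT0 v : dset (cdom c) v -> str1 (csff c) v
    * normsq4 (fun a b k l => ccov c a b k l v) = 0.
  by move=> /sT_le; rewrite div_field0 mulr0; move: (_ * normsq4 _) => y; lra.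
have cu : {for u, continuous (t : _ -> R^o)} by exact: (@sf_smooth _ _ t 0%N u Uu).
have t0 : 0 < `|t u| by rewrite normr_gt0; apply/eqP.
have N1 : nbhs u (dom (pchart c)).
  exact: (open_nbhs_nbhs (conj (@dom_open _ _ At (pchart c)) Uu)).
have N2 : nbhs u (fun v => `|t u - t v| < `|t u|) by move/cvgrPdist_lt : cu => /(_ _ t0).
have h0 : \near u, forall x y z, csff c x y z u = 0.
  apply: filterS (filterI N1 N2) => v [Uv tv].
  have tv0 : t v != 0 by apply/eqP => tz; move: tv; rewrite tz subr0 ltxx.
  have /eqP := sT0 v Uv; rewrite mulf_eq0 => /orP[/eqP|/eqP n0].
    by rewrite (str1_at Uv) => /str1_eq0 e0 x y z; have := congr1 (fun h => h x y z) e0.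
  by case/eqP: tv0; exact: (normsq4_eq0 n0 a b k l).
have hu x y z : csff c x y z u = 0 by have := nbhs_singleton h0; exact.
(* T is the frame derivative of h minus the action of the connection on h, and h vanishes on a whole
   neighbourhood of u. *)
apply: nz; transitivity ((cder l (csff c a b k) - act3 (tconn (conn7 (@cder c) (cvec c))
   (tau7 (cpos c) (cvec c) (chart_twelfth (cdom c))) l) (csff c) a b k) u) => //.
rewrite (sfunE Uu) rmorphB rmorph_act3_eq0 //.
rewrite subr0; apply: etrans (chart_derE (chart_frame c) l (csff c a b k) Uu) _.
rewrite (near_eq_derive (g := cst 0 : _ -> R^o)) ?derive_cst //.
by apply: filterS h0 => v; exact.
Qed.

(** The statement allows arbitrary smooth fields; they are expanded in the frame with smooth
    coefficients, in which T is trilinear. *)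
Lemma chart_T_vanishes : T_vanishes At f.
Proof.
move=> c0 X Y Z Xs Ys Zs u Uu; pose c := PointedChart Uu.
have Uo := dset_open (cdom c).
have rX (W : 'rV[R]_3 -> 'rV[R]_3) : smooth_on (dom c0) W -> exists x, repX (U := cdom c) (e c0) W x.
  move=> Ws; have en l : smooth_on (cdom c) (fun v => W v 0 l : R^o).
    by move=> k; have [h _] := @Ck_on_row R _ 3 k (cdom c) W Uo; exact: h (Ws k) l.
  pose G := frame_dual (@chart_smooth c) (chart_frame c).
  exists (fun a => \sig_l mksfun (en l) * G l a) => v Uv.
  have GE l : delta_mx 0 l = \sig_a G l a v *: e c0 a v.
    exact: (repX_coord (@chart_smooth c) (chart_frame c) l Uv).
  rewrite [LHS](row_sum_delta (W v)) sum3E.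
  rewrite (eq_sum3 (G := fun l => W v 0 l *: \sig_a G l a v *: e c0 a v)); last by move=> l; rewrite GE.
  rewrite [RHS](eq_sum3 (G := fun a => (\sig_l W v 0 l * G l a v) *: e c0 a v)); last first.
    move=> a; congr (_ *: _); apply: etrans (sfun_sum3 _ Uv) _; apply: eq_sum3 => l.
    by apply: etrans (sfunM _ _ Uv) _; congr (_ * _); exact: cutE.
  exact: lin3_exchange.
have [x xX] := rX X Xs; have [y yY] := rX Y Ys; have [z zZ] := rX Z Zs.
apply/rowP => j; rewrite [RHS]mxE.
apply: etrans (Ttensor_rep (@chart_smooth c) (@chart_sphere c) (chart_frame c)
  (@chart_lagrangian c) xX yY zZ j Uu) _.
have t0 l i k m : ccov c i k m l = 0 by exact: ccov_eq0.
apply: etrans (congr1 (fun w : 'rV[sfun (cdom c)]_7 => w 0 j u) (lin7_tri3_eq0 _ _ _ _ t0)) _.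
have z0 : (0 : 'rV[sfun (cdom c)]_7) 0 j = 0 by rewrite mxE.
by apply: etrans (congr1 (fun a : sfun (cdom c) => a u) z0) _; exact: sfun0.
Qed.

End Rigidity.

End Global.

Theorem proposition3p1 (R : realType) (M : ptopologicalType) (A : atlas3 R M)
    (M_hausdorff : hausdorff_space M) (M_compact : compact [set: M])
    (f : M -> 'rV[R]_7) (f_immersion : immersion_in_S6 A f)
    (f_lagrangian : lagrangian A f)
    (e : chart A -> 'I_3 -> 'rV[R]_3 -> 'rV[R]_3)
    (e_frames : orthonormal_frames f e)
    (dM : {measure set (g_sigma_algebraType (@open M)) -> \bar R})
    (dM_volume : riemannian_volume A f dM) :
  let s := s_fun f e in
  let q := q_fun f e in
  let r := r_fun f e in
  (0 >= \int[dM]_p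
     (13 / 180 * grad_normsq A f s p + 1 / 180 * (s p * T_normsq f e p)
      + Ffun (s p) (q p) (r p))%:E)%E
  /\ (connected [set: M] -> (forall p, 0 <= Ffun (s p) (q p) (r p)) ->
      T_vanishes A f).
Proof.
cbv zeta; split; first by eapply integral_bound; eassumption.
by move=> _ F0; eapply chart_T_vanishes; eassumption.
Qed.
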